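(* Let $1/2<\alpha<1$, $\nu\ge0$, and let $L$ be the 2D linear Navier-Stokes operator ($\nu>0$; linear Euler operator for $\nu=0$) at the shear $\Omega_*=\cos x_2$ on the rectangular periodic domain $[0,2\pi/\alpha]\times[0,2\pi]$, which decouples into its restrictions to the invariant subspaces spanned by the Fourier modes $\{\hat k+np\}_{n\in\mathbb{Z}}$, $p=(0,1)^T$, $\hat k=(\hat k_1,\hat k_2)^T\in\mathbb{Z}^2\setminus\{0\}$. The spectra of $L$ have the following properties (in items 1-3, for the restriction of $L$ to the subspace labelled by the indicated $\hat k$). 1. Suppose $(\alpha\hat k_1)^2+(\hat k_2+n)^2>1$ for all $n\in\mathbb{Z}$. When $\nu>0$, there is no eigenvalue of non-negative real part. When $\nu=0$, the entire spectrum is the continuous spectrum $\left[-i\frac{\alpha|\hat k_1|}{2},\ i\frac{\alpha|\hat k_1|}{2}\right]$. 2. Suppose $\hat k_1=0$, $\hat k_2=1$. The spectrum consists of the eigenvalues $\lambda=-\nu n^2$, $n\in\mathbb{Z}\setminus\{0\}$. The eigenfunctions are the Fourier modes $\tilde\omega_{np}e^{inx_2}+\text{c.c.}$, for all $\tilde\omega_{np}\in\mathbb{C}$, $n\in\mathbb{Z}\setminus\{0\}$. As $\nu\to0^+$, the eigenvalues are dense on the negative half of the real axis $(-\infty,0]$. Setting $\nu=0$, the only eigenvalue is $\lambda=0$, of infinite multiplicity, with the same eigenfunctions. 3. Suppose $\hat k_1=-1$, $\hat k_2=0$. (a) $\nu>0$. For any $\alpha\in(0.5,0.95)$ there is a unique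 $\nu_*(\alpha)$, $$\frac{\sqrt{32-3\alpha^6-17\alpha^4-16\alpha^2}}{4(\alpha^2+1)(\alpha^2+4)}<\nu_*(\alpha)<\frac{1}{2(\alpha^2+1)}\sqrt{\frac{1-\alpha^2}{2}},$$ where the term under the square root on the left is positive for $\alpha\in(0.5,0.95)$ and the left term is always less than the right term, such that the following holds. When $\nu>\nu_*(\alpha)$, there is no eigenvalue of non-negative real part. When $\nu=\nu_*(\alpha)$, $\lambda=0$ is an eigenvalue, and all the rest eigenvalues have negative real parts. When $\nu<\nu_*(\alpha)$, there is a unique positive eigenvalue $\lambda(\nu)>0$, and all the rest eigenvalues have negative real parts. $\nu^{-1}\lambda(\nu)$ is a strictly monotonically decreasing function of $\nu$. When $\alpha\in(0.5,0.8469)$, we have the estimate $$\sqrt{\frac{\alpha^2(1-\alpha^2)}{8(\alpha^2+1)}-\frac{\alpha^4(\alpha^2+3)}{16(\alpha^2+1)(\alpha^2+4)}}-\nu(\alpha^2+1)<\lambda(\nu)<\sqrt{\frac{\alpha^2(1-\alpha^2)}{8(\alpha^2+1)}}-\nu\alpha^2,$$ where the term under the square root on the left is positive for $\alpha\in(0.5,0.8469)$, and $$\sqrt{\frac{\alpha^2(1-\alpha^2)}{8(\alpha^2+1)}-\frac{\alpha^4(\alpha^2+3)}{16(\alpha^2+1)(\alpha^2+4)}}\le\lim_{\nu\to0^+}\lambda(\nu)\le\sqrt{\frac{\alpha^2(1-\alpha^2)}{8(\alpha^2+1)}}.$$ In particular, as $\nu\to0^+$, $\lambda(\nu)=O(1)$.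 (b) $\nu=0$. When $\alpha\in(0.5,0.8469)$, there are only two eigenvalues $\lambda_0$ and $-\lambda_0$, where $\lambda_0$ is positive, $$\sqrt{\frac{\alpha^2(1-\alpha^2)}{8(\alpha^2+1)}-\frac{\alpha^4(\alpha^2+3)}{16(\alpha^2+1)(\alpha^2+4)}}<\lambda_0<\sqrt{\frac{\alpha^2(1-\alpha^2)}{8(\alpha^2+1)}}.$$ The rest of the spectrum is a continuous spectrum $[-i\alpha/2,\ i\alpha/2]$. (c) For any fixed $\alpha\in(0.5,0.8469)$, $\lim_{\nu\to0^+}\lambda(\nu)=\lambda_0$. 4. Finally, when $\nu=0$, the union of the continuous spectra $\left[-i\frac{\alpha|\hat k_1|}{2},\ i\frac{\alpha|\hat k_1|}{2}\right]$, over all $\hat k\in\mathbb{Z}^2\setminus\{0\}$ with $(\alpha\hat k_1)^2+(\hat k_2+n)^2>1$ for all $n\in\mathbb{Z}$, together with the continuous spectrum $[-i\alpha/2,\ i\alpha/2]$ for $\hat k=(-1,0)^T$, is the imaginary axis $i\mathbb{R}$.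
   Context: On the domain $[0,2\pi/\alpha]\times[0,2\pi]$ mean-zero periodic vorticities are expanded as $\Omega=\sum_{k\in\mathbb{Z}^2\setminus\{0\}}\omega_ke^{i[\alpha k_1x_1+k_2x_2]}$. With $p=(0,1)^T$ the steady state is $\Omega_*=\cos x_2=\Gamma e^{ix_2}+\bar\Gamma e^{-ix_2}$, $\Gamma=1/2$. For fixed $\hat k\in\mathbb{Z}^2\setminus\{0\}$ put $\kappa_n=(\alpha\hat k_1)^2+(\hat k_2+n)^2$ and $\rho_n=1-\kappa_n^{-1}$. The linear operator $L$ is defined in Fourier modes by $$(L\omega)_{\hat k+np}=\frac{\alpha\hat k_1}{4}\left(\rho_{n-1}\,\omega_{\hat k+(n-1)p}-\rho_{n+1}\,\omega_{\hat k+(n+1)p}\right)-\nu\kappa_n\,\omega_{\hat k+np},\qquad n\in\mathbb{Z},$$ (the zero mode, which occurs only when $\hat k_1=0$, is excluded; the coupling terms then vanish). Equivalently, with $a=-\alpha\hat k_1/4$ and $z_n=\rho_n\omega_{\hat k+np}$ (when $\hat k_1\ne0$ and all $\rho_n\neq 0$), the eigenvalue equation is $a_nz_n+z_{n-1}-z_{n+1}=0$ with $$a_n=-\frac{4}{\alpha\hat k_1}\,\frac{\kappa_n}{\kappa_n-1}\,(\lambda+\nu\kappa_n).$$ Spectra are taken in the Sobolev space $H^\ell$ of mean-zero functions, $\ell$ any natural number. ''c.c.'' denotes complex conjugate. In item 2, ''dense as $\nu\to0^+$'' means that every point of $(-\infty,0]$ is a limit, as $\nu\to0^+$, of eigenv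alues.
   Formalization: ''Continuous spectrum'' means L - λ is injective with unbounded inverse on H^ℓ and range dense in the L² norm; density in H^ℓ, the usual requirement, fails for ℓ ≥ 1 (e.g. at λ = 0, ν = 0), and for ℓ = 0 the two notions agree. *)

(* Defs.v *)
From HB Require Import structures.
From mathcomp Require Import all_boot all_order all_algebra.
From mathcomp Require Import complex.
From mathcomp Require Import all_classical all_reals all_analysis.

Set Implicit Arguments.
Unset Strict Implicit.
Unset Printing Implicit Defensive.

Import Order.TTheory GRing.Theory Num.Theory.
Import numFieldNormedType.Exports.

Local Open Scope classical_set_scope.
Local Open Scope complex_scope.
Local Open Scope ring_scope.

(* A function on [0, 2pi/alpha] x [0, 2pi] is given by the family of its       *)
(* Fourier coefficients, w k being that of e^{i(alpha k_1 x_1 + k_2 x_2)}.     *)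
Definition freq : Type := (int * int)%type.
Definition coeffs (R : realType) : Type := freq -> R[i].

Definition p : freq := (0, 1).

Definition kappa (R : realType) (alpha : R) (k : freq) : R :=
  (alpha * k.1%:~R) ^+ 2 + k.2%:~R ^+ 2.

(* The junk value at k = 0 (0^-1 = 0) is harmless: in linNS below, rho is only *)
(* reached at k = 0 with a factor k.1 = 0.                                     *)
Definition rho (R : realType) (alpha : R) (k : freq) : R :=
  1 - (kappa alpha k)^-1.

(* Fourier form of the vorticity equation linearized at cos x_2 (Euler if      *)
(* nu = 0).  At k = 0 both terms vanish.                                       *)
Definition linNS (R : realType) (alpha nu : R) (w : coeffs R) : coeffs R :=
  fun k =>
    (alpha * k.1%:~R / 4)%:C *
      ((rho alpha (k - p))%:C * w (k - p) - (rho alpha (k + p))%:C * w (k + p))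
    - (nu * kappa alpha k)%:C * w k.

Definition line (khat : freq) : set freq := range (fun n : int => khat + p *~ n).

Definition line_part (R : realType) (khat : freq) (w : coeffs R) : coeffs R :=
  fun k => if `[< line khat k >] then w k else 0.

Definition Hnorm2 (R : realType) (alpha : R) (l : nat) (w : coeffs R) : \bar R :=
  \esum_(k in [set: freq]) ((1 + kappa alpha k) ^+ l * Normc.normc (w k) ^+ 2)%:E.

Definition Hline (R : realType) (alpha : R) (l : nat) (khat : freq)
    : set (coeffs R) :=
  [set w | [/\ (forall k, ~ line khat k -> w k = 0), w 0 = 0
             & (Hnorm2 alpha l w < +oo)%E]].

(* Maximal domain: H^{l+2} modes when nu > 0, all of Hline when nu = 0.        *)
Definition dom (R : realType) (alpha nu : R) (l : nat) (khat : freq)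
    : set (coeffs R) :=
  [set w | Hline alpha l khat w /\ Hline alpha l khat (linNS alpha nu w)].

Definition shifted (R : realType) (alpha nu : R) (lam : R[i]) (w : coeffs R)
    : coeffs R :=
  fun k => linNS alpha nu w k - lam * w k.

Definition eigenfunction (R : realType) (alpha nu : R) (l : nat) (khat : freq)
    (lam : R[i]) (w : coeffs R) : Prop :=
  [/\ dom alpha nu l khat w, (exists k, w k != 0)
    & forall k, linNS alpha nu w k = lam * w k].

Definition eigenvalues (R : realType) (alpha nu : R) (l : nat) (khat : freq)
    : set R[i] :=
  [set lam | exists w, eigenfunction alpha nu l khat lam w].

Definition resolvent_set (R : realType) (alpha nu : R) (l : nat) (khat : freq)
    : set R[i] :=
  [set lam | exists M : R, forall f, Hline alpha l khat f ->
     exists w, [/\ dom alpha nu l khat w, shifted alpha nu lam w = f,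
       (forall w', dom alpha nu l khat w' -> shifted alpha nu lam w' = f ->
          w' = w)
     & (Hnorm2 alpha l w <= M%:E * Hnorm2 alpha l f)%E]].

Definition spectrum (R : realType) (alpha nu : R) (l : nat) (khat : freq)
    : set R[i] :=
  ~` resolvent_set alpha nu l khat.

(* L - lam is injective with dense range and an unbounded inverse.  Density is *)
(* meant in the L^2 norm: for l = 0 this is the usual continuous spectrum.     *)
(* For l >= 1 density in H^l cannot be asked: with nu = 0 and lam = i t in the *)
(* interior of the segment, the transposed equation has bounded solutions,     *)
(* which define H^l-continuous functionals vanishing on the range (as do point *)
(* evaluations for multiplication by 2 i sin - lam on H^1 of the circle).      *)
Definition continuous_spectrum (R : realType) (alpha nu : R) (l : nat)
    (khat : freq) : set R[i] :=
  [set lam |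
    [/\ ~ eigenvalues alpha nu l khat lam,
        (forall f, Hline alpha 0 khat f -> forall eps : R, 0 < eps ->
           exists2 w, dom alpha nu l khat w &
             (Hnorm2 alpha 0 (fun k => shifted alpha nu lam w k - f k)%R
                < eps%:E)%E)
      & ~ exists M : R, forall w, dom alpha nu l khat w ->
           (Hnorm2 alpha l w <= M%:E * Hnorm2 alpha l (shifted alpha nu lam w))%E]].

Definition imag_segment (R : realType) (r : R) : set R[i] :=
  [set t *i | t in `[- r, r]].

Definition outside_disc (R : realType) (alpha : R) (khat : freq) : Prop :=
  khat != 0 /\
  forall n : int, 1 < (alpha * khat.1%:~R) ^+ 2 + (khat.2 + n)%:~R ^+ 2.

Definition real_valued (R : realType) (w : coeffs R) : Prop :=
  forall k, w (- k) = (w k)^*.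

(* The function c e^{i n x_2} + c.c. (for n <> 0).                             *)
Definition shear_mode (R : realType) (n : int) (c : R[i]) : coeffs R :=
  fun k => if k == p *~ n then c else if k == p *~ (- n) then c^* else 0.

Definition infinite_multiplicity (R : realType) (alpha nu : R) (l : nat)
    (khat : freq) (lam : R[i]) : Prop :=
  forall N : nat, exists v : 'I_N -> coeffs R,
    (forall j, eigenfunction alpha nu l khat lam (v j)) /\
    (forall c : 'I_N -> R[i],
       (forall k, \sum_j c j * v j k = 0) -> forall j, c j = 0).

Definition all_other_stable (R : realType) (E : set R[i]) (lam : R[i]) : Prop :=
  forall mu, E mu -> mu != lam -> complex.Re mu < 0.

Definition critical_viscosity (R : realType) (alpha : R) (l : nat) (khat : freq)
    (nus : R) : Prop :=
  forall nu : R, 0 < nu ->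
  let E := eigenvalues alpha nu l khat in
  [/\ nus < nu -> forall mu, E mu -> complex.Re mu < 0,
      nu = nus -> E 0 /\ all_other_stable E 0
    & nu < nus -> exists lam : R,
        unique (fun x : R => 0 < x /\ E x%:C) lam /\ all_other_stable E lam%:C].

Definition positive_branch (R : realType) (alpha : R) (l : nat) (khat : freq)
    (nus : R) (lam : R -> R) : Prop :=
  forall nu, 0 < nu -> nu < nus ->
    0 < lam nu /\ eigenvalues alpha nu l khat (lam nu)%:C.

Definition nu_lower_radicand (R : realType) (alpha : R) : R :=
  32 - 3 * alpha ^+ 6 - 17 * alpha ^+ 4 - 16 * alpha ^+ 2.

Definition nu_lower (R : realType) (alpha : R) : R :=
  Num.sqrt (nu_lower_radicand alpha) /
    (4 * (alpha ^+ 2 + 1) * (alpha ^+ 2 + 4)).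

Definition nu_upper (R : realType) (alpha : R) : R :=
  1 / (2 * (alpha ^+ 2 + 1)) * Num.sqrt ((1 - alpha ^+ 2) / 2).

Definition lam_upper_radicand (R : realType) (alpha : R) : R :=
  alpha ^+ 2 * (1 - alpha ^+ 2) / (8 * (alpha ^+ 2 + 1)).

Definition lam_lower_radicand (R : realType) (alpha : R) : R :=
  alpha ^+ 2 * (1 - alpha ^+ 2) / (8 * (alpha ^+ 2 + 1))
  - alpha ^+ 4 * (alpha ^+ 2 + 3) /
      (16 * (alpha ^+ 2 + 1) * (alpha ^+ 2 + 4)).

(* Main.v *)
Require Import Defs.
From HB Require Import structures.
From mathcomp Require Import all_boot all_order all_algebra.
From mathcomp Require Import complex.
From mathcomp Require Import ring lra zify.
From mathcomp Require Import all_classical all_reals all_analysis.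

Set Implicit Arguments.
Unset Strict Implicit.
Unset Printing Implicit Defensive.

Import Order.TTheory GRing.Theory Num.Theory.
Import numFieldNormedType.Exports.

Local Open Scope classical_set_scope.
Local Open Scope complex_scope.
Local Open Scope ring_scope.

(* On the line of khat put z = rho w and b = alpha khat_1 / 4. The eigenvalue
   equation becomes d_m z_m = z_(m+1) - z_(m-1), d_m = - (lam + nu kappa_m) /
   (b rho_m), with z tending to 0 at both ends. When every rho_m is positive,
   pairing with z shows that Re lam + nu kappa_m cannot be positive for all m.

   For khat = (-1, 0) only rho_0 is negative. If Re lam >= 0 and Im lam <> 0, the
   ratios z_(n+1) / z_n stay in a cone which is incompatible with the equation
   at m = 0, so unstable eigenvalues are real. For real lam >= 0 these ratios are
   continued fractions with positive entries, and the equation at m = 0 is a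
   scalar dispersion relation. Rescaling the entries of even and odd index in
   opposite ways makes it strictly monotone in lam and nu, with a quadratic
   growth bound that gives continuity; its first two convergents give the
   explicit bounds.

   For nu = 0 and lam off the segment, weighted energy estimates and Galerkin
   approximations invert the operator after rho_0 is made positive, which is a
   rank one change. On the segment, cut off plane waves form a Weyl sequence,
   while convexity of |z| or an almost conserved quadratic form excludes decaying
   solutions of the equation and of its adjoint: there is no eigenvalue and the
   range is dense in L^2. *)

(** * Squared moduli and sums over windows *)

(** On the line of (-1, 0) all entries of the continued fraction grow with [lam] and [nu], while a
    continued fraction increases in some entries and decreases in the others, so no monotonicity is
    visible. Multiplying the relation by u = lam + nu alpha^2, the numerator at m = 0, puts u and
    1/u alternately on the entries: those multiplied by u still increase, and those divided by u
    become (lam + nu kappa) / (lam + nu alpha^2) up to a constant, which decreases because kappa >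
    alpha^2. What remains at m = 0 is a constant of [alpha], so roots are level crossings of one
    monotone function. Read in the variable lam / nu, the same scaling gives the slope of the branch
    and stability above the threshold.

    Limit objects are all obtained in one way: bounded quantities converge along an ultrafilter, and
    local equations pass to the limit. This gives the continued fractions, the inverse off the
    segment, the adjoint solution behind density and the inviscid limit.

    Excluding eigenvalues uses only the decay of z at both ends, whatever [l] is. The resolvent does
    need the weights, made slowly varying by enlarging their constant term. *)

Definition nsq (R : realType) (z : R[i]) : R :=
  complex.Re z ^+ 2 + complex.Im z ^+ 2.

Lemma complex_ext (R : realType) (x y : R[i]) :
  complex.Re x = complex.Re y -> complex.Im x = complex.Im y -> x = y.
Proof. by case: x y => [a b] [c d] /= -> ->. Qed.

Lemma ReD (R : realType) (x y : R[i]) :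
  complex.Re (x + y) = complex.Re x + complex.Re y.
Proof. by case: x y => [a b] [c d]. Qed.

Lemma ImD (R : realType) (x y : R[i]) :
  complex.Im (x + y) = complex.Im x + complex.Im y.
Proof. by case: x y => [a b] [c d]. Qed.

Lemma ReN (R : realType) (x : R[i]) : complex.Re (- x) = - complex.Re x.
Proof. by case: x. Qed.

Lemma ImN (R : realType) (x : R[i]) : complex.Im (- x) = - complex.Im x.
Proof. by case: x. Qed.

Lemma ReM (R : realType) (x y : R[i]) :
  complex.Re (x * y) = complex.Re x * complex.Re y - complex.Im x * complex.Im y.
Proof. by case: x y => [a b] [c d]. Qed.

Lemma ImM (R : realType) (x y : R[i]) :
  complex.Im (x * y) = complex.Re x * complex.Im y + complex.Im x * complex.Re y.
Proof. by case: x y => [a b] [c d]. Qed.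

Lemma ReJ (R : realType) (x : R[i]) : complex.Re (x^*) = complex.Re x.
Proof. by case: x. Qed.

Lemma ImJ (R : realType) (x : R[i]) : complex.Im (x^*) = - complex.Im x.
Proof. by case: x. Qed.

Definition ReImE := (ReD, ImD, ReN, ImN, ReM, ImM, ReJ, ImJ).

Lemma nsq_ge0 (R : realType) (z : R[i]) : 0 <= nsq z.
Proof. by rewrite addr_ge0 ?sqr_ge0. Qed.

Lemma nsq_eq0 (R : realType) (z : R[i]) : (nsq z == 0) = (z == 0).
Proof.
by case: z => a b; rewrite /nsq /= paddr_eq0 ?sqr_ge0 // !sqrf_eq0 eq_complex.
Qed.

Lemma nsq_le0 (R : realType) (z : R[i]) : nsq z <= 0 -> z = 0.
Proof. by move=> h; apply/eqP; rewrite -nsq_eq0 eq_le h nsq_ge0. Qed.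

Lemma nsq0 (R : realType) : nsq (0 : R[i]) = 0.
Proof. by apply/eqP; rewrite nsq_eq0. Qed.

Lemma nsqM (R : realType) (x y : R[i]) : nsq (x * y) = nsq x * nsq y.
Proof. by rewrite /nsq !ReImE; ring. Qed.

Lemma nsqN (R : realType) (x : R[i]) : nsq (- x) = nsq x.
Proof. by rewrite /nsq !ReImE; ring. Qed.

Lemma nsqJ (R : realType) (x : R[i]) : nsq (x^*) = nsq x.
Proof. by rewrite /nsq !ReImE; ring. Qed.

Lemma nsqC (R : realType) (x : R) : nsq x%:C = x ^+ 2.
Proof. by rewrite /nsq /= expr0n addr0. Qed.

Lemma nsqD_le (R : realType) (x y : R[i]) : nsq (x + y) <= 2 * (nsq x + nsq y).
Proof.
rewrite /nsq !ReImE.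
have := sqr_ge0 (complex.Re x - complex.Re y).
have := sqr_ge0 (complex.Im x - complex.Im y).
lra.
Qed.

Lemma nsqB_le (R : realType) (x y : R[i]) : nsq (x - y) <= 2 * (nsq x + nsq y).
Proof. by rewrite -(nsqN y); exact: nsqD_le. Qed.

Lemma nsqV (R : realType) (x : R[i]) : nsq x^-1 = (nsq x)^-1.
Proof.
have [->|x0] := eqVneq x 0; first by rewrite invr0 nsq0 invr0.
have nx0 : nsq x != 0 by rewrite nsq_eq0.
by apply: (mulfI nx0); rewrite mulfV // -nsqM mulfV // nsqC expr1n.
Qed.

Lemma normc_sqr (R : realType) (z : R[i]) : Normc.normc z ^+ 2 = nsq z.
Proof. by case: z => a b; rewrite /nsq /= sqr_sqrtr // addr_ge0 ?sqr_ge0. Qed.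

Lemma conj_mul_nsq (R : realType) (z : R[i]) : z * z^* = (nsq z)%:C.
Proof. by apply: complex_ext; rewrite !ReImE /nsq /=; ring. Qed.

Lemma Re_mulJ_le (R : realType) (x y : R[i]) :
  `|complex.Re (x * y^*)| <= (nsq x + nsq y) / 2.
Proof.
rewrite /nsq !ReImE ler_norml.
have := sqr_ge0 (complex.Re x - complex.Re y).
have := sqr_ge0 (complex.Im x - complex.Im y).
have := sqr_ge0 (complex.Re x + complex.Re y).
have := sqr_ge0 (complex.Im x + complex.Im y).
by move=> *; apply/andP; split; lra.
Qed.

Lemma Im_mulJ_le (R : realType) (x y : R[i]) :
  `|complex.Im (x * y^*)| <= (nsq x + nsq y) / 2.
Proof.
rewrite /nsq !ReImE ler_norml.
have := sqr_ge0 (complex.Re x - complex.Im y).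
have := sqr_ge0 (complex.Im x - complex.Re y).
have := sqr_ge0 (complex.Re x + complex.Im y).
have := sqr_ge0 (complex.Im x + complex.Re y).
by move=> *; apply/andP; split; lra.
Qed.

(* Sum over the window -N <= m < N of the integers. *)
Definition wsum (V : zmodType) (N : nat) (f : int -> V) : V :=
  \sum_(n < N) (f n%:Z + f (- n.+1%:Z)).

Lemma wsum0 (V : zmodType) (f : int -> V) : wsum 0 f = 0.
Proof. by rewrite /wsum big_ord0. Qed.

Lemma wsumS (V : zmodType) (N : nat) (f : int -> V) :
  wsum N.+1 f = wsum N f + (f N%:Z + f (- N.+1%:Z)).
Proof. by rewrite /wsum big_ord_recr. Qed.

Lemma eq_wsum (V : zmodType) (N : nat) (f g : int -> V) :
  (forall m, - N%:Z <= m < N%:Z -> f m = g m) -> wsum N f = wsum N g.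
Proof.
move=> fg; apply: eq_bigr => n _.
by have nN := ltn_ord n; rewrite !fg //; apply/andP; lia.
Qed.

Lemma wsumD (V : zmodType) (N : nat) (f g : int -> V) :
  wsum N (fun m => f m + g m) = wsum N f + wsum N g.
Proof. by rewrite -big_split; apply: eq_bigr => n _; rewrite addrACA. Qed.

Lemma wsumN (V : zmodType) (N : nat) (f : int -> V) :
  wsum N (fun m => - f m) = - wsum N f.
Proof. by rewrite -sumrN; apply: eq_bigr => n _; rewrite opprD. Qed.

Lemma wsumZ (R : comNzRingType) (N : nat) (c : R) (f : int -> R) :
  wsum N (fun m => c * f m) = c * wsum N f.
Proof. by rewrite mulr_sumr; apply: eq_bigr => n _; rewrite mulrDr. Qed.

Lemma wsum_const (R : comNzRingType) (N : nat) (c : R) :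
  wsum N (fun=> c) = N%:R * c *+ 2.
Proof. by rewrite /wsum sumr_const card_ord mulr_natl -mulrnA mulnC mulrnA. Qed.

(** The half-open window leaves one boundary value at each end, so summation by parts needs no
    correction term. *)
Lemma wsum_telescope (V : zmodType) (N : nat) (f : int -> V) :
  wsum N (fun m => f (m + 1) - f m) = f N%:Z - f (- N%:Z).
Proof.
elim: N => [|N IH]; first by rewrite wsum0 oppr0 subrr.
rewrite wsumS IH.
have -> : N%:Z + 1 = N.+1%:Z by lia.
have -> : - N.+1%:Z + 1 = - N%:Z by lia.
by rewrite [X in _ + X]addrC addrA subrKA addrC subrKA.
Qed.

Lemma ler_wsum (R : realDomainType) (N : nat) (f g : int -> R) :
  (forall m, - N%:Z <= m < N%:Z -> f m <= g m) -> wsum N f <= wsum N g.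
Proof.
move=> fg; apply: ler_sum => n _.
by have nN := ltn_ord n; apply: lerD; apply: fg; apply/andP; lia.
Qed.

Lemma wsum_ge0 (R : realDomainType) (N : nat) (f : int -> R) :
  (forall m, 0 <= f m) -> 0 <= wsum N f.
Proof. by move=> f0; apply: sumr_ge0 => n _; exact: addr_ge0. Qed.

Lemma wsum_mono (R : realDomainType) (N M : nat) (f : int -> R) :
  (forall m, 0 <= f m) -> (N <= M)%N -> wsum N f <= wsum M f.
Proof.
move=> f0 /subnK <-; elim: (M - N)%N => // k IH.
by rewrite addSn wsumS (le_trans IH) // lerDl addr_ge0.
Qed.

Lemma wsum_term (R : realDomainType) (N : nat) (f : int -> R) (m : int) :
  (forall m, 0 <= f m) -> - N%:Z <= m < N%:Z -> f m <= wsum N f.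
Proof.
move=> f0; elim: N => [|N IH] mN; first by exfalso; lia.
rewrite wsumS; have [mN'|mN'] := boolP (- N%:Z <= m < N%:Z).
  by rewrite (le_trans (IH mN')) // lerDl addr_ge0.
have /orP[/eqP->|/eqP->] : (m == N%:Z) || (m == - N.+1%:Z) by lia.
  by rewrite addrCA lerDl addr_ge0 // wsum_ge0.
by rewrite addrA addrC lerDl addr_ge0 // wsum_ge0.
Qed.

Lemma wsum_supp (V : zmodType) (N M : nat) (f : int -> V) :
  (forall m, ~~ (- N%:Z <= m < N%:Z) -> f m = 0) -> (N <= M)%N ->
  wsum M f = wsum N f.
Proof.
move=> f0 /subnK <-; elim: (M - N)%N => // k IH.
by rewrite addSn wsumS IH !f0 ?addr0 //; lia.
Qed.

Lemma wsum_shift (V : zmodType) (N : nat) (f : int -> V) :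
  wsum N (fun m => f (m + 1)) = wsum N f + (f N%:Z - f (- N%:Z)).
Proof.
by rewrite -wsum_telescope -wsumD; apply: eq_wsum => m _; rewrite addrCA subrr addr0.
Qed.

Lemma wsum_unshift (V : zmodType) (N : nat) (f : int -> V) :
  wsum N (fun m => f (m - 1)) = wsum N f + (f (- N%:Z - 1) - f (N%:Z - 1)).
Proof.
have := wsum_shift N (fun m => f (m - 1)).
rewrite (@eq_wsum _ _ (fun m => f (m + 1 - 1)) f) => [->|m _]; last first.
  by rewrite addrK.
by rewrite -addrA subrKA subrr addr0.
Qed.

Lemma bounded_sum_cvg0 (R : realType) (u : nat -> R) (M : R) :
  (forall n, 0 <= u n) -> (forall N, \sum_(n < N) u n <= M) ->
  u n @[n --> \oo] --> 0.
Proof.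
move=> u0 uM; apply: cvg_series_cvg_0; apply: nondecreasing_is_cvgn.
  move=> m n mn; rewrite /series /= (big_cat_nat (leq0n m) mn) //= lerDl.
  exact: sumr_ge0.
by exists M => _ [n _ <-]; rewrite /series /= big_mkord.
Qed.

(** This turns a finite norm into decay at both ends, the only information on the function space
    that is used when eigenvalues are excluded. *)
Lemma wsum_bounded_cvg0 (R : realType) (f : int -> R) (M : R) :
  (forall m, 0 <= f m) -> (forall N, wsum N f <= M) ->
  f n%:Z @[n --> \oo] --> 0 /\ f (- n%:Z) @[n --> \oo] --> 0.
Proof.
move=> f0 fM; split.
  apply: (@bounded_sum_cvg0 _ _ M) => // N; rewrite (le_trans _ (fM N)) //.
  by apply: ler_sum => n _; rewrite lerDl.
rewrite -cvg_shiftS.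
apply: (@bounded_sum_cvg0 _ _ M) => // N; rewrite (le_trans _ (fM N)) //.
by apply: ler_sum => n _; rewrite lerDr.
Qed.

(** Bridge from unordered extended sums to finite real windows, where the later estimates are made.
    The integers are enumerated by the pairs n, -n-1, as in [wsum]. *)
Lemma esum_int_le (R : realType) (f : int -> R) (M : R) :
  (forall m, 0 <= f m) ->
  (\esum_(m in [set: int]) (f m)%:E <= M%:E)%E <-> forall N, wsum N f <= M.
Proof.
move=> f0.
have split_esum : \esum_(m in [set: int]) (f m)%:E =
    (\sum_(0 <= n <oo) (f n%:Z + f (- n.+1%:Z))%:E)%E.
  rewrite (esumID [set m : int | 0 <= m]); last by move=> *; rewrite lee_fin.
  rewrite (@reindex_esum _ _ _ [set: nat] _ (fun n : nat => n%:Z)); last first.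
    split=> [n _ /=|n m _ _ [] //|m [_ /= m0]]; first by split.
    by exists `|m|%N => //; rewrite gez0_abs.
  rewrite (@reindex_esum _ _ _ [set: nat] (_ `&` ~` _)
             (fun n : nat => - n.+1%:Z)); last first.
    split=> [n _ /=|n m _ _|m [_ /= m0]]; first by split=> //=; lia.
      by lia.
    by exists (`|m|.-1)%N => //; lia.
  rewrite -!nneseries_esumT; try by move=> n; rewrite lee_fin.
  by rewrite -nneseriesD // => n _ _; rewrite lee_fin.
have ge0 n : 0 <= f n%:Z + f (- n.+1%:Z) by rewrite addr_ge0.
have partial N : (\sum_(0 <= n < N) (f n%:Z + f (- n.+1%:Z))%:E)%E =
    (wsum N f)%:E by rewrite big_mkord -sumEFin.
rewrite split_esum; split=> [fM N|fM].
  rewrite -lee_fin -partial (le_trans _ fM) //; apply: nneseries_lim_ge => n _ _.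
  by rewrite lee_fin.
apply: lime_le; first by apply: is_cvg_nneseries => n _ _; rewrite lee_fin.
by near=> N; rewrite partial lee_fin.
Unshelve. all: by end_near. Qed.

Lemma kappa_ge0 (R : realType) (alpha : R) (k : freq) : 0 <= kappa alpha k.
Proof. by rewrite addr_ge0 ?sqr_ge0. Qed.

(* The H^l weight on the line k.1 = k1, the frequencies being indexed by k.2. *)
Definition sobolev_weight (R : realType) (g : R) (l : nat) (m : int) : R :=
  (1 + (g + m%:~R ^+ 2)) ^+ l.

Lemma Hnorm2_le (R : realType) (alpha : R) (l : nat) (k1 : int)
    (w : coeffs R) (M : R) :
  (forall k, k.1 != k1 -> w k = 0) ->
  (Hnorm2 alpha l w <= M%:E)%E <->
  forall N, wsum N (fun m => sobolev_weight ((alpha * k1%:~R) ^+ 2) l m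
                             * nsq (w (k1, m))) <= M.
Proof.
move=> supp; rewrite -esum_int_le; last first.
  move=> m; rewrite mulr_ge0 ?nsq_ge0 // exprn_ge0 // addr_ge0 //.
  exact: (kappa_ge0 alpha (k1, m)).
have -> : Hnorm2 alpha l w = \esum_(m in [set: int])
    (sobolev_weight ((alpha * k1%:~R) ^+ 2) l m * nsq (w (k1, m)))%:E.
  rewrite -(@reindex_esum _ _ _ [set: int] [set k : freq | k.1 = k1]
             (fun m => (k1, m))
             (fun k => ((1 + kappa alpha k) ^+ l * nsq (w k))%:E)); last first.
    by split=> [//|m n _ _ []//|[a m] /= ->]; exists m.
  rewrite [RHS]esum_mkcond; apply: eq_esum => k _; rewrite normc_sqr.
  case: ifPn => // /negP; rewrite inE /= => /eqP kk1.
  by rewrite supp // nsq0 mulr0.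
by [].
Qed.

Lemma Hnorm2_ge0 (R : realType) (alpha : R) (l : nat) (w : coeffs R) :
  (0 <= Hnorm2 alpha l w)%E.
Proof.
apply: esum_ge0 => k _; rewrite lee_fin mulr_ge0 ?sqr_ge0 // exprn_ge0 //.
by rewrite addr_ge0 ?kappa_ge0.
Qed.

Lemma Hnorm2_fin (R : realType) (alpha : R) (l : nat) (w : coeffs R) :
  (Hnorm2 alpha l w < +oo)%E <-> exists M : R, (Hnorm2 alpha l w <= M%:E)%E.
Proof.
split=> [fin|[M]]; last by move=> /le_lt_trans; apply; rewrite ltry.
by exists (fine (Hnorm2 alpha l w)); rewrite fineK // ge0_fin_numE ?Hnorm2_ge0.
Qed.

Lemma freq_pmulz (n : int) : p *~ n = (0, n).
Proof.
have pM (j : nat) : p *+ j = (0, j%:Z).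
  by elim: j => // j IH; rewrite mulrS IH; congr pair; rewrite intS.
case: n => n; first exact: pM.
by rewrite NegzE mulrNz -pmulrn pM; congr pair; rewrite oppr0.
Qed.

Lemma lineE (khat : freq) (k : freq) : line khat k <-> k.1 = khat.1.
Proof.
split=> [[n _ <-]|kk]; first by rewrite freq_pmulz /= addr0.
exists (k.2 - khat.2) => //; rewrite freq_pmulz; case: k khat kk => a b [c d] /= ->.
by congr pair; rewrite ?addr0 // addrC subrK.
Qed.

(** * Decaying solutions on a half line *)

Lemma cvg_ext (T : Type) (V : topologicalType) (F : set_system T)
    (f g : T -> V) (l : V) :
  f =1 g -> f x @[x --> F] --> l -> g x @[x --> F] --> l.
Proof. by move=> /funext ->. Qed.

Lemma cvg_ge (R : realType) (T : Type) (F : set_system T) (FF : ProperFilter F)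
    (f : T -> R) (l a : R) :
  f x @[x --> F] --> l -> (\forall x \near F, a <= f x) -> a <= l.
Proof.
move=> fl af; rewrite -(cvg_lim (@Rhausdorff R) fl); apply: limr_ge => //.
by apply/cvg_ex; exists l.
Qed.

Lemma cvg_le (R : realType) (T : Type) (F : set_system T) (FF : ProperFilter F)
    (f : T -> R) (l a : R) :
  f x @[x --> F] --> l -> (\forall x \near F, f x <= a) -> l <= a.
Proof.
move=> fl af; rewrite -(cvg_lim (@Rhausdorff R) fl); apply: limr_le => //.
by apply/cvg_ex; exists l.
Qed.

Lemma nonincreasing_cvg0_ge0 (R : realType) (X : nat -> R) :
  (forall n, X n.+1 <= X n) -> X n @[n --> \oo] --> (0 : R) ->
  forall n, 0 <= X n.
Proof.
move=> dX X0 n; rewrite -(cvg_lim (@Rhausdorff R) X0).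
apply: nonincreasing_cvgn_ge; last by apply/cvg_ex; exists 0.
exact/nonincreasing_seqP.
Qed.

(** The minimum of [X n] and [Y n] is nonincreasing and tends to 0. *)
Lemma alternating_ge0 (R : realType) (X Y : nat -> R) :
  (forall n, Y n.+1 <= X n) -> (forall n, X n.+1 <= Y n) ->
  X n @[n --> \oo] --> (0 : R) -> Y n @[n --> \oo] --> (0 : R) ->
  forall n, 0 <= X n /\ 0 <= Y n.
Proof.
move=> XY YX X0 Y0 n.
have U0 : Num.min (X n) (Y n) @[n --> \oo] --> (0 : R).
  have minE (a b : R) : Num.min a b = (a + b - `|a - b|) / 2.
    by rewrite minr_absE.
  apply: cvg_ext (fun n => esym (minE (X n) (Y n))) _.
  have -> : (0 : R) = ((0 : R) + 0 - `|(0 : R) - 0|) / 2.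
    by rewrite addr0 subr0 normr0 subr0 mul0r.
  by apply: cvgMl; apply: cvgB; [exact: cvgD|apply: cvg_norm; exact: cvgB].
have := @nonincreasing_cvg0_ge0 R (fun n => Num.min (X n) (Y n)) _ U0 n.
rewrite le_min => H; apply/andP; apply: H => m.
by rewrite le_min !ge_min XY YX orbT.
Qed.

(* The eigenvalue equation on n >= 1, for z = rho w. *)
Definition half_line_eq (R : realType) (d z : nat -> R[i]) : Prop :=
  forall n, d n.+1 * z n.+1 = z n.+2 - z n.

(** [- z n.+1 * (z n)^*] is the ratio - z (n+1) / z n times [nsq (z n)]; working with it avoids
    dividing by a [z n] that may vanish. *)
Lemma cvg0_cross (R : realType) (z : nat -> R[i]) :
  nsq (z n) @[n --> \oo] --> (0 : R) ->
  complex.Re (- z n.+1 * (z n)^*) @[n --> \oo] --> (0 : R) /\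
  complex.Im (- z n.+1 * (z n)^*) @[n --> \oo] --> (0 : R).
Proof.
move=> z0; have z1 : nsq (z n.+1) @[n --> \oo] --> (0 : R).
  by rewrite (cvg_shiftS (fun n => nsq (z n))).
have b0 : (nsq (- z n.+1) + nsq (z n)) / 2 @[n --> \oo] --> (0 : R).
  rewrite -[X in _ --> X](mul0r 2^-1); apply: cvgMl.
  rewrite -[X in _ --> X]addr0; apply: cvgD z0.
  by apply: cvg_ext z1 => n; rewrite nsqN.
have Nb0 : - ((nsq (- z n.+1) + nsq (z n)) / 2) @[n --> \oo] --> (0 : R).
  by rewrite -oppr0; exact: cvgN.
split; apply: squeeze_cvgr Nb0 b0; near=> n; rewrite -ler_norml.
  exact: Re_mulJ_le.
exact: Im_mulJ_le.
Unshelve. all: by end_near. Qed.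

(* The cone {s | Im (s u^* ) <= 0 <= Im (s u)} is stable by sums and inverses,
   hence by continued fractions with entries d n; the bound below is this fact
   for - z 1 / z 0, written without division. *)
Lemma half_line_cone (R : realType) (d z : nat -> R[i]) (u : R[i]) :
  half_line_eq d z -> nsq (z n) @[n --> \oo] --> (0 : R) ->
  (forall n, complex.Im (d n.+1 * u^*) <= 0) ->
  (forall n, 0 <= complex.Im (d n.+1 * u)) ->
  complex.Im (d 1%N * u) * nsq (z 1%N) <= - complex.Im (- z 1%N * (z 0%N)^* * u^*).
Proof.
move=> eqz z0 dneg dpos.
have [R0 I0] := cvg0_cross z0.
pose X n := - complex.Im (- z n.+1 * (z n)^* * u^*).
pose Y n := complex.Im (- z n.+1 * (z n)^* * u).
have zE n : z n = z n.+2 - d n.+1 * z n.+1 by rewrite eqz opprB addrC subrK.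
(* Inversion exchanges [u] and its conjugate: each use of the recurrence passes from [X] to [Y] or
   back and adds a nonnegative multiple of [nsq (z n.+1)]. *)
have XE n : X n = complex.Im (d n.+1 * u) * nsq (z n.+1) + Y n.+1.
  by rewrite /X /Y /nsq (zE n) !ReImE; ring.
have YE n : Y n = - complex.Im (d n.+1 * u^*) * nsq (z n.+1) + X n.+1.
  by rewrite /X /Y /nsq (zE n) !ReImE; ring.
have lin0 (a b : R) : a * complex.Re (- z n.+1 * (z n)^*) +
    b * complex.Im (- z n.+1 * (z n)^*) @[n --> \oo] --> (0 : R).
  have -> : 0 = a * 0 + b * 0 :> R by rewrite !mulr0 addr0.
  by apply: cvgD; apply: cvgMr.
have X0 : X n @[n --> \oo] --> (0 : R).
  by apply: cvg_ext (lin0 (complex.Im u) (- complex.Re u)) => n; rewrite /X !ReImE; ring.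
have Y0 : Y n @[n --> \oo] --> (0 : R).
  by apply: cvg_ext (lin0 (complex.Im u) (complex.Re u)) => n; rewrite /Y !ReImE; ring.
have [||_ Y1] := @alternating_ge0 R X Y _ _ X0 Y0 1%N.
- by move=> n; rewrite XE lerDr mulr_ge0 ?nsq_ge0.
- by move=> n; rewrite YE lerDr mulr_ge0 ?nsq_ge0 // oppr_ge0.
by rewrite -/(X 0%N) XE lerDl.
Qed.

(** The real part [X n] decreases to 0, each drop being [d n.+1 * nsq (z n.+1)]; hence a zero of [z]
    propagates to the right. The imaginary part only changes sign, so its modulus is constant and,
    tending to 0, vanishes: all ratios are real, and positive after the change of sign. *)
Lemma half_line_real (R : realType) (d : nat -> R) (z : nat -> R[i]) :
  (forall n, 0 < d n.+1) -> half_line_eq (fun n => (d n)%:C) z ->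
  nsq (z n) @[n --> \oo] --> (0 : R) ->
  (z 0%N = 0 -> forall n, z n = 0) /\
  (z 0%N != 0 -> exists s : nat -> R,
     (forall n, z n.+1 = - (s n)%:C * z n) /\
     (forall n, 0 < s n /\ s n * (d n.+1 + s n.+1) = 1)).
Proof.
move=> d0 eqz z0.
have [R0 I0] := cvg0_cross z0.
pose X n := complex.Re (- z n.+1 * (z n)^*).
pose Y n := complex.Im (- z n.+1 * (z n)^*).
have zE n : z n = z n.+2 - (d n.+1)%:C * z n.+1 by rewrite eqz opprB addrC subrK.
have XE n : X n = d n.+1 * nsq (z n.+1) + X n.+1.
  by rewrite /X /nsq (zE n) !ReImE /=; ring.
have YE n : Y n = - Y n.+1 by rewrite /Y (zE n) !ReImE /=; ring.
have Xge n : d n.+1 * nsq (z n.+1) <= X n.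
  rewrite XE lerDl; apply: (@nonincreasing_cvg0_ge0 R X) => // {}n.
  by rewrite [leRHS]XE lerDr mulr_ge0 ?nsq_ge0 // ltW.
have Y0 n : Y n = 0.
  have Yn k : `|Y n| = `|Y (n + k)%N|.
    by elim: k => [|k ->]; rewrite ?addn0 // YE normrN addnS.
  apply/eqP; rewrite -normr_eq0; apply/eqP.
  have cst : `|Y k| @[k --> \oo] --> `|Y n|.
    apply: cvg_near_cst; near=> k; rewrite (Yn (k - n)%N) subnKC //; near: k.
    exact: nbhs_infty_ge.
  have := cvg_unique (@Rhausdorff R) cst (cvg_norm I0).
  by rewrite normr0; apply.
have next0 n : z n = 0 -> z n.+1 = 0.
  move=> zn; have := Xge n.
  rewrite /X zn conjC0 mulr0 /= => h; apply: nsq_le0.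
  by rewrite -(pmulr_rle0 _ (d0 n)).
split=> [z00|z00]; first by elim=> // n /next0.
have zn0 n : z n != 0.
  elim: n => // n /eqP zn; apply/eqP => zn1; apply: zn.
  by rewrite zE (next0 _ zn1) zn1 mulr0 subr0.
have nz n : 0 < nsq (z n) by rewrite lt0r nsq_eq0 zn0 nsq_ge0.
have X0 n : 0 < X n by rewrite (lt_le_trans _ (Xge n)) // mulr_gt0.
have eE n : - z n.+1 * (z n)^* = (X n)%:C.
  by apply: complex_ext => //=; exact: Y0.
have cz n : (nsq (z n))%:C != 0 :> R[i] by rewrite eq_complex /= eqxx andbT gt_eqF.
exists (fun n => X n / nsq (z n)).
have zsE n : z n.+1 = - (X n / nsq (z n))%:C * z n.
  apply: (mulIf (cz n)); rewrite -mulrA [z n * _]mulrC mulrA mulNr -rmorphM /=.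
  by rewrite divfK ?gt_eqF // -(eE n) !mulNr opprK -mulrA [_^* * _]mulrC conj_mul_nsq.
split=> // n; split; first by rewrite divr_gt0.
have -> : d n.+1 + X n.+1 / nsq (z n.+1) = X n / nsq (z n.+1).
  by rewrite [in RHS]XE mulrDl mulfK // gt_eqF.
rewrite zsE nsqM nsqN nsqC; field.
by apply/andP; split; [rewrite gt_eqF|exact: lt0r_neq0 (X0 n)].
Unshelve. all: by end_near. Qed.

(* Threshold energies: |y n| is convex where tau >= 2. *)
Lemma half_line_convex (R : realType) (tau : nat -> R) (y : nat -> R[i]) :
  (forall n, 2 <= tau n.+1) ->
  (forall n, y n.+2 + y n = (tau n.+1)%:C * y n.+1) ->
  nsq (y n) @[n --> \oo] --> (0 : R) ->
  nsq (y 1%N) <= complex.Re (y 1%N * (y 0%N)^*) <= nsq (y 0%N).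
Proof.
move=> tau2 eqy y0.
have [R0 _] := cvg0_cross y0.
pose X n := complex.Re (y n.+1 * (y n)^*) - nsq (y n.+1).
have yE n : y n = (tau n.+1)%:C * y n.+1 - y n.+2 by rewrite -eqy addrAC subrr add0r.
have X0 : X n @[n --> \oo] --> (0 : R).
  rewrite -[X in _ --> X]subr0; apply: cvgB; last first.
    by rewrite (cvg_shiftS (fun n => nsq (y n))).
  rewrite -[X in _ --> X]oppr0; apply: cvg_ext (cvgN R0) => n.
  by rewrite /= !ReImE; ring.
have dX n : X n.+1 <= X n.
  have -> : X n = X n.+1 + (nsq (y n.+1 - y n.+2) + (tau n.+1 - 2) * nsq (y n.+1)).
    by rewrite /X /nsq (yE n) !ReImE /=; ring.
  by rewrite lerDl addr_ge0 ?nsq_ge0 // mulr_ge0 ?nsq_ge0 // subr_ge0.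
have := nonincreasing_cvg0_ge0 dX X0 0%N; rewrite subr_ge0 => h.
rewrite h /=; have := nsq_ge0 (y 0%N - y 1%N); move: h.
by rewrite /nsq !ReImE; lra.
Qed.

(* Inside the band: a quadratic form that is nearly conserved, since v is
   summable, keeps solutions away from 0. *)
Lemma half_line_band (R : realType) (E K : R) (v : nat -> R) (y : nat -> R[i]) :
  `|E| < 2 -> 0 <= K ->
  (forall n, 0 <= v n.+1 <= K * (n.+1%:R^-1 - n.+2%:R^-1)) ->
  (forall n, y n.+2 + y n = (E * (1 + v n.+1))%:C * y n.+1) ->
  nsq (y n) @[n --> \oo] --> (0 : R) ->
  forall n, y n = 0.
Proof.
move=> E2 K0 vK eqy y0.
have [R0 _] := cvg0_cross y0.
have yE n : y n = (E * (1 + v n.+1))%:C * y n.+1 - y n.+2.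
  by rewrite -eqy addrAC subrr add0r.
pose c := 1 - `|E| / 2; have c0 : 0 < c by rewrite /c; lra.
(* For v = 0 this form is invariant under the recurrence, and |E| < 2 makes it positive definite;
   this is where the open band enters. *)
pose Q n := nsq (y n.+1) + nsq (y n) - E * complex.Re (y n.+1 * (y n)^*).
have Qge n : c * (nsq (y n) + nsq (y n.+1)) <= Q n.
  have h : `|E * complex.Re (y n.+1 * (y n)^*)| <=
           `|E| * ((nsq (y n.+1) + nsq (y n)) / 2).
    by rewrite normrM ler_wpM2l // Re_mulJ_le.
  by rewrite /Q /c; move: h; rewrite ler_norml => /andP[_]; lra.
have dQ n : Q n * (1 - v n.+1 / c) <= Q n.+1 * (1 + v n.+1 / c).
  have /andP[v0 _] := vK n.
  have QE : Q n.+1 = Q n + E * v n.+1 * complex.Re ((y n.+2 - y n) * (y n.+1)^*).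
    by rewrite /Q /nsq (yE n) !ReImE /=; ring.
  set r := complex.Re _ in QE.
  have rle : `|r| <= (nsq (y n) + nsq (y n.+1) + (nsq (y n.+1) + nsq (y n.+2))) / 2.
    have -> : r = complex.Re (y n.+2 * (y n.+1)^*) - complex.Re (y n * (y n.+1)^*).
      by rewrite /r !ReImE; ring.
    rewrite (le_trans (ler_normB _ _)) //.
    have := Re_mulJ_le (y n.+2) (y n.+1); have := Re_mulJ_le (y n) (y n.+1); lra.
  have h : `|E * v n.+1 * r| <= 2 * v n.+1 * ((Q n + Q n.+1) / (2 * c)).
    rewrite !normrM (ger0_norm v0) ler_pM ?mulr_ge0 //.
      by rewrite ler_wpM2r // ltW.
    rewrite (le_trans rle) // ler_pdivlMr ?mulr_gt0 //.
    by have := Qge n; have := Qge n.+1; lra.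
  have -> : Q n.+1 * (1 + v n.+1 / c) = Q n + E * v n.+1 * r + Q n.+1 * (v n.+1 / c).
    by rewrite mulrDr mulr1 {1}QE.
  have : 2 * v n.+1 * ((Q n + Q n.+1) / (2 * c)) =
         Q n * (v n.+1 / c) + Q n.+1 * (v n.+1 / c).
    by field; rewrite gt_eqF.
  by move: h; rewrite ler_norml => /andP[]; lra.
have Q0 n : 0 <= Q n.
  by rewrite (le_trans _ (Qge n)) // mulr_ge0 ?(ltW c0) // addr_ge0 ?nsq_ge0.
pose L := 2 * K / c; have L0 : 0 <= L by rewrite divr_ge0 ?mulr_ge0 // ltW.
have step n : L * (n.+1%:R^-1 - n.+2%:R^-1) <= 1 ->
    Q n * (1 - L * (n.+1%:R^-1 - n.+2%:R^-1)) <= Q n.+1.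
  move=> L1; have /andP[v0 vle] := vK n; set t := _ - _ in vle L1 *.
  have a0 : 0 <= v n.+1 / c by rewrite divr_ge0 // ltW.
  have ale : 2 * (v n.+1 / c) <= L * t.
    have -> : L * t = 2 * (K * t / c) by rewrite /L; field; rewrite gt_eqF.
    by rewrite ler_pM2l // ler_pM2r ?invr_gt0.
  have h := dQ n; set a := v n.+1 / c in a0 ale h.
  rewrite (@le_trans _ _ (Q n * (1 - 2 * a))) //; first by rewrite ler_wpM2l //; lra.
  rewrite -(@ler_pM2r _ (1 + a)); last by rewrite ltr_wpDr.
  rewrite (le_trans _ h) // -mulrA ler_wpM2l //; have := sqr_ge0 a; lra.
(* The relative losses telescope, so from an index with N + 1 >= 2 L on, [Q] never falls below half
   of [Q N]. As [Q] tends to 0, this forces [Q N] to be 0. *)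
clearbody L; have Qlow N n : 2 * L <= N.+1%:R ->
    Q N * (1 - L * (N.+1%:R^-1 - (N + n).+1%:R^-1)) <= Q (N + n)%N.
  move=> LN; have iN (k : nat) : 0 < k.+1%:R^-1 :> R by rewrite invr_gt0.
  have half : L * N.+1%:R^-1 <= 2^-1 by rewrite ler_pdivrMr //; lra.
  elim: n => [|n IH]; first by rewrite addn0 subrr mulr0 subr0 mulr1.
  have dec : (N + n).+2%:R^-1 <= (N + n).+1%:R^-1 :> R.
    by rewrite lef_pV2 ?posrE // ler_nat.
  have dec' : (N + n).+1%:R^-1 <= N.+1%:R^-1 :> R.
    by rewrite lef_pV2 ?posrE // ler_nat ltnS leq_addr.
  rewrite addnS; set x := (N + n).+2%:R^-1 in dec *; set w := (N + n).+1%:R^-1 in dec dec' IH *.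
  have x0 : 0 < x by exact: iN.
  set k := N.+1%:R^-1 in half dec' IH *.
  have Lx : 0 <= L * x by rewrite mulr_ge0 // ltW.
  have Lxw : L * x <= L * w by rewrite ler_wpM2l.
  have LwN : L * w <= L * k by rewrite ler_wpM2l.
  have := step (N + n)%N; rewrite -/w -/x; clearbody k x w => stepn.
  have h : L * (w - x) <= 1 by lra.
  have := stepn h => /(le_trans _); apply.
  have h' : 0 <= 1 - L * (w - x) by rewrite subr_ge0.
  apply: le_trans (ler_wpM2r h' IH); rewrite -[leRHS]mulrA ler_wpM2l //.
  have : 0 <= L * (k - w) * (L * (w - x)) by rewrite mulr_ge0 // mulr_ge0 // subr_ge0.
  lra.
have Q1 : nsq (y n.+1) @[n --> \oo] --> (0 : R).
  by rewrite (cvg_shiftS (fun n => nsq (y n))).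
have Qcvg : Q n @[n --> \oo] --> (0 : R).
  have QE n : nsq (y n.+1) + nsq (y n) + E * complex.Re (- y n.+1 * (y n)^*) = Q n.
    by rewrite mulNr ReN mulrN.
  apply: cvg_ext QE _; have -> : 0 = 0 + 0 + E * 0 :> R by rewrite mulr0 !addr0.
  apply: cvgD; last exact: cvgMr.
  exact: cvgD.
have far N : 2 * L <= N.+1%:R -> y N = 0.
  move=> LN; have QN : Q N <= 0.
    have : Q (N + n)%N @[n --> \oo] --> (0 : R).
      apply: (@cvg_ext _ _ _ (fun n => Q (n + N)%N)) => [n|]; first by rewrite addnC.
      by rewrite (cvg_shiftn N Q).
    move=> QN0; have h n : Q N / 2 <= Q (N + n)%N.
      rewrite (le_trans _ (Qlow N n LN)) // ler_wpM2l //.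
      have : L * N.+1%:R^-1 <= 2^-1 by rewrite ler_pdivrMr //; lra.
      have : 0 <= L * (N + n).+1%:R^-1 by rewrite mulr_ge0.
      by set i := N.+1%:R^-1; set j := (_ + _).+1%:R^-1; clearbody i j; lra.
    have : Q N / 2 <= 0 by apply: cvg_ge QN0 _; near=> n; exact: h.
    lra.
  have := Qge N; have := nsq_ge0 (y N); have := nsq_ge0 (y N.+1) => n1 n0 h.
  apply: nsq_le0; have : c * (nsq (y N) + nsq (y N.+1)) <= 0 by exact: le_trans h QN.
  by rewrite pmulr_rle0 //; lra.
have [N NL] : exists N : nat, 2 * L <= N%:R.
  by exists (Num.truncn (2 * L)).+1; rewrite ltW // truncnS_gt.
have farN n : (N <= n)%N -> y n = 0.
  by move=> Nn; apply: far; rewrite (le_trans NL) // ler_nat leqW.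
(* The recurrence can be run backwards, which carries the zeros beyond [N] down to 0. *)
have : forall k n, (N <= n + k)%N -> y n = 0.
  elim=> [|k IH] n; first by rewrite addn0; exact: farN.
  by move=> Nnk; rewrite yE (IH n.+1) ?(IH n.+2) ?mulr0 ?subr0 //; lia.
by move=> all n; apply: (all N); exact: leq_addl.
Unshelve. all: by end_near. Qed.

(** * Continued fractions *)

Lemma cvgR_unique (R : realType) (T : Type) (F : set_system T)
    (FF : ProperFilter F) (f : T -> R) (a b : R) :
  f x @[x --> F] --> a -> f x @[x --> F] --> b -> a = b.
Proof.
by move=> fa fb; rewrite -(cvg_lim (@Rhausdorff R) fa) (cvg_lim (@Rhausdorff R) fb).
Qed.

(** Ultrafilters replace the extraction of subsequences: countably many bounded quantities converge
    along the same one, with no diagonal argument. *)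
Lemma ultra_bounded_cvg (R : realType) (T : Type) (U : set_system T)
    (f : T -> R) (M : R) :
  UltraFilter U -> (\forall x \near U, `|f x| <= M) ->
  exists l : R, f x @[x --> U] --> l.
Proof.
move=> UU fM; have FU : ProperFilter U := @ultra_proper _ _ UU.
have fMM : (f x @[x --> U]) [set` `[- M, M]].
  by near=> x; rewrite /= in_itv /= -ler_norml; near: x; exact: fM.
have [l [_ lcl]] := @segment_compact R (- M) M _ _ fMM.
exists l => B nB.
have [//|UnB] := in_ultra_setVsetC (f @^-1` B) UU.
have [x [nBx Bx]] := lcl (~` B) B UnB nB.
by [].
Unshelve. all: by end_near. Qed.

(** If the preimage of some neighbourhood were missing from [F], then [F] could be refined by its
    complement to an ultrafilter along which convergence fails. *)
Lemma ultra_cvg (T : Type) (V : topologicalType) (F : set_system T)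
    (FF : ProperFilter F) (f : T -> V) (l : V) :
  (forall U, UltraFilter U -> F `<=` U -> f x @[x --> U] --> l) ->
  f x @[x --> F] --> l.
Proof.
move=> cvgU B nB; apply: contrapT => nFB.
have PG : ProperFilter (within (~` (f @^-1` B)) F).
  apply: Build_ProperFilter_ex => P; rewrite /within /= => FP.
  apply: contrapT => nP; apply: nFB; apply: filterS FP => x /= h.
  by apply: contrapT => nBx; apply: nP; exists x; exact: h.
have [U [UU GU]] := ultraFilterLemma PG.
have FU : ProperFilter U := @ultra_proper _ _ UU.
have subU : F `<=` U.
  by move=> P FP; apply: GU; rewrite /within /=; apply: filterS FP.
have UB : U (f @^-1` B) := cvgU U UU subU B nB.
have UnB : U (~` (f @^-1` B)).
  by apply: GU; rewrite /within /=; apply: filterE.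
by have [x []] := filter_ex (filterI UB UnB).
Qed.

(* s n = 1 / (d n + 1 / (d n.+1 + ...)). *)
Definition cf_sol (R : realType) (d s : nat -> R) : Prop :=
  forall n, 0 <= s n /\ s n * (d n + s n.+1) = 1.

Fixpoint cf_trunc (R : realType) (d : nat -> R) (k n : nat) : R :=
  if k is k'.+1 then (d n + cf_trunc d k' n.+1)^-1 else 0.

Lemma cf_gt0 (R : realType) (d s : nat -> R) n : cf_sol d s -> 0 < s n.
Proof.
move=> /(_ n)[s0 s1]; rewrite lt0r s0 andbT; apply/eqP => sn0.
by move: s1; rewrite sn0 mul0r => /esym/eqP; rewrite oner_eq0.
Qed.

(** The truncations that end at a common index M satisfy the recursion exactly at each n < M and
    stay in [0, 1/delta]; their limits in M along an ultrafilter satisfy it everywhere. *)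
Lemma cf_exists (R : realType) (d : nat -> R) (delta : R) :
  0 < delta -> (forall n, delta <= d n) -> exists s, cf_sol d s.
Proof.
move=> de0 dd; have [U [UU oU]] := ultraFilterLemma eventually_filter.
have FU : ProperFilter U := @ultra_proper _ _ UU.
have tb k n : 0 <= cf_trunc d k n <= delta^-1.
  elim: k n => [n|k IH n] /=; first by rewrite lexx invr_ge0 ltW.
  have /andP[t0 _] := IH n.+1.
  have dt : delta <= d n + cf_trunc d k n.+1 by rewrite (le_trans (dd n)) // lerDl.
  have dt0 := lt_le_trans de0 dt.
  by rewrite invr_ge0 (ltW dt0) lef_pV2 // posrE.
have lims n : exists l : R, cf_trunc d (M - n)%N n @[M --> U] --> l.
  apply: (@ultra_bounded_cvg _ _ _ _ delta^-1) => //; near=> M.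
  by have /andP[? ?] := tb (M - n)%N n; rewrite ger0_norm.
exists (fun n => projT1 (cid (lims n))) => n.
case: (cid (lims n)) => l1 h1; case: (cid (lims n.+1)) => l2 h2 /=.
split; first by apply: (cvg_ge _ h1); near=> M; case/andP: (tb (M - n)%N n).
have h3 : cf_trunc d (M - n)%N n * (d n + cf_trunc d (M - n.+1)%N n.+1) @[M --> U]
    --> l1 * (d n + l2).
  by apply: cvgM => //; apply: cvgD => //; exact: cvg_cst.
have h4 : cf_trunc d (M - n)%N n * (d n + cf_trunc d (M - n.+1)%N n.+1) @[M --> U]
    --> (1 : R).
  apply: cvg_near_cst; apply: oU; exists n.+1 => // M /= nM.
  rewrite -(subnSK nM) /= mulVf // gt_eqF //.
  have /andP[t0 _] := tb (M - n.+1)%N n.+1.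
  by rewrite (lt_le_trans de0) // (le_trans (dd n)) // lerDl.
exact: cvgR_unique h3 h4.
Unshelve. all: by end_near. Qed.

Lemma cf_le (R : realType) (d s : nat -> R) n : 0 < d n -> cf_sol d s ->
  s n < (d n)^-1.
Proof.
move=> d0 cs; have s0 := cf_gt0 n cs; have s1 := cf_gt0 n.+1 cs.
have [_ sE] := cs n.
by rewrite -[ltRHS]mul1r ltr_pdivlMr // -sE ltr_pM2l // ltrDl.
Qed.

(** A contraction factor below 1 exists only for two consecutive terms, since a single [s n] may
    exceed 1. It comes from s n s (n+1) delta^2 <= s n d n = 1 - s n s (n+1). *)
Lemma cf_mul_le (R : realType) (d s : nat -> R) (delta : R) n :
  0 < delta -> (forall n, delta <= d n) -> cf_sol d s ->
  s n * s n.+1 <= (1 + delta ^+ 2)^-1.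
Proof.
move=> de0 dd cs; have s0 := cf_gt0 n cs; have s1 := cf_gt0 n.+1 cs.
have s2 := cf_gt0 n.+2 cs; have [_ e0] := cs n; have [_ e1] := cs n.+1.
rewrite -[leRHS]mul1r ler_pdivlMr; last by rewrite ltr_wpDr ?sqr_ge0.
have : s n * delta <= s n * d n by rewrite ler_wpM2l // ltW.
have : s n.+1 * delta <= s n.+1 * d n.+1 by rewrite ler_wpM2l // ltW.
move=> h1 h0.
have h2 : s n.+1 * delta <= 1.
  by rewrite (le_trans h1) // -e1 ler_wpM2l ?(ltW s1) // lerDl ltW.
have : s n * delta * (s n.+1 * delta) <= s n * d n.
  rewrite (le_trans _ h0) // ler_piMr // mulr_ge0 // ltW //.
by move: e0; lra.
Qed.

(* The difference of two continued fractions contracts by s n * s' n at each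
   step, with alternating signs; so they compare like their entries of even
   index, and oppositely to those of odd index. *)
Lemma cf_compare (R : realType) (d d' s s' : nat -> R) (delta : R) :
  0 < delta -> (forall n, delta <= d n) -> (forall n, delta <= d' n) ->
  cf_sol d s -> cf_sol d' s' ->
  (forall k, d k.*2 <= d' k.*2) -> (forall k, d' k.*2.+1 <= d k.*2.+1) ->
  s' 0%N <= s 0%N.
Proof.
move=> de0 dd dd' cs cs' even odd; set r := (1 + delta ^+ 2)^-1.
have d1 : 0 < 1 + delta ^+ 2 by rewrite ltr_wpDr ?sqr_ge0.
have r0 : 0 <= r by rewrite invr_ge0 ltW.
have r1 : r < 1 by rewrite invf_lt1 // ltrDl exprn_gt0.
have bound k : s' 0%N - s 0%N <= r ^+ k * delta^-1.
  elim: k d d' s s' dd dd' cs cs' even odd => [|k IH] d d' s s' dd dd' cs cs' even odd.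
    rewrite mul1r lerBlDr.
    rewrite (le_trans (ltW (cf_le (lt_le_trans de0 (dd' 0%N)) cs'))) //.
    rewrite (@le_trans _ _ delta^-1) ?lerDl ?(ltW (cf_gt0 _ cs)) //.
    by rewrite lef_pV2 ?posrE // (lt_le_trans de0).
  have IH2 := IH (fun n => d n.+2) (fun n => d' n.+2) (fun n => s n.+2)
    (fun n => s' n.+2) (fun n => dd n.+2) (fun n => dd' n.+2)
    (fun n => cs n.+2) (fun n => cs' n.+2)
    (fun k => even k.+1) (fun k => odd k.+1).
  have sg n := cf_gt0 n cs; have sg' n := cf_gt0 n cs'.
  have m := cf_mul_le 0 de0 dd cs; have m' := cf_mul_le 0 de0 dd' cs'.
  rewrite -/r in m m'.
  have [_ e0] := cs 0%N; have [_ e1] := cs 1%N.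
  have [_ e0'] := cs' 0%N; have [_ e1'] := cs' 1%N.
  have D1 : s' 1%N - s 1%N = s 1%N * s' 1%N * (d 1%N - d' 1%N + (s 2%N - s' 2%N)).
    transitivity (s' 1%N * (s 1%N * (d 1%N + s 2%N)) - s 1%N * (s' 1%N * (d' 1%N + s' 2%N))).
      by rewrite e1 e1' !mulr1.
    ring.
  have D0 : s' 0%N - s 0%N = s 0%N * s' 0%N * (d 0%N - d' 0%N + (s 1%N - s' 1%N)).
    transitivity (s' 0%N * (s 0%N * (d 0%N + s 1%N)) - s 0%N * (s' 0%N * (d' 0%N + s' 1%N))).
      by rewrite e0 e0' !mulr1.
    ring.
  have ss0 : 0 < s 0%N * s' 0%N by rewrite mulr_gt0.
  have ss1 : 0 < s 1%N * s' 1%N by rewrite mulr_gt0.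
  (* Advancing two entries at a time keeps the sign of the difference, so that the induction needs
     an upper bound only. *)
  have step : s' 0%N - s 0%N <=
      (s 0%N * s 1%N) * (s' 0%N * s' 1%N) * (s' 2%N - s 2%N).
    have -> : (s 0%N * s 1%N) * (s' 0%N * s' 1%N) * (s' 2%N - s 2%N) =
        s 0%N * s' 0%N * (s 1%N * s' 1%N * (s' 2%N - s 2%N)) by ring.
    rewrite D0 ler_pM2l //.
    have h0 := even 0%N; have h1 := odd 0%N; rewrite /= in h0 h1.
    have : s 1%N * s' 1%N * (d' 1%N - d 1%N) <= 0.
      by rewrite pmulr_rle0 // subr_le0.
    have : s 1%N - s' 1%N = s 1%N * s' 1%N * (s' 2%N - s 2%N)
        + s 1%N * s' 1%N * (d' 1%N - d 1%N).
      by rewrite -opprB D1; ring.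
    by move=> ->; lra.
  have p0 : 0 < s 0%N * s 1%N by rewrite mulr_gt0.
  have p0' : 0 < s' 0%N * s' 1%N by rewrite mulr_gt0.
  have rd0 : 0 <= r ^+ k * delta^-1.
    by rewrite mulr_ge0 ?exprn_ge0 // invr_ge0 ltW.
  rewrite (le_trans step) // (@le_trans _ _ ((s 0%N * s 1%N) * (s' 0%N * s' 1%N) *
    (r ^+ k * delta^-1))) //; first by rewrite ler_wpM2l // mulr_ge0 // ltW.
  rewrite exprS -[r * _ * _]mulrA ler_wpM2r // -[leRHS]mulr1 ler_pM ?(ltW p0) ?(ltW p0') //.
  by rewrite (le_trans m') // ltW.
rewrite -subr_le0; apply: (@cvg_ge R _ \oo _ (fun k => r ^+ k * delta^-1)).
  rewrite -[X in _ --> X](mul0r delta^-1); apply: cvgMl.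
  by apply: cvg_expr; rewrite ger0_norm.
by near=> k; exact: bound.
Unshelve. all: by end_near. Qed.

(** On the tails the two parities trade places, so [cf_compare] gives [s 1 <= s' 1]; strictness then
    comes from the entry at 0. *)
Lemma cf_compare_lt (R : realType) (d d' s s' : nat -> R) (delta : R) :
  0 < delta -> (forall n, delta <= d n) -> (forall n, delta <= d' n) ->
  cf_sol d s -> cf_sol d' s' -> d 0%N < d' 0%N ->
  (forall k, d k.*2 <= d' k.*2) -> (forall k, d' k.*2.+1 <= d k.*2.+1) ->
  s' 0%N < s 0%N.
Proof.
move=> de0 dd dd' cs cs' d0 even odd.
have := @cf_compare R (fun n => d' n.+1) (fun n => d n.+1) (fun n => s' n.+1)
  (fun n => s n.+1) delta de0 (fun n => dd' n.+1) (fun n => dd n.+1)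
  (fun n => cs' n.+1) (fun n => cs n.+1) odd (fun k => even k.+1).
move=> /= s1; have [_ e] := cs 0%N; have [_ e'] := cs' 0%N.
have p := cf_gt0 1 cs; have p' := cf_gt0 1 cs'; have q := cf_gt0 0 cs.
have q' := cf_gt0 0 cs'.
have D : 0 < d 0%N + s 1%N by rewrite -(pmulr_rgt0 _ q) e.
rewrite -(ltr_pM2r D) e -e' ltr_pM2l //; lra.
Qed.

(** The equivalence transformation of continued fractions: it leaves every product [s n * s n.+1]
    unchanged. *)
Lemma cf_scale (R : realType) (d s : nat -> R) (u : R) : 0 < u -> cf_sol d s ->
  cf_sol (fun n => if odd n then d n / u else d n * u)
         (fun n => if odd n then s n * u else s n / u).
Proof.
move=> u0 cs n; have [s0 sE] := cs n; have un0 : u != 0 by rewrite gt_eqF.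
split; first by case: odd; rewrite ?mulr_ge0 ?invr_ge0 // ltW.
rewrite /=; case: (odd n) => /=; rewrite -[RHS]sE; field => //.
Qed.

(** [F] is u / s 0, that is, u d 0 + 1 / (d 1 / u + 1 / (u d 2 + ...)). It is a relation rather than
    a function so that existence, comparison and uniqueness of roots can be handled separately. *)
Definition cf_ratio_spec (R : realType) (u : R) (d : nat -> R) (F : R) : Prop :=
  exists s, cf_sol d s /\ F * s 0%N = u.

(** Absorbing [t] into the scale [u] of the first fraction reduces the multiplicative bound to a
    plain comparison of scaled entries. *)
Lemma cf_ratio_le (R : realType) (u u' t delta F F' : R) (d d' : nat -> R) :
  0 < delta -> (forall n, delta <= d n) -> (forall n, delta <= d' n) ->
  0 < u -> 0 < u' -> 0 < t ->
  cf_ratio_spec u d F -> cf_ratio_spec u' d' F' ->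
  (forall k, u' * d' k.*2 <= t * (u * d k.*2)) ->
  (forall k, d k.*2.+1 / u <= t * (d' k.*2.+1 / u')) ->
  F' <= t * F.
Proof.
move=> de0 dd dd' u0 u'0 t0 [s [cs FE]] [s' [cs' FE']] even odd'.
have ut0 : 0 < u * t by rewrite mulr_gt0.
have c1 := cf_scale ut0 cs; have c2 := cf_scale u'0 cs'.
set B := (fun n => if _ then _ else d n * _) in c1.
set B' := (fun n => if _ then _ else d' n * _) in c2.
(* Scaling by x and 1/x keeps the entries above min (delta x, delta / x), so one positive lower
   bound serves both scaled fractions. *)
have [delta' de'0 [hB hB']] : exists2 e, 0 < e & (forall n, e <= B n) /\ (forall n, e <= B' n).
  pose m (x : R) := Num.min (delta * x) (delta / x).
  have m0 x : 0 < x -> 0 < m x by move=> x0; rewrite lt_min !mulr_gt0 ?invr_gt0.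
  have mB x e n : 0 < x -> (forall n, delta <= e n) ->
      m x <= (if odd n then e n / x else e n * x).
    move=> x0 he; rewrite ge_min; case: (odd n); apply/orP; [right|left];
    by rewrite ler_wpM2r ?invr_ge0 // ltW.
  exists (Num.min (m (u * t)) (m u')); first by rewrite lt_min !m0.
  by split=> n; rewrite ge_min mB ?orbT.
have := cf_compare de'0 hB' hB c2 c1; rewrite /B /B' /=.
have s0 := cf_gt0 0 cs; have s0' := cf_gt0 0 cs'.
have -> : F = u / s 0%N by rewrite -FE mulfK // gt_eqF.
have -> : F' = u' / s' 0%N by rewrite -FE' mulfK // gt_eqF.
move=> h; rewrite mulrA [t * u]mulrC.
suff hh : s 0%N / (u * t) <= s' 0%N / u'.
  rewrite -lef_pV2 ?posrE ?divr_gt0 ?mulr_gt0 //.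
  by rewrite !invfM !invrK [X in X <= _]mulrC [X in _ <= X]mulrC -invfM.
apply: h => k; rewrite odd_double /=.
  by rewrite mulrC (le_trans (even k)) // mulrC -mulrA mulrC -mulrA [t * _]mulrC.
rewrite invfM mulrA ler_pdivrMr // (le_trans (odd' k)) // mulrC //.
Qed.

Lemma cf_ratio_lt (R : realType) (u u' delta F F' : R) (d d' : nat -> R) :
  0 < delta -> (forall n, delta <= d n) -> (forall n, delta <= d' n) ->
  0 < u -> 0 < u' ->
  cf_ratio_spec u d F -> cf_ratio_spec u' d' F' ->
  u * d 0%N < u' * d' 0%N ->
  (forall k, u * d k.*2 <= u' * d' k.*2) ->
  (forall k, d' k.*2.+1 / u' <= d k.*2.+1 / u) ->
  F < F'.
Proof.
move=> de0 dd dd' u0 u'0 [s [cs FE]] [s' [cs' FE']] lt0 even odd'.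
have c1 := cf_scale u0 cs; have c2 := cf_scale u'0 cs'.
set B := (fun n => if _ then _ else d n * _) in c1.
set B' := (fun n => if _ then _ else d' n * _) in c2.
have [delta' de'0 [hB hB']] : exists2 e, 0 < e & (forall n, e <= B n) /\ (forall n, e <= B' n).
  pose m (x : R) := Num.min (delta * x) (delta / x).
  have m0 x : 0 < x -> 0 < m x by move=> x0; rewrite lt_min !mulr_gt0 ?invr_gt0.
  have mB x e n : 0 < x -> (forall n, delta <= e n) ->
      m x <= (if odd n then e n / x else e n * x).
    move=> x0 he; rewrite ge_min; case: (odd n); apply/orP; [right|left];
    by rewrite ler_wpM2r ?invr_ge0 // ltW.
  exists (Num.min (m u) (m u')); first by rewrite lt_min !m0.
  by split=> n; rewrite ge_min mB ?orbT.
have := cf_compare_lt de'0 hB hB' c1 c2; rewrite /B /B' /= => h.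
have s0 := cf_gt0 0 cs; have s0' := cf_gt0 0 cs'.
have -> : F = u / s 0%N by rewrite -FE mulfK // gt_eqF.
have -> : F' = u' / s' 0%N by rewrite -FE' mulfK // gt_eqF.
suff hh : s' 0%N / u' < s 0%N / u.
  by rewrite -ltf_pV2 ?posrE ?divr_gt0 // !invfM !invrK mulrC [X in _ < X]mulrC.
apply: h => [|k|k]; first by rewrite mulrC [X in _ < X]mulrC.
  by rewrite odd_double mulrC [X in _ <= X]mulrC.
by rewrite odd_double /=; exact: odd'.
Qed.

Lemma cf_ratio_bounds (R : realType) (u F : R) (d : nat -> R) :
  (forall n, 0 < d n) -> 0 < u -> cf_ratio_spec u d F ->
  u * d 0%N < F /\ F < u * d 0%N + u / d 1%N.
Proof.
move=> d0 u0 [s [cs FE]]; have [_ e] := cs 0%N.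
have s0 := cf_gt0 0 cs; have s1 := cf_gt0 1 cs.
have -> : F = u * d 0%N + u * s 1%N.
  apply: (mulIf (lt0r_neq0 s0)); rewrite FE -mulrDr mulrC mulrA.
  by rewrite [_ * u]mulrC -mulrA e mulr1.
by rewrite ltrDl mulr_gt0 // ltrD2l ltr_pM2l // cf_le.
Qed.

Lemma cf_ratio_exists (R : realType) (u delta : R) (d : nat -> R) :
  0 < delta -> (forall n, delta <= d n) -> exists F, cf_ratio_spec u d F.
Proof.
move=> de0 dd; have [s cs] := cf_exists de0 dd.
by exists (u / s 0%N), s; split=> //; rewrite divfK // gt_eqF // (cf_gt0 0 cs).
Qed.

(* The hypotheses make G continuous. *)
Lemma square_lipschitz_IVT (R : realType) (G : R -> R) (a b c : R) :
  0 < a -> a <= b ->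
  (forall x y, a <= x -> x <= y -> y <= b -> G x <= G y) ->
  (forall x y, a <= x -> x <= y -> y <= b -> G y <= (y / x) ^+ 2 * G x) ->
  0 < G a -> G a < c -> c < G b ->
  exists x, [/\ a < x, x < b & G x = c].
Proof.
move=> a0 ab mono lip Ga0 Gac cGb.
have c0 : 0 < c by exact: lt_trans Gac.
have cont : {within `[a, b], continuous G}.
  apply/subspace_continuousP => x /=; rewrite in_itv /= => /andP[ax xb].
  have x0 : 0 < x by exact: lt_le_trans ax.
  (* Modulus of continuity at x: monotonicity controls one side of [G x] and the quadratic growth
     bound the other. *)
  pose h y := G x * `|(y / x) ^+ 2 - 1|.
  have Gpos y : a <= y -> y <= b -> 0 <= G y.
    by move=> ay yb; rewrite (le_trans (ltW Ga0)) // mono.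
  have h0 : h y @[y --> within `[a, b] (nbhs x)] --> (0 : R).
    apply: cvg_trans (_ : h y @[y --> x] --> (0 : R)).
      by apply: cvg_app; exact: cvg_within.
    have -> : 0 = G x * `|(x / x) ^+ 2 - 1|.
      by rewrite divff ?gt_eqF // expr1n subrr normr0 mulr0.
    apply: cvgMr; apply: cvg_norm; apply: cvgB; last exact: cvg_cst.
    apply: cvg_ext (fun y => esym (expr2 (y / x))) _; rewrite expr2.
    by apply: cvgM; apply: cvgMl; exact: cvg_id.
  have hD : G x + h y @[y --> within `[a, b] (nbhs x)] --> G x.
    by rewrite -[X in _ --> X]addr0; apply: cvgD => //; exact: cvg_cst.
  have hB : G x - h y @[y --> within `[a, b] (nbhs x)] --> G x.
    by rewrite -[X in _ --> X]subr0; apply: cvgB => //; exact: cvg_cst.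
  apply: squeeze_cvgr hB hD; rewrite near_withinE; near=> y => /=.
  rewrite in_itv /= => /andP[ay yb]; rewrite -ler_distlC distrC /h.
  have y0 : 0 < y by exact: lt_le_trans ay.
  have [xy|/ltW yx] := leP x y.
    have t1 : 1 <= (y / x) ^+ 2 by rewrite exprn_ege1 // ler_pdivlMr // mul1r.
    rewrite !ger0_norm ?subr_ge0 ?mono // mulrBr mulr1 mulrC lerD2r.
    exact: lip.
  have t1 : (y / x) ^+ 2 <= 1.
    by rewrite exprn_ile1 ?divr_ge0 ?(ltW x0) ?(ltW y0) // ler_pdivrMr // mul1r.
  rewrite !ler0_norm ?subr_le0 ?mono // !opprB mulrBr mulr1 lerD2l lerN2.
  rewrite -ler_pdivlMr ?exprn_gt0 ?divr_gt0 // -exprVn invf_div mulrC.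
  exact: lip.
have [|x xab Gx] := IVT ab cont (_ : Num.min (G a) (G b) <= c <= Num.max (G a) (G b)).
  by rewrite ge_min le_max (ltW Gac) (ltW cGb) orbT.
exists x; move: xab; rewrite in_itv /= !le_eqVlt => /andP[].
case/orP=> [/eqP ax|ax]; first by move: Gac; rewrite ax Gx ltxx.
case/orP=> [/eqP xb|xb //]; first by move: cGb; rewrite -xb Gx ltxx.
Unshelve. all: by end_near. Qed.

(** * Decaying solutions on a line *)

Definition line_eq (R : realType) (d z : int -> R[i]) : Prop :=
  forall m, d m * z m = z (m + 1) - z (m - 1).

Definition null_line (R : realType) (z : int -> R[i]) : Prop :=
  nsq (z n%:Z) @[n --> \oo] --> (0 : R) /\
  nsq (z (- n%:Z)) @[n --> \oo] --> (0 : R).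

(* The reflection with alternating signs turns the half line m <= 0 into a
   solution of the same equation on m >= 0. *)
Definition left_half (R : realType) (z : int -> R[i]) (n : nat) : R[i] :=
  (-1) ^+ n * z (- n%:Z).

Lemma line_halves (R : realType) (d z : int -> R[i]) :
  line_eq d z -> (forall m, d (- m) = d m) ->
  half_line_eq (fun n => d n%:Z) (fun n => z n%:Z) /\
  half_line_eq (fun n => d n%:Z) (left_half z).
Proof.
move=> eqz dE; split=> n.
  by rewrite eqz; congr (z _ - z _); lia.
have := eqz (- n.+1%:Z); rewrite dE.
have -> : - n.+1%:Z + 1 = - n%:Z by lia.
have -> : - n.+1%:Z - 1 = - n.+2%:Z by lia.
by rewrite /left_half mulrCA => ->; rewrite !exprS; ring.
Qed.

Lemma left_half_null (R : realType) (z : int -> R[i]) :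
  null_line z -> nsq (left_half z n) @[n --> \oo] --> (0 : R).
Proof.
move=> [_ h]; apply: cvg_ext h => n.
rewrite /left_half nsqM; suff -> : nsq ((-1) ^+ n : R[i]) = 1 by rewrite mul1r.
by elim: n => [|n IH]; rewrite ?exprS ?nsqM ?IH ?mulr1 ?nsqN nsqC expr1n.
Qed.

Lemma line_center (R : realType) (d z : int -> R[i]) : line_eq d z ->
  d 0 * z 0 = z 1 + left_half z 1.
Proof. by move=> eqz; rewrite eqz /left_half expr1 mulN1r. Qed.

Lemma line_zero (R : realType) (d z : int -> R[i]) : line_eq d z ->
  z 0 = 0 -> z 1 = 0 -> forall m, z m = 0.
Proof.
move=> eqz z0 z1.
have pos n : z n%:Z = 0 /\ z n.+1%:Z = 0.
  elim: n => [//|n [IH1 IH2]]; split=> //; have := eqz n.+1%:Z.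
  have -> : n.+1%:Z + 1 = n.+2%:Z by lia.
  have -> : n.+1%:Z - 1 = n%:Z by lia.
  by rewrite IH1 IH2 mulr0 subr0.
have neg n : z (- n%:Z) = 0 /\ z (1 - n%:Z) = 0.
  elim: n => [|n [IH1 IH2]]; first by rewrite oppr0 subr0.
  have := eqz (- n%:Z).
  have -> : - n%:Z + 1 = 1 - n%:Z by lia.
  have -> : - n%:Z - 1 = - n.+1%:Z by lia.
  have -> : 1 - n.+1%:Z = - n%:Z by lia.
  by rewrite IH1 IH2 mulr0 sub0r => /esym/eqP; rewrite oppr_eq0 => /eqP.
move=> m; have [m0|m0] := leP 0 m.
  by have [h _] := pos `|m|%N; rewrite gez0_abs in h.
by have [h _] := neg `|m|%N; rewrite ltz0_abs ?opprK in h.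
Qed.

(** The difference of the two shifts is skew-adjoint, so the real part of the pairing with [z]
    telescopes to boundary terms that tend to 0, while every summand is nonnegative. [sigma] carries
    the common sign of the real parts. *)
Lemma line_dissipative (R : realType) (d z : int -> R[i]) (sigma : R) :
  line_eq d z -> null_line z -> (forall m, 0 < sigma * complex.Re (d m)) ->
  forall m, z m = 0.
Proof.
move=> eqz [zr zl] dpos m.
pose r k := complex.Re (z k * (z (k - 1))^*).
have sumE N : wsum N (fun k => sigma * complex.Re (d k) * nsq (z k)) =
    sigma * (r N%:Z - r (- N%:Z)).
  rewrite -wsum_telescope -wsumZ; apply: eq_wsum => k _.
  rewrite -mulrA; congr (_ * _); rewrite /r addrK.
  transitivity (complex.Re (d k * z k * (z k)^*)); first by rewrite /nsq !ReImE; ring.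
  by rewrite eqz !ReImE; ring.
have ge0 k : 0 <= sigma * complex.Re (d k) * nsq (z k).
  by rewrite mulr_ge0 ?nsq_ge0 // ltW.
have rr : r n%:Z @[n --> \oo] --> (0 : R).
  have [h _] := cvg0_cross zr.
  suff : r n.+1%:Z @[n --> \oo] --> (0 : R) by rewrite (cvg_shiftS (fun n : nat => r n%:Z)).
  rewrite -[X in _ --> X]oppr0; apply: cvg_ext (cvgN h) => n /=.
  rewrite /r; have -> : n.+1%:Z - 1 = n%:Z by lia.
  by rewrite mulNr ReN opprK.
have rl : r (- n%:Z) @[n --> \oo] --> (0 : R).
  have [h _] := cvg0_cross zl.
  rewrite -[X in _ --> X]oppr0; apply: cvg_ext (cvgN h) => n /=.
  rewrite /r; have -> : - n%:Z - 1 = - n.+1%:Z by lia.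
  by rewrite !ReImE; ring.
have lim0 : sigma * (r n%:Z - r (- n%:Z)) @[n --> \oo] --> (0 : R).
  have -> : 0 = sigma * (0 - 0) :> R by rewrite subrr mulr0.
  by apply: cvgMr; apply: cvgB.
have : sigma * complex.Re (d m) * nsq (z m) <= 0.
  apply: cvg_ge lim0 _; near=> N; rewrite -sumE; apply: wsum_term => //.
  have : (`|m|.+1 <= N)%N by near: N; exact: nbhs_infty_ge.
  by lia.
by rewrite pmulr_rle0 // => /nsq_le0.
Unshelve. all: by end_near. Qed.

(* In the cone spanned by u and its inverse, both half lines contribute to
   - d 0 = c u on the same strict side. *)
Lemma line_cone (R : realType) (d z : int -> R[i]) (u : R[i]) (c : R) :
  line_eq d z -> null_line z -> (forall m, d (- m) = d m) ->
  0 < c -> u != 0 -> d 0 = - (c%:C * u) ->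
  (forall n, complex.Im (d n.+1%:Z * u^*) <= 0) ->
  (forall n, 0 < complex.Im (d n.+1%:Z * u)) ->
  forall m, z m = 0.
Proof.
move=> eqz znull dE c0 u0 d0 dneg dpos.
have [hr hl] := line_halves eqz dE; have [zr _] := znull.
have dpos' n : 0 <= complex.Im (d n.+1%:Z * u) by rewrite ltW.
have br : complex.Im (d 1 * u) * nsq (z 1) <=
    - complex.Im (- z 1 * (z 0)^* * u^*) := half_line_cone hr zr dneg dpos'.
have bl : complex.Im (d 1 * u) * nsq (left_half z 1) <=
    - complex.Im (- left_half z 1 * (left_half z 0)^* * u^*) :=
  half_line_cone hl (left_half_null znull) dneg dpos'.
have lh0 : left_half z 0 = z 0 by rewrite /left_half expr0 mul1r oppr0.
rewrite lh0 in bl.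
have key : complex.Im (d 1 * u) * (nsq (z 1) + nsq (left_half z 1)) <= 0.
  (* [d 0 * u^*] is real, so the equation at 0, paired with [z 0], makes the two half-line bounds
     add up to 0. *)
  have : - complex.Im (- z 1 * (z 0)^* * u^*) -
      complex.Im (- left_half z 1 * (z 0)^* * u^*) = 0.
    transitivity (complex.Im (d 0 * z 0 * (z 0)^* * u^*)).
      by rewrite (line_center eqz) !ReImE; ring.
    by rewrite d0 !ReImE /=; ring.
  by move: bl br; lra.
move: key; rewrite pmulr_rle0; last exact: (dpos 0%N).
have := nsq_ge0 (z 1); have := nsq_ge0 (left_half z 1) => n1 n2 n3.
have z1 : z 1 = 0 by apply: nsq_le0; lra.
have l1 : left_half z 1 = 0 by apply: nsq_le0; lra.
apply: (line_zero eqz _ z1); have := line_center eqz.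
rewrite z1 l1 addr0 d0 => /eqP; rewrite mulf_eq0 oppr_eq0 mulf_eq0 (negPf u0).
by rewrite eq_complex /= (gt_eqF c0) /= => /eqP.
Qed.

(** By symmetry both half lines solve the same continued fraction, whose solution is unique by
    [cf_compare] used in both directions; hence the factor 2 at the centre. *)
Lemma line_real (R : realType) (d : int -> R) (z : int -> R[i]) (delta : R) :
  line_eq (fun m => (d m)%:C) z -> null_line z -> (forall m, d (- m) = d m) ->
  0 < delta -> (forall n : nat, delta <= d n.+1%:Z) ->
  (forall m, z m = 0) \/
  exists s, cf_sol (fun n : nat => d n.+1%:Z) s /\ d 0 = - (2 * s 0%N).
Proof.
move=> eqz znull dE de0 dd.
have dE' m : (d (- m))%:C = (d m)%:C :> R[i] by rewrite dE.
have [hr hl] := line_halves eqz dE'; have [zr _] := znull.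
have d0 n : 0 < d n.+1%:Z by exact: lt_le_trans (dd n).
have [r0 r1] := @half_line_real R (fun n => d n%:Z) _ d0 hr zr.
have [l0 l1] := @half_line_real R (fun n => d n%:Z) _ d0 hl (left_half_null znull).
have lh0 : left_half z 0 = z 0 by rewrite /left_half expr0 mul1r oppr0.
have [z0|z0] := eqVneq (z 0) 0.
  by left; apply: (line_zero eqz) => //; exact: (r0 z0 1%N).
right; have [s [zs sE]] := r1 z0.
have [|s' [zs' sE']] := l1; first by rewrite lh0.
have cs : cf_sol (fun n : nat => d n.+1%:Z) s.
  by move=> n; have [s0 ?] := sE n; split=> //; exact: ltW.
have cs' : cf_sol (fun n : nat => d n.+1%:Z) s'.
  by move=> n; have [s0 ?] := sE' n; split=> //; exact: ltW.
exists s; split=> //.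
have ss : s' 0%N = s 0%N.
  by apply/eqP; rewrite eq_le (cf_compare de0 dd dd cs cs') // (cf_compare de0 dd dd cs' cs).
have := line_center eqz; rewrite (zs 0%N) (zs' 0%N) lh0 -mulrDl => /(mulIf z0).
by move=> /(congr1 (@complex.Re R)); rewrite !ReImE /= ss => ->; ring.
Qed.

(** Inside the band each half line vanishes separately, by [half_line_band]. On its edge and beyond,
    half-line solutions may decay, and the equation at m = 0 excludes them: this is what the
    condition on [v 0] is for. *)
Lemma line_imaginary (R : realType) (E K : R) (v : int -> R) (z : int -> R[i]) :
  line_eq (fun m => (E * (1 + v m)) *i) z -> null_line z ->
  (forall m, v (- m) = v m) -> 0 <= K ->
  (forall n : nat, 0 < v n.+1%:Z <= K * (n.+1%:R^-1 - n.+2%:R^-1)) ->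
  0 < v 0 \/ 1 + v 0 < 0 ->
  forall m, z m = 0.
Proof.
move=> eqz znull vE K0 vK v0.
have dE m : (E * (1 + v (- m))) *i = (E * (1 + v m)) *i :> R[i] by rewrite vE.
have [hr hl] := line_halves eqz dE; have [zr _] := znull.
have zl := left_half_null znull.
have lh0 : left_half z 0 = z 0 by rewrite /left_half expr0 mul1r oppr0.
(* Multiplication by powers of -i or i turns z(m+1) - z(m-1) into a sum with real coefficients.
   Outside the band the sign [e] is chosen so that e E = |E|. *)
pose phase (e : R) : R[i] := (- e) *i.
have phase2 e : e ^+ 2 = 1 -> phase e ^+ 2 = -1.
  by move=> e1; apply: complex_ext; rewrite expr2 !ReImE /=; move: e1; rewrite expr2; lra.
have phaseE e (y : nat -> R[i]) : e ^+ 2 = 1 ->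
    half_line_eq (fun n : nat => (E * (1 + v n%:Z)) *i) y ->
    forall n : nat, phase e ^+ n.+2 * y n.+2 + phase e ^+ n * y n =
      (e * E * (1 + v n.+1%:Z))%:C * (phase e ^+ n.+1 * y n.+1).
  move=> e1 hy n.
  rewrite !exprS; set q := _ ^+ n.
  have -> : phase e * (phase e * q) * y n.+2 + q * y n = q * (phase e ^+ 2 * y n.+2 + y n).
    by ring.
  have -> : y n.+2 = (E * (1 + v n.+1%:Z)) *i * y n.+1 + y n by rewrite hy subrK.
  rewrite phase2 // mulN1r opprD subrK.
  have -> : - ((E * (1 + v n.+1%:Z)) *i * y n.+1) =
      (e * E * (1 + v n.+1%:Z))%:C * phase e * y n.+1.
    rewrite -mulNr; congr (_ * _); apply: complex_ext; rewrite !ReImE /=; first by ring.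
    by move: e1; rewrite expr2 => e1; transitivity (- (e * e * (E * (1 + v n.+1%:Z)))); [rewrite e1; ring|ring].
  by ring.
have phase_nsq e n : e ^+ 2 = 1 -> nsq (phase e ^+ n) = 1.
  move=> e1; elim: n => [|n IH]; first by rewrite expr0 nsqC expr1n.
  by rewrite exprS nsqM IH mulr1 /nsq /= expr0n add0r sqrrN.
have phase_null e (y : nat -> R[i]) : e ^+ 2 = 1 ->
    nsq (y n) @[n --> \oo] --> (0 : R) ->
    nsq (phase e ^+ n * y n) @[n --> \oo] --> (0 : R).
  by move=> e1 y0; apply: cvg_ext y0 => n; rewrite nsqM phase_nsq // mul1r.
have [E2|E2] := ltP `|E| 2.
  have zero (y : nat -> R[i]) : half_line_eq (fun n : nat => (E * (1 + v n%:Z)) *i) y ->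
      nsq (y n) @[n --> \oo] --> (0 : R) -> forall n, y n = 0.
    move=> hy ynull n; have e1 : 1 ^+ 2 = 1 :> R by rewrite expr1n.
    have := half_line_band E2 K0 (v := fun n : nat => v n%:Z) _ _ (phase_null 1 y e1 ynull) n.
    move=> h; apply: nsq_le0; rewrite -[nsq _]mul1r -(phase_nsq 1 n e1) -nsqM h ?nsq0 //.
      by move=> k; have /andP[? ->] := vK k; rewrite ltW.
    by move=> k; rewrite phaseE // mul1r.
  by apply: (line_zero eqz); [exact: (zero _ hr zr 0%N)|exact: (zero _ hr zr 1%N)].
pose e : R := Num.sg E.
have E0 : E != 0 by apply/eqP => E0; move: E2; rewrite E0 normr0; lra.
have e1 : e ^+ 2 = 1 by rewrite /e sqr_sg E0.
have eE : e * E = `|E| by rewrite /e normrEsg.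
have tau2 n : 2 <= e * E * (1 + v n.+1%:Z).
  have /andP[vn _] := vK n; rewrite eE (le_trans E2) // ler_peMr //; lra.
have convex (y : nat -> R[i]) : half_line_eq (fun n : nat => (E * (1 + v n%:Z)) *i) y ->
    nsq (y n) @[n --> \oo] --> (0 : R) ->
    nsq (y 1%N) <= complex.Re (phase e * y 1%N * (y 0%N)^*) <= nsq (y 0%N).
  move=> hy ynull.
  have := half_line_convex (tau := fun n : nat => e * E * (1 + v n%:Z)) tau2
    (phaseE e y e1 hy) (phase_null e y e1 ynull).
  by rewrite expr0 expr1 !mul1r nsqM -(expr1 (phase e)) phase_nsq // mul1r.
have /andP[r1 r2] : nsq (z 1) <= complex.Re (phase e * z 1 * (z 0)^*) <= nsq (z 0).
  exact: convex _ hr zr.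
have /andP[l1 l2] := convex _ hl zl.
rewrite lh0 in l1 l2.
have center : `|E| * (1 + v 0) * nsq (z 0) =
    complex.Re (phase e * z 1 * (z 0)^*) + complex.Re (phase e * left_half z 1 * (z 0)^*).
  rewrite -ReD -mulrDl -mulrDr -(line_center eqz) /nsq -eE !ReImE /=.
  ring.
have nz := nsq_ge0 (z 0); have n1 := nsq_ge0 (z 1); have n2 := nsq_ge0 (left_half z 1).
(* Convexity puts each of the two terms on the right of [center] between 0 and [nsq (z 0)], while
   |E| (1 + v 0) is either larger than 2 or negative. *)
have z00 : nsq (z 0) <= 0.
  case: v0 => v0.
    have : 2 * v 0 * nsq (z 0) <= `|E| * v 0 * nsq (z 0).
      by rewrite ler_wpM2r // ler_wpM2r // ltW.
    have : 2 * nsq (z 0) <= `|E| * nsq (z 0) by rewrite ler_wpM2r.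
    move=> h1 h2; have : 2 * v 0 * nsq (z 0) <= 0.
      by move: center; lra.
    by rewrite pmulr_rle0 // mulr_gt0.
  have Ev : `|E| * (1 + v 0) < 0 by rewrite nmulr_llt0 // normr_gt0.
  rewrite -(nmulr_rge0 _ Ev) center; lra.
have z0 := nsq_le0 z00.
apply: (line_zero eqz z0); apply: nsq_le0; rewrite (le_trans r1) // z0 conjC0 mulr0 //.
Qed.

(** * The dispersion relation *)

(* The coefficient of z m in the eigenvalue equation of the line k.1 = -1. *)
Definition dcoef (R : realType) (alpha nu lam : R) (m : int) : R :=
  (lam + nu * (alpha ^+ 2 + m%:~R ^+ 2)) /
  (alpha / 4 * (1 - (alpha ^+ 2 + m%:~R ^+ 2)^-1)).

Definition right_coef (R : realType) (alpha nu lam : R) (n : nat) : R :=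
  dcoef alpha nu lam n.+1%:Z.

(** The scale is the numerator of [dcoef] at m = 0. With it the whole dependence on [lam] and [nu]
    sits in [F], to be compared with a constant of [alpha]. *)
Definition dispersion (R : realType) (alpha nu lam : R) : R -> Prop :=
  cf_ratio_spec (lam + nu * alpha ^+ 2) (right_coef alpha nu lam).

(* - 2 (alpha / 4) rho_0: with this value of F, dispersion is the eigenvalue
   equation at m = 0, where z 1 = z (-1) = - s 0 for the decaying solution with
   z 0 = 1. *)
Definition neutral_level (R : realType) (alpha : R) : R :=
  (1 - alpha ^+ 2) / (2 * alpha).

Definition kap (R : realType) (alpha : R) (n : nat) : R :=
  alpha ^+ 2 + n.+1%:R ^+ 2.

Definition coef_den (R : realType) (alpha : R) (n : nat) : R :=
  alpha / 4 * (1 - (kap alpha n)^-1).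

Lemma right_coefE (R : realType) (alpha nu lam : R) n :
  right_coef alpha nu lam n = (lam + nu * kap alpha n) / coef_den alpha n.
Proof. by []. Qed.

Section Dispersion.
Variables (R : realType) (alpha : R).
Hypotheses (alpha_gt : 1 / 2 < alpha) (alpha_lt : alpha < 1).

Lemma alpha_gt0 : 0 < alpha. Proof. by apply: lt_trans alpha_gt; lra. Qed.

Lemma alpha2_bounds : 1 / 4 < alpha ^+ 2 < 1.
Proof. rewrite expr2; have := alpha_gt; have := alpha_lt => h1 h2; apply/andP; nra. Qed.

Lemma kap_ge (n : nat) : alpha ^+ 2 + 1 <= kap alpha n.
Proof. by rewrite lerD2l exprn_ege1 // ler1n. Qed.

Lemma kap_gt1 n : 1 < kap alpha n.
Proof. by have := kap_ge n; have /andP[] := alpha2_bounds; lra. Qed.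

Lemma coef_den_gt0 n : 0 < coef_den alpha n.
Proof.
rewrite mulr_gt0 ?divr_gt0 ?alpha_gt0 // subr_gt0 invf_lt1 ?kap_gt1 //.
by apply: lt_trans (kap_gt1 n).
Qed.

Lemma coef_den_le n : coef_den alpha n <= alpha / 4.
Proof.
rewrite ler_piMr ?divr_ge0 ?(ltW alpha_gt0) // lerBlDr lerDl invr_ge0.
by have := kap_gt1 n; lra.
Qed.

Lemma right_coef_ge (nu lam : R) n : 0 <= nu -> 0 <= lam ->
  (lam + nu) / (alpha / 4) <= right_coef alpha nu lam n.
Proof.
move=> nu0 lam0; rewrite right_coefE ler_pM ?invr_ge0 ?divr_ge0 ?(ltW alpha_gt0) //.
- by rewrite addr_ge0.
- by rewrite lerD2l ler_peMr // ltW // kap_gt1.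
by rewrite lef_pV2 ?posrE ?coef_den_le ?coef_den_gt0 // divr_gt0 ?alpha_gt0.
Qed.

Lemma right_coef_delta (nu lam nu' lam' : R) :
  0 <= nu -> 0 <= lam -> 0 < lam + nu ->
  0 <= nu' -> 0 <= lam' -> 0 < lam' + nu' ->
  exists2 delta, 0 < delta & (forall n, delta <= right_coef alpha nu lam n) /\
    (forall n, delta <= right_coef alpha nu' lam' n).
Proof.
move=> n0 l0 s0 n0' l0' s0'; have a0 := alpha_gt0.
exists (Num.min ((lam + nu) / (alpha / 4)) ((lam' + nu') / (alpha / 4))).
  by rewrite lt_min !divr_gt0.
by split=> n; rewrite ge_min right_coef_ge ?orbT.
Qed.

Lemma shear_sum_gt0 (nu lam : R) : 0 <= nu -> 0 <= lam -> 0 < lam + nu ->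
  0 < lam + nu * alpha ^+ 2.
Proof.
move=> n0 l0 s0; have /andP[a2 _] := alpha2_bounds.
have := mulr_ge0 n0 (ltW (lt_trans _ a2)); nra.
Qed.

Lemma dispersion_exists (nu lam : R) : 0 <= nu -> 0 <= lam -> 0 < lam + nu ->
  exists F, dispersion alpha nu lam F.
Proof.
move=> n0 l0 s0.
have [delta de0 [dd _]] := right_coef_delta n0 l0 s0 n0 l0 s0.
exact: cf_ratio_exists de0 dd.
Qed.

(** The even entries are products of two increasing factors; the odd ones contain (lam + nu kap) /
    (lam + nu alpha^2), which decreases in [lam] because kap > alpha^2. *)
Lemma dispersion_lam_lt (nu lam1 lam2 F1 F2 : R) :
  0 <= nu -> 0 <= lam1 -> 0 < lam1 + nu -> lam1 < lam2 ->
  dispersion alpha nu lam1 F1 -> dispersion alpha nu lam2 F2 -> F1 < F2.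
Proof.
move=> n0 l1 s1 l12 D1 D2.
have l2 : 0 <= lam2 by rewrite (le_trans l1) // ltW.
have s2 : 0 < lam2 + nu by rewrite (lt_trans s1) // ltrD2r.
have [delta de0 [d1 d2]] := right_coef_delta n0 l1 s1 n0 l2 s2.
have u1 := shear_sum_gt0 n0 l1 s1; have u2 := shear_sum_gt0 n0 l2 s2.
have even n : (lam1 + nu * alpha ^+ 2) * right_coef alpha nu lam1 n <
    (lam2 + nu * alpha ^+ 2) * right_coef alpha nu lam2 n.
  have k0 : 0 <= kap alpha n by have := kap_gt1 n; lra.
  rewrite !right_coefE [ltLHS]mulrA [ltRHS]mulrA ltr_pM2r ?invr_gt0 ?coef_den_gt0 //.
  by rewrite ltr_pM ?ltrD2r ?(ltW u1) // addr_ge0 // mulr_ge0.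
apply: (cf_ratio_lt de0 d1 d2 u1 u2 D1 D2 (even 0%N)) => k; first exact: ltW.
set n := k.*2.+1; have k1 := kap_ge n; rewrite !right_coefE.
rewrite !(mulrAC _ (coef_den _ _)^-1) ler_pM2r ?invr_gt0 ?coef_den_gt0 //.
rewrite ler_pdivrMr // mulrAC ler_pdivlMr //.
have : 0 <= nu * (kap alpha n - alpha ^+ 2) * (lam2 - lam1).
  by rewrite !mulr_ge0 //; lra.
nra.
Qed.

(** With x <= y the two scales and m = nu (n+1)^2, an even entry x (x + m) becomes y (y + m), at
    most (y/x)^2 times as large, and (x + m) / x is at most (y/x)^2 (y + m) / y. This growth bound
    supplies the continuity for the intermediate value theorem. *)
Lemma dispersion_lam_lip (nu lam1 lam2 F1 F2 : R) :
  0 <= nu -> 0 <= lam1 -> 0 < lam1 + nu -> lam1 <= lam2 ->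
  dispersion alpha nu lam1 F1 -> dispersion alpha nu lam2 F2 ->
  F2 <= ((lam2 + nu * alpha ^+ 2) / (lam1 + nu * alpha ^+ 2)) ^+ 2 * F1.
Proof.
move=> n0 l1 s1 l12 D1 D2.
have l2 : 0 <= lam2 by rewrite (le_trans l1).
have s2 : 0 < lam2 + nu by rewrite (lt_le_trans s1) // lerD2r.
have [delta de0 [d1 d2]] := right_coef_delta n0 l1 s1 n0 l2 s2.
have u1 := shear_sum_gt0 n0 l1 s1; have u2 := shear_sum_gt0 n0 l2 s2.
set x := lam1 + _ in u1 *; set y := lam2 + _ in u2 *.
have xy : x <= y by rewrite lerD2r.
have t0 : 0 < (y / x) ^+ 2 by rewrite exprn_gt0 // divr_gt0.
have kE n lam : lam + nu * kap alpha n = lam + nu * alpha ^+ 2 + nu * n.+1%:R ^+ 2.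
  by rewrite mulrDr addrA.
apply: (cf_ratio_le de0 d1 d2 u1 u2 t0 D1 D2) => k.
  rewrite !right_coefE !mulrA ler_pM2r ?invr_gt0 ?coef_den_gt0 // !kE -/x -/y.
  set m := nu * _; have m0 : 0 <= m by rewrite mulr_ge0 ?sqr_ge0.
  have -> : (y / x) ^+ 2 * x * (x + m) = y * (y + y / x * m).
    by field; rewrite gt_eqF.
  by rewrite ler_pM2l // lerD2l ler_peMl // ler_pdivlMr // mul1r.
rewrite !right_coefE mulrA !(mulrAC _ (coef_den _ _)^-1) mulrA.
rewrite !(mulrAC _ (coef_den _ _)^-1).
rewrite ler_pM2r ?invr_gt0 ?coef_den_gt0 // !kE -/x -/y.
set m := nu * _; have m0 : 0 <= m by rewrite mulr_ge0 ?sqr_ge0.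
have -> : (y / x) ^+ 2 * (y + m) / y = (x + m) / x + ((y ^+ 2 - x ^+ 2) + m * (y - x)) / x ^+ 2.
  by field; rewrite !gt_eqF.
rewrite lerDl divr_ge0 ?sqr_ge0 // addr_ge0 ?mulr_ge0 ?subr_ge0 //.
by rewrite ler_pXn2r // nnegrE ltW.
Qed.

(** Since lam + nu x = nu (lam / nu + x), the even entries carry nu^2, while the odd ones depend on
    lam / nu alone and decrease in it. So [F] increases with [nu] as long as lam / nu does not drop,
    the form that serves both the threshold and the slope of the branch. *)
Lemma dispersion_nu_lt (nu1 nu2 lam1 lam2 F1 F2 : R) :
  0 < nu1 -> nu1 < nu2 -> 0 <= lam1 -> 0 <= lam2 -> lam1 / nu1 <= lam2 / nu2 ->
  dispersion alpha nu1 lam1 F1 -> dispersion alpha nu2 lam2 F2 -> F1 < F2.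
Proof.
move=> n1 n12 l1 l2 lam12 D1 D2.
have n2 : 0 < nu2 := lt_trans n1 n12.
have s1 : 0 < lam1 + nu1 by rewrite ltr_wpDl.
have s2 : 0 < lam2 + nu2 by rewrite ltr_wpDl.
have [delta de0 [d1 d2]] := right_coef_delta (ltW n1) l1 s1 (ltW n2) l2 s2.
have u1 := shear_sum_gt0 (ltW n1) l1 s1; have u2 := shear_sum_gt0 (ltW n2) l2 s2.
set m1 := lam1 / nu1 in lam12; set m2 := lam2 / nu2 in lam12.
have m10 : 0 <= m1 by rewrite divr_ge0 // ltW.
have e1 x : lam1 + nu1 * x = nu1 * (m1 + x).
  by rewrite /m1; field; rewrite gt_eqF.
have e2 x : lam2 + nu2 * x = nu2 * (m2 + x).
  by rewrite /m2; field; rewrite gt_eqF.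
have a2 : 0 < alpha ^+ 2 by have /andP[] := alpha2_bounds; lra.
have even n : (lam1 + nu1 * alpha ^+ 2) * right_coef alpha nu1 lam1 n <
    (lam2 + nu2 * alpha ^+ 2) * right_coef alpha nu2 lam2 n.
  have k1 := kap_gt1 n.
  rewrite !right_coefE [ltLHS]mulrA [ltRHS]mulrA ltr_pM2r ?invr_gt0 ?coef_den_gt0 //.
  rewrite !e1 !e2; have pos x : 0 < x -> nu1 * (m1 + x) < nu2 * (m2 + x).
    move=> x0; rewrite (@lt_le_trans _ _ (nu2 * (m1 + x))) //.
      by rewrite ltr_pM2r // ltr_wpDl.
    by rewrite ler_pM2l // lerD2r.
  have k0 : 0 < kap alpha n by lra.
  have ge0 x : 0 < x -> 0 <= nu1 * (m1 + x).
    by move=> x0; rewrite mulr_ge0 ?(ltW n1) // addr_ge0 // ltW.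
  by rewrite ltr_pM ?ge0 ?pos.
apply: (cf_ratio_lt de0 d1 d2 u1 u2 D1 D2 (even 0%N)) => k; first exact: ltW.
set n := k.*2.+1; have k1 := kap_ge n; rewrite !right_coefE.
rewrite !(mulrAC _ (coef_den _ _)^-1) ler_pM2r ?invr_gt0 ?coef_den_gt0 //.
rewrite !e1 !e2 -!mulf_div !divff ?gt_eqF // !mul1r.
rewrite ler_pdivrMr; last by rewrite ltr_wpDl // (le_trans m10).
rewrite mulrAC ler_pdivlMr; last by rewrite ltr_wpDl.
have : 0 <= (kap alpha n - alpha ^+ 2) * (m2 - m1) by rewrite mulr_ge0 //; lra.
nra.
Qed.

(** At lam = 0 the even entries scale exactly by (nu2 / nu1)^2 and the odd ones do not depend on the
    viscosity. *)
Lemma dispersion_nu_lip (nu1 nu2 F1 F2 : R) : 0 < nu1 -> nu1 <= nu2 ->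
  dispersion alpha nu1 0 F1 -> dispersion alpha nu2 0 F2 ->
  F2 <= (nu2 / nu1) ^+ 2 * F1.
Proof.
move=> n1 n12 D1 D2.
have n2 : 0 < nu2 := lt_le_trans n1 n12.
have s1 : 0 < 0 + nu1 by rewrite add0r.
have s2 : 0 < 0 + nu2 by rewrite add0r.
have [delta de0 [d1 d2]] := right_coef_delta (ltW n1) (lexx 0) s1 (ltW n2) (lexx 0) s2.
have u1 := shear_sum_gt0 (ltW n1) (lexx 0) s1.
have u2 := shear_sum_gt0 (ltW n2) (lexx 0) s2.
have t0 : 0 < (nu2 / nu1) ^+ 2 by rewrite exprn_gt0 // divr_gt0.
have a0 := alpha_gt0.
apply: (cf_ratio_le de0 d1 d2 u1 u2 t0 D1 D2) => k; rewrite !right_coefE !add0r.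
  rewrite le_eqVlt; apply/orP; left; apply/eqP; field.
  by rewrite !gt_eqF ?coef_den_gt0.
have t1 : 1 <= (nu2 / nu1) ^+ 2 by rewrite exprn_ege1 // ler_pdivlMr // mul1r.
have k1 := kap_gt1 k.*2.+1; have q0 := coef_den_gt0 k.*2.+1.
have E nu : 0 < nu -> nu * kap alpha k.*2.+1 / coef_den alpha k.*2.+1 / (nu * alpha ^+ 2) =
    kap alpha k.*2.+1 / coef_den alpha k.*2.+1 / alpha ^+ 2.
  by move=> nu0; field; rewrite !gt_eqF.
rewrite !E // ler_peMl // !divr_ge0 ?sqr_ge0 ?(ltW q0) //; lra.
Qed.

(** * Explicit bounds from the first two convergents *)

Lemma coef_den0 : coef_den alpha 0 = alpha ^+ 3 / (4 * (alpha ^+ 2 + 1)).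
Proof.
have /andP[a2 _] := alpha2_bounds.
by rewrite /coef_den /kap expr1n; field; rewrite gt_eqF //; lra.
Qed.

Lemma coef_den1 :
  coef_den alpha 1 = alpha * (alpha ^+ 2 + 3) / (4 * (alpha ^+ 2 + 4)).
Proof.
have /andP[a2 _] := alpha2_bounds.
have k4 : kap alpha 1 = alpha ^+ 2 + 4 by rewrite /kap; congr (_ + _); ring.
by rewrite /coef_den k4; field; rewrite gt_eqF //; lra.
Qed.

Lemma kap0 : kap alpha 0 = alpha ^+ 2 + 1. Proof. by rewrite /kap expr1n. Qed.

Lemma kap1 : kap alpha 1 = alpha ^+ 2 + 4.
Proof. by rewrite /kap; congr (_ + _); ring. Qed.

Lemma dispersion_bounds (nu lam F : R) : 0 <= nu -> 0 <= lam -> 0 < lam + nu ->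
  dispersion alpha nu lam F ->
  (lam + nu * alpha ^+ 2) * (lam + nu * (alpha ^+ 2 + 1)) < F * coef_den alpha 0 /\
  F * coef_den alpha 0 <
    (lam + nu * alpha ^+ 2) * (lam + nu * (alpha ^+ 2 + 1)) +
    (lam + nu * alpha ^+ 2) / (lam + nu * (alpha ^+ 2 + 4)) *
      (coef_den alpha 0 * coef_den alpha 1).
Proof.
move=> n0 l0 s0 D.
have [delta de0 [dd _]] := right_coef_delta n0 l0 s0 n0 l0 s0.
have d0 n : 0 < right_coef alpha nu lam n by exact: lt_le_trans (dd n).
have u0 := shear_sum_gt0 n0 l0 s0.
have q0 := coef_den_gt0 0; have q1 := coef_den_gt0 1.
have [] := cf_ratio_bounds d0 u0 D.
have p1 : 0 < lam + nu * kap alpha 1.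
  by have := d0 1%N; rewrite right_coefE pmulr_lgt0 // invr_gt0.
rewrite !right_coefE -kap0 -kap1 mulrA ltr_pdivrMr // => h1 h2; split=> //.
rewrite -(ltr_pM2r q0) in h2; apply: lt_le_trans h2 _.
rewrite le_eqVlt; apply/orP; left; apply/eqP; field.
by rewrite !gt_eqF.
Qed.

Lemma neutral_upper : neutral_level alpha * coef_den alpha 0 = lam_upper_radicand alpha.
Proof.
have /andP[a2 _] := alpha2_bounds; have a0 := alpha_gt0.
rewrite /neutral_level coef_den0 /lam_upper_radicand; field.
by rewrite !gt_eqF //; lra.
Qed.

Lemma neutral_lower : neutral_level alpha * coef_den alpha 0 -
  coef_den alpha 0 * coef_den alpha 1 = lam_lower_radicand alpha.
Proof.
have /andP[a2 _] := alpha2_bounds; have a0 := alpha_gt0.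
rewrite /neutral_level coef_den0 coef_den1 /lam_lower_radicand; field.
by rewrite !gt_eqF //; lra.
Qed.

(** The quotient (lam + nu alpha^2) / (lam + nu (alpha^2 + 4)) in the second convergent is bounded
    by 1, its value at nu = 0. *)
Lemma dispersion_radicands (nu lam : R) : 0 <= nu -> 0 <= lam -> 0 < lam + nu ->
  dispersion alpha nu lam (neutral_level alpha) ->
  lam_lower_radicand alpha <
    (lam + nu * alpha ^+ 2) * (lam + nu * (alpha ^+ 2 + 1)) < lam_upper_radicand alpha.
Proof.
move=> n0 l0 s0 D; have [h1 h2] := dispersion_bounds n0 l0 s0 D.
rewrite -neutral_upper h1 andbT -neutral_lower ltrBlDr (lt_le_trans h2) // lerD2l.
have q0 := coef_den_gt0 0; have q1 := coef_den_gt0 1.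
have u0 := shear_sum_gt0 n0 l0 s0.
have uv : lam + nu * alpha ^+ 2 <= lam + nu * (alpha ^+ 2 + 4).
  by rewrite lerD2l ler_wpM2l // lerDl.
rewrite ler_piMl ?(ltW (mulr_gt0 q0 q1)) //.
by rewrite ler_pdivrMr ?mul1r // (lt_le_trans u0).
Qed.

Lemma dispersion_unique (nu lam1 lam2 F : R) :
  0 <= nu -> 0 <= lam1 -> 0 < lam1 + nu -> 0 <= lam2 -> 0 < lam2 + nu ->
  dispersion alpha nu lam1 F -> dispersion alpha nu lam2 F -> lam1 = lam2.
Proof.
move=> n0 l1 s1 l2 s2 D1 D2; have [h|h|//] := ltgtP lam1 lam2.
  by have := dispersion_lam_lt n0 l1 s1 h D1 D2; rewrite ltxx.
by have := dispersion_lam_lt n0 l2 s2 h D2 D1; rewrite ltxx.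
Qed.

Lemma dispersion_slope (nu1 nu2 lam1 lam2 F : R) :
  0 < nu1 -> nu1 < nu2 -> 0 <= lam1 -> 0 <= lam2 ->
  dispersion alpha nu1 lam1 F -> dispersion alpha nu2 lam2 F ->
  lam2 / nu2 < lam1 / nu1.
Proof.
move=> n1 n12 l1 l2 D1 D2; rewrite ltNge; apply/negP => h.
by have := dispersion_nu_lt n1 n12 l1 l2 h D1 D2; rewrite ltxx.
Qed.

Lemma nu_lower_radicand_gt0 : alpha < 95 / 100 -> 0 < nu_lower_radicand alpha.
Proof.
move=> a95; have a0 := alpha_gt0; have /andP[x0 _] := alpha2_bounds.
rewrite /nu_lower_radicand (exprM alpha 2 3) (exprM alpha 2 2).
(* 361/400 is the square of 95/100; the radicand is a decreasing cubic in alpha^2, still positive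
   there. *)
have : alpha ^+ 2 <= 361 / 400 by rewrite expr2; nra.
move: x0; set x := alpha ^+ 2; clearbody x => x0 x1.
have h2 : 0 <= x * (361 / 400 - x) by apply: mulr_ge0; lra.
have h3 : 0 <= x * x * (361 / 400 - x) by apply: mulr_ge0; [apply: mulr_ge0|]; lra.
rewrite !exprS expr0; lra.
Qed.

Lemma lam_upper_radicand_bounds : 0 < lam_upper_radicand alpha < 1.
Proof.
have /andP[] := alpha2_bounds; rewrite /lam_upper_radicand.
set x := alpha ^+ 2; clearbody x => h1 h2; apply/andP; split.
  by rewrite divr_gt0 // ?mulr_gt0 //; lra.
rewrite ltr_pdivrMr; last lra.
nra.
Qed.

Lemma lam_lower_radicand_gt0 : alpha < 8469 / 10000 -> 0 < lam_lower_radicand alpha.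
Proof.
move=> a84; have a0 := alpha_gt0; have /andP[x0 _] := alpha2_bounds.
(* Fractions with small denominators: 83/98 lies just above 8469/10000, and 203/283 just above its
   square but below the positive root (sqrt 177 - 9) / 6 of 8 - 9 x - 3 x^2. *)
have {}a84 : alpha < 83 / 98 by apply: lt_trans a84 _; lra.
have : alpha ^+ 2 <= 203 / 283.
  have h1 : 0 <= alpha * (83 / 98 - alpha) by apply: mulr_ge0; lra.
  by rewrite expr2; lra.
clear a84.
rewrite /lam_lower_radicand (exprM alpha 2 2).
move: x0; set x := alpha ^+ 2; clearbody x => x0 x1.
have -> : x * (1 - x) / (8 * (x + 1)) - x ^+ 2 * (x + 3) / (16 * (x + 1) * (x + 4)) =
    x * (8 - 9 * x - 3 * x ^+ 2) / (16 * (x + 1) * (x + 4)).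
  by field; rewrite !gt_eqF //; lra.
have h2 : 0 <= x * (203 / 283 - x) by apply: mulr_ge0; lra.
have p0 : 0 < 8 - 9 * x - 3 * x ^+ 2 by rewrite expr2; lra.
have p1 : 0 < x + 1 by lra.
have p4 : 0 < x + 4 by lra.
by apply: divr_gt0; rewrite ?mulr_gt0 //; lra.
Qed.

(** [nu_upper] is the viscosity at which the first convergent, a lower bound of [F], reaches the
    neutral level for lam = 0. *)
Lemma nu_upper_sqr : 0 < nu_upper alpha /\
  nu_upper alpha * alpha ^+ 2 * (nu_upper alpha * (alpha ^+ 2 + 1)) =
  neutral_level alpha * coef_den alpha 0.
Proof.
have /andP[h1 h2] := alpha2_bounds; have a0 := alpha_gt0.
have r0 : 0 < (1 - alpha ^+ 2) / 2 by lra.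
split; first by rewrite /nu_upper mulr_gt0 ?sqrtr_gt0 // divr_gt0 //; lra.
rewrite neutral_upper /nu_upper /lam_upper_radicand.
set s := Num.sqrt _; have s2 : s ^+ 2 = (1 - alpha ^+ 2) / 2 by rewrite sqr_sqrtr // ltW.
transitivity (s ^+ 2 * (alpha ^+ 2 / (4 * (alpha ^+ 2 + 1)))).
  by field; rewrite gt_eqF //; lra.
by rewrite s2; field; rewrite gt_eqF //; lra.
Qed.

(** [nu_lower] is the viscosity at which the second convergent, an upper bound of [F], equals the
    neutral level for lam = 0. *)
Lemma nu_lower_sqr : alpha < 95 / 100 -> 0 < nu_lower alpha /\
  nu_lower alpha * alpha ^+ 2 * (nu_lower alpha * (alpha ^+ 2 + 1)) +
  alpha ^+ 2 / (alpha ^+ 2 + 4) * (coef_den alpha 0 * coef_den alpha 1) =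
  neutral_level alpha * coef_den alpha 0.
Proof.
move=> a95; have /andP[h1 h2] := alpha2_bounds; have a0 := alpha_gt0.
have r0 := nu_lower_radicand_gt0 a95.
split; first by rewrite /nu_lower divr_gt0 ?sqrtr_gt0 // !mulr_gt0 //; lra.
rewrite neutral_upper /nu_lower /lam_upper_radicand coef_den0 coef_den1.
set s := Num.sqrt _; have s2 : s ^+ 2 = nu_lower_radicand alpha.
  by rewrite sqr_sqrtr // ltW.
rewrite (_ : s / _ * _ * _ = s ^+ 2 * (alpha ^+ 2 / (16 * (alpha ^+ 2 + 1) * (alpha ^+ 2 + 4) ^+ 2))).
  by rewrite s2 /nu_lower_radicand; field; rewrite !gt_eqF //; lra.
by field; rewrite !gt_eqF //; lra.
Qed.

Lemma nu_lower_lt_upper : alpha < 95 / 100 -> nu_lower alpha < nu_upper alpha.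
Proof.
move=> a95; have [l0 lE] := nu_lower_sqr a95; have [u0 uE] := nu_upper_sqr.
have /andP[h1 h2] := alpha2_bounds.
have q0 := coef_den_gt0 0; have q1 := coef_den_gt0 1.
have : 0 < alpha ^+ 2 / (alpha ^+ 2 + 4) * (coef_den alpha 0 * coef_den alpha 1).
  by rewrite mulr_gt0 ?(mulr_gt0 q0 q1) // divr_gt0 //; lra.
move: lE; rewrite -uE => lE p.
rewrite -(ltr_pXn2r (n := 2)) ?nnegrE ?ltW //.
have A : 0 < alpha ^+ 2 * (alpha ^+ 2 + 1) by rewrite mulr_gt0 //; lra.
by rewrite -(ltr_pM2r A); lra.
Qed.

(** At lam = 0, [F] lies below the neutral level for [nu_lower] and above it for [nu_upper]; the
    threshold is the crossing in between. *)
Lemma critical_nu_exists : alpha < 95 / 100 -> exists nus,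
  [/\ nu_lower alpha < nus, nus < nu_upper alpha
    & dispersion alpha nus 0 (neutral_level alpha)].
Proof.
move=> a95; have [l0 lE] := nu_lower_sqr a95; have [u0 uE] := nu_upper_sqr.
have [G GP] : exists G : R -> R, forall nu, 0 < nu -> dispersion alpha nu 0 (G nu).
  suff [G GP] : {G : R -> R & forall nu, 0 < nu -> dispersion alpha nu 0 (G nu)} by exists G.
  apply: (@choice _ _ (fun nu F => 0 < nu -> dispersion alpha nu 0 F)) => nu.
  have [nu0|nu0] := ltP 0 nu; last by exists 0.
  have [|F DF] := @dispersion_exists nu 0 (ltW nu0) (lexx 0); first by rewrite add0r.
  by exists F.
have q0 := coef_den_gt0 0; have q1 := coef_den_gt0 1.
have /andP[h1 h2] := alpha2_bounds.
have bnd nu : 0 < nu -> nu * alpha ^+ 2 * (nu * (alpha ^+ 2 + 1)) < G nu * coef_den alpha 0 /\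
    G nu * coef_den alpha 0 < nu * alpha ^+ 2 * (nu * (alpha ^+ 2 + 1)) +
      alpha ^+ 2 / (alpha ^+ 2 + 4) * (coef_den alpha 0 * coef_den alpha 1).
  move=> nu0; have s0 : 0 < 0 + nu by rewrite add0r.
  have := dispersion_bounds (ltW nu0) (lexx 0) s0 (GP nu nu0).
  by rewrite !add0r -mulf_div divff ?gt_eqF // mul1r.
have [||||||x [lx xu Gx]] := @square_lipschitz_IVT R G (nu_lower alpha) (nu_upper alpha)
    (neutral_level alpha) l0.
- exact: ltW (nu_lower_lt_upper a95).
- move=> x y ax; rewrite le_eqVlt => /predU1P[->//|xy] yb.
  have x0 : 0 < x by exact: lt_le_trans ax.
  apply/ltW/(dispersion_nu_lt x0 xy (lexx 0) (lexx 0)); first by rewrite !mul0r.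
    exact: GP.
  by apply: GP; exact: lt_trans xy.
- move=> x y ax xy yb; have x0 : 0 < x by exact: lt_le_trans ax.
  by apply: dispersion_nu_lip => //; apply: GP => //; exact: lt_le_trans xy.
- have [h _] := bnd _ l0; rewrite -(pmulr_lgt0 _ q0); apply: lt_trans h.
  have a2 : 0 < alpha ^+ 2 by lra.
  have a21 : 0 < alpha ^+ 2 + 1 by lra.
  exact: mulr_gt0 (mulr_gt0 l0 a2) (mulr_gt0 l0 a21).
- by rewrite -(ltr_pM2r q0) -lE; case: (bnd _ l0).
- by rewrite -(ltr_pM2r q0) -uE; case: (bnd _ u0).
exists x; split=> //; rewrite -Gx; apply: GP; exact: lt_trans lx.
Qed.

Lemma dispersion_root (nu a b : R) : 0 <= nu -> 0 <= a -> a <= b -> 0 < a + nu ->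
  (forall F, dispersion alpha nu a F -> F < neutral_level alpha) ->
  (forall F, dispersion alpha nu b F -> neutral_level alpha < F) ->
  exists lam, [/\ a < lam, lam < b & dispersion alpha nu lam (neutral_level alpha)].
Proof.
move=> n0 a0 ab s0 ha hb.
(* The growth bound is quadratic in lam + nu alpha^2, so this sum is the variable of the
   intermediate value theorem. The shift also makes the left end positive when [a] is 0 and [nu] is
   not. *)
set c := nu * alpha ^+ 2.
have [G GP] : exists G : R -> R, forall lam, a <= lam -> dispersion alpha nu lam (G (lam + c)).
  suff [G GP] : {G : R -> R & forall x, a + c <= x -> dispersion alpha nu (x - c) (G x)}.
    by exists G => lam al; rewrite -[X in dispersion _ _ X](addrK c); apply: GP; rewrite lerD2r.
  apply: (@choice _ _ (fun x F => a + c <= x -> dispersion alpha nu (x - c) F)) => x.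
  have [ax|ax] := leP (a + c) x; last by exists 0.
  have ax' : a <= x - c by rewrite lerBrDr.
  have [||F DF] := @dispersion_exists nu (x - c) n0; last by exists F.
    exact: le_trans ax'.
  by rewrite (lt_le_trans s0) // lerD2r.
have ac0 : 0 < a + c by exact: shear_sum_gt0.
have GP' x : a + c <= x -> dispersion alpha nu (x - c) (G x).
  by move=> ax; have := GP (x - c); rewrite subrK lerBrDr; apply.
have [||||||x [lx xu Gx]] := @square_lipschitz_IVT R G (a + c) (b + c)
    (neutral_level alpha) ac0.
- by rewrite lerD2r.
- move=> x y ax; rewrite le_eqVlt => /predU1P[->//|xy] yb.
  have ax' : a <= x - c by rewrite lerBrDr.
  apply/ltW/(@dispersion_lam_lt nu (x - c) (y - c)) => //.
  + exact: le_trans ax'.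
  + by rewrite (lt_le_trans s0) // lerD2r.
  + by rewrite ltrD2r.
  + exact: GP'.
  + by apply: GP'; rewrite (le_trans ax) // ltW.
- move=> x y ax xy yb; have ax' : a <= x - c by rewrite lerBrDr.
  have := @dispersion_lam_lip nu (x - c) (y - c) (G x) (G y); rewrite -/c !subrK; apply => //.
  + exact: le_trans ax'.
  + by rewrite (lt_le_trans s0) // lerD2r.
  + by rewrite lerD2r.
  + exact: GP'.
  + by apply: GP'; rewrite (le_trans ax).
- have [h _] := dispersion_bounds n0 a0 s0 (GP a (lexx a)).
  rewrite -(pmulr_lgt0 _ (coef_den_gt0 0)); apply: le_lt_trans h.
  by rewrite mulr_ge0 // ?(ltW ac0) // addr_ge0 // mulr_ge0 // addr_ge0 ?sqr_ge0.
- by apply: ha; apply: GP.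
- by apply: hb; apply: GP.
exists (x - c); split; rewrite ?ltrBrDr ?ltrBlDr //.
by rewrite -Gx; apply: GP'; exact: ltW.
Qed.

(** At lam = 0, monotonicity in [nu] puts [F] below its value at [nus], the neutral level. At lam =
    1 the first convergent is already above, because [lam_upper_radicand] is smaller than 1. *)
Lemma unstable_root_exists (nu nus : R) : 0 < nu -> nu < nus ->
  dispersion alpha nus 0 (neutral_level alpha) ->
  exists2 lam, 0 < lam & dispersion alpha nu lam (neutral_level alpha).
Proof.
move=> n0 nn Ds; have s0 : 0 < 0 + nu by rewrite add0r.
have [|||lam [l0 _ D]] := @dispersion_root nu 0 1 (ltW n0) (lexx 0) _ s0; last by exists lam.
- lra.
- by move=> F DF; apply: dispersion_nu_lt DF Ds => //; rewrite !mul0r.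
move=> F DF; have s1 : 0 < 1 + nu by lra.
have [h _] := dispersion_bounds (ltW n0) ler01 s1 DF.
rewrite -(ltr_pM2r (coef_den_gt0 0)) neutral_upper; apply: lt_trans h.
have /andP[_ lu] := lam_upper_radicand_bounds.
rewrite (lt_le_trans lu) // -[leLHS]mulr1 ler_pM // lerDl mulr_ge0 ?(ltW n0) //.
  exact: sqr_ge0.
by rewrite addr_ge0 ?sqr_ge0.
Qed.

(** For nu = 0 the two bounds of [dispersion_bounds] are lam^2 and lam^2 plus a constant, so the
    square roots of the two radicands bracket the root. *)
Lemma inviscid_root_exists : alpha < 8469 / 10000 ->
  exists lam0, [/\ Num.sqrt (lam_lower_radicand alpha) < lam0,
    lam0 < Num.sqrt (lam_upper_radicand alpha)
    & dispersion alpha 0 lam0 (neutral_level alpha)].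
Proof.
move=> a84; have low0 := lam_lower_radicand_gt0 a84.
have q0 := coef_den_gt0 0; have q1 := coef_den_gt0 1.
have /andP[up0 _] := lam_upper_radicand_bounds.
have lu : lam_lower_radicand alpha <= lam_upper_radicand alpha.
  by rewrite -neutral_lower -neutral_upper gerBl mulr_ge0 // ltW.
apply: dispersion_root; rewrite ?addr0 ?sqrtr_ge0 ?sqrtr_gt0 ?ler_wsqrtr //.
- move=> F DF; have [|||_] := dispersion_bounds _ _ _ DF; rewrite ?addr0 ?sqrtr_gt0 ?sqrtr_ge0 //.
  rewrite !mul0r !addr0 divff ?gt_eqF ?sqrtr_gt0 // mul1r -expr2 sqr_sqrtr ?ltW //.
  by rewrite -neutral_lower subrK ltr_pM2r.
move=> F DF; have [|||h _] := dispersion_bounds _ _ _ DF; rewrite ?addr0 ?sqrtr_gt0 ?sqrtr_ge0 //.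
move: h; rewrite !mul0r !addr0 -expr2 sqr_sqrtr ?ltW // -neutral_upper ltr_pM2r //.
Qed.

(** With u = lam + nu alpha^2 < v = lam + nu (alpha^2 + 1), the product u v lies between the
    radicands; hence v^2 exceeds the lower one and u^2 stays under the upper one. *)
Lemma dispersion_lam_bounds (nu lam : R) : 0 < nu -> 0 <= lam ->
  dispersion alpha nu lam (neutral_level alpha) ->
  Num.sqrt (lam_lower_radicand alpha) - nu * (alpha ^+ 2 + 1) < lam /\
  lam < Num.sqrt (lam_upper_radicand alpha) - nu * alpha ^+ 2.
Proof.
move=> n0 l0 D; have s0 : 0 < lam + nu by rewrite ltr_wpDl.
have /andP[h1 h2] := dispersion_radicands (ltW n0) l0 s0 D.
have u0 := shear_sum_gt0 (ltW n0) l0 s0.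
have v0 : 0 < lam + nu * (alpha ^+ 2 + 1) by rewrite mulrDr addrA addr_gt0 // mulr1.
have uv : lam + nu * alpha ^+ 2 < lam + nu * (alpha ^+ 2 + 1).
  by rewrite ltrD2l ltr_pM2l // ltrDl.
rewrite ltrBlDr ltrBrDr; split.
  rewrite -[ltRHS]ger0_norm ?(ltW v0) // -sqrtr_sqr ltr_sqrt ?exprn_gt0 //.
  by rewrite (lt_trans h1) // expr2 ltr_pM2r.
rewrite -[ltLHS]ger0_norm ?(ltW u0) // -sqrtr_sqr ltr_sqrt //.
  by rewrite (lt_trans _ h2) // expr2 ltr_pM2l.
by apply: lt_trans h2; rewrite mulr_gt0.
Qed.

(* Compactness: along an ultrafilter, the continued fractions converge to
   a continued fraction, and the inviscid root is unique. *)
Lemma dispersion_limit (lam : R -> R) (lam0 m : R) :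
  0 < lam0 -> dispersion alpha 0 lam0 (neutral_level alpha) -> 0 < m ->
  (\forall nu \near 0^'+, m <= lam nu) ->
  (\forall nu \near 0^'+, dispersion alpha nu (lam nu) (neutral_level alpha)) ->
  lam nu @[nu --> 0^'+] --> lam0.
Proof.
move=> lam00 D0 m0 mlam Dlam.
apply: ultra_cvg => U UU subU; have FU : ProperFilter U := @ultra_proper _ _ UU.
have nu_pos : \forall nu \near U, 0 < nu by apply: subU; exact: nbhs_right_gt.
have nu_cvg : nu @[nu --> U] --> (0 : R).
  by move=> B nB; apply: subU; apply: cvg_within nB.
have {}mlam : \forall nu \near U, m <= lam nu by exact: subU.
have {}Dlam : \forall nu \near U, dispersion alpha nu (lam nu) (neutral_level alpha).
  exact: subU.
have /andP[up0 up1] := lam_upper_radicand_bounds.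
have [l lamU] : exists l : R, lam nu @[nu --> U] --> l.
  apply: (@ultra_bounded_cvg _ _ _ _ 1) => //; near=> nu.
  have nu0 : 0 < nu by near: nu.
  have ml : m <= lam nu by near: nu.
  have l0 : 0 <= lam nu by rewrite (le_trans _ ml) // ltW.
  rewrite ger0_norm //; have [|_ h] := dispersion_lam_bounds nu0 l0; first by near: nu.
  rewrite (le_trans (ltW h)) // lerBlDr (@le_trans _ _ 1) //.
    by rewrite -sqrtr1 ler_wsqrtr // ltW.
  by rewrite lerDl mulr_ge0 ?sqr_ge0 // ltW.
have ml : m <= l by apply: cvg_ge lamU mlam.
have l0 : 0 < l by exact: lt_le_trans ml.
have [s sP] : exists s : R -> nat -> R, \forall nu \near U,
    cf_sol (right_coef alpha nu (lam nu)) (s nu) /\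
    neutral_level alpha * s nu 0%N = lam nu + nu * alpha ^+ 2.
  suff [s sP] : {s : R -> nat -> R & forall nu,
      dispersion alpha nu (lam nu) (neutral_level alpha) ->
      cf_sol (right_coef alpha nu (lam nu)) (s nu) /\
      neutral_level alpha * s nu 0%N = lam nu + nu * alpha ^+ 2}.
    by exists s; near=> nu; apply: sP; near: nu.
  apply: (@choice _ _ (fun nu s => dispersion alpha nu (lam nu) (neutral_level alpha) ->
    cf_sol (right_coef alpha nu (lam nu)) s /\
    neutral_level alpha * s 0%N = lam nu + nu * alpha ^+ 2)) => nu.
  have [[s [h1 h2]]|nD] := pselect (dispersion alpha nu (lam nu) (neutral_level alpha)).
    by exists s.
  by exists (fun=> 0).
(* The lower bound [m] on [lam] keeps the entries away from 0 uniformly as [nu] vanishes, so the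
   continued fractions stay bounded. *)
have bnd n : \forall nu \near U, `|s nu n| <= alpha / 4 / m.
  near=> nu; have nu0 : 0 < nu by near: nu.
  have ml' : m <= lam nu by near: nu.
  have [cs _] : cf_sol (right_coef alpha nu (lam nu)) (s nu) /\
    neutral_level alpha * s nu 0%N = lam nu + nu * alpha ^+ 2 by near: nu.
  have lam_ge0 : 0 <= lam nu by rewrite (le_trans _ ml') // ltW.
  have a0 := alpha_gt0.
  have dge : m / (alpha / 4) <= right_coef alpha nu (lam nu) n.
    rewrite (le_trans _ (right_coef_ge n (ltW nu0) lam_ge0)) //.
    by rewrite ler_pM2r ?invr_gt0 ?divr_gt0 // (le_trans ml') // lerDl ltW.
  have d0 : 0 < right_coef alpha nu (lam nu) n.
    by rewrite (lt_le_trans _ dge) // !divr_gt0.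
  rewrite gtr0_norm ?(cf_gt0 n cs) // (le_trans (ltW (cf_le d0 cs))) //.
  by rewrite -[leRHS]invf_div lef_pV2 // posrE !divr_gt0.
have lims n : exists x : R, s nu n @[nu --> U] --> x.
  exact: ultra_bounded_cvg (bnd n).
have coefU n : right_coef alpha nu (lam nu) n @[nu --> U] --> right_coef alpha 0 l n.
  apply: cvgMl; rewrite mul0r addr0 -[X in _ --> X]addr0 -(mul0r (kap alpha n)).
  by apply: cvgD => //; exact: cvgMl.
suff Dl : dispersion alpha 0 l (neutral_level alpha).
  have := dispersion_unique (lexx 0) (ltW l0) _ (ltW lam00) _ Dl D0.
  by rewrite !addr0 => /(_ l0 lam00) <-.
exists (fun n => projT1 (cid (lims n))); split=> [n|].
  case: (cid (lims n)) => x1 h1; case: (cid (lims n.+1)) => x2 h2 /=; split.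
    apply: (cvg_ge _ h1); near=> nu.
    have [cs _] : cf_sol (right_coef alpha nu (lam nu)) (s nu) /\
      neutral_level alpha * s nu 0%N = lam nu + nu * alpha ^+ 2 by near: nu.
    by have [] := cs n.
  have h3 : s nu n * (right_coef alpha nu (lam nu) n + s nu n.+1) @[nu --> U]
      --> x1 * (right_coef alpha 0 l n + x2).
    by apply: cvgM => //; exact: cvgD.
  apply: cvgR_unique h3 _; apply: cvg_near_cst; near=> nu.
  have [cs _] : cf_sol (right_coef alpha nu (lam nu)) (s nu) /\
    neutral_level alpha * s nu 0%N = lam nu + nu * alpha ^+ 2 by near: nu.
  by have [] := cs n.
case: (cid (lims 0%N)) => x1 h1 /=.
have h3 : neutral_level alpha * s nu 0%N @[nu --> U] --> neutral_level alpha * x1.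
  exact: cvgMr.
have h4 : lam nu + nu * alpha ^+ 2 @[nu --> U] --> l + 0 * alpha ^+ 2.
  by apply: cvgD => //; exact: cvgMl.
apply: cvgR_unique h3 _; apply: cvg_trans h4; apply: near_eq_cvg; near=> nu.
have [_ ->] : cf_sol (right_coef alpha nu (lam nu)) (s nu) /\
  neutral_level alpha * s nu 0%N = lam nu + nu * alpha ^+ 2 by near: nu.
by [].
Unshelve. all: by end_near. Qed.

End Dispersion.

(** * Resolvent estimates *)

(** Componentwise convergence, so that ultrafilter limits are taken among real numbers only. *)
Definition ccvg (R : realType) (T : Type) (U : set_system T) (f : T -> R[i])
    (l : R[i]) : Prop :=
  complex.Re (f t) @[t --> U] --> complex.Re l /\
  complex.Im (f t) @[t --> U] --> complex.Im l.

Lemma ccvg_cst (R : realType) (T : Type) (U : set_system T) (FU : ProperFilter U)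
    (l : R[i]) : ccvg U (fun=> l) l.
Proof. by split; exact: cvg_cst. Qed.

Lemma ccvgB (R : realType) (T : Type) (U : set_system T) (FU : ProperFilter U)
    (f g : T -> R[i]) (l k : R[i]) :
  ccvg U f l -> ccvg U g k -> ccvg U (fun t => f t - g t) (l - k).
Proof.
move=> [f1 f2] [g1 g2]; split; rewrite !ReImE.
  by apply: cvg_ext (cvgB f1 g1) => t; rewrite !ReImE.
by apply: cvg_ext (cvgB f2 g2) => t; rewrite !ReImE.
Qed.

Lemma ccvgM (R : realType) (T : Type) (U : set_system T) (FU : ProperFilter U)
    (f g : T -> R[i]) (l k : R[i]) :
  ccvg U f l -> ccvg U g k -> ccvg U (fun t => f t * g t) (l * k).
Proof.
move=> [f1 f2] [g1 g2]; split; rewrite !ReImE.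
  by apply: cvg_ext (cvgB (cvgM f1 g1) (cvgM f2 g2)) => t; rewrite !ReImE.
by apply: cvg_ext (cvgD (cvgM f1 g2) (cvgM f2 g1)) => t; rewrite !ReImE.
Qed.

Lemma ccvg_near_unique (R : realType) (T : Type) (U : set_system T)
    (FU : ProperFilter U) (f : T -> R[i]) (l k : R[i]) :
  ccvg U f l -> (\forall t \near U, f t = k) -> l = k.
Proof.
move=> [f1 f2] fk; apply: complex_ext.
  by apply: cvgR_unique f1 _; apply: cvg_near_cst; apply: filterS fk => t ->.
by apply: cvgR_unique f2 _; apply: cvg_near_cst; apply: filterS fk => t ->.
Qed.

Lemma ccvg_nsq (R : realType) (T : Type) (U : set_system T) (FU : ProperFilter U)
    (f : T -> R[i]) (l : R[i]) :
  ccvg U f l -> nsq (f t) @[t --> U] --> nsq l.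
Proof.
move=> [f1 f2]; rewrite /nsq !expr2.
apply: cvg_ext (cvgD (cvgM f1 f1) (cvgM f2 f2)) => t.
by rewrite !expr2.
Qed.

Lemma wsum_cvg (R : realType) (T : Type) (U : set_system T) (FU : ProperFilter U)
    (N : nat) (f : T -> int -> R) (l : int -> R) :
  (forall m, f t m @[t --> U] --> l m) -> wsum N (f t) @[t --> U] --> wsum N l.
Proof.
move=> fl; elim: N => [|N IH].
  by rewrite wsum0; apply: cvg_ext (cvg_cst (0 : R)) => t; rewrite wsum0.
rewrite wsumS; apply: cvg_ext (fun t => esym (wsumS N (f t))) _.
by apply: cvgD => //; exact: cvgD.
Qed.

Lemma ultra_ccvg (R : realType) (T : Type) (U : set_system T) (x : T -> int -> R[i])
    (M : int -> R) : UltraFilter U ->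
  (forall m, \forall t \near U, nsq (x t m) <= M m) ->
  exists y : int -> R[i], forall m, ccvg U (fun t => x t m) (y m).
Proof.
move=> UU xM; have FU : ProperFilter U := @ultra_proper _ _ UU.
suff [y yP] : {y : int -> R[i] & forall m, ccvg U (fun t => x t m) (y m)} by exists y.
apply: (@choice _ _ (fun m y => ccvg U (fun t => x t m) y)) => m.
have le_norm (a c : R) : a ^+ 2 <= c -> `|a| <= 1 + c.
  move=> ac; rewrite ler_norml; have := sqr_ge0 (a - 1); have := sqr_ge0 (a + 1).
  by rewrite sqrrB sqrrD expr1n !mulr1 => h1 h2; apply/andP; split; lra.
have [a ha] : exists a : R, complex.Re (x t m) @[t --> U] --> a.
  apply: (@ultra_bounded_cvg _ _ _ _ (1 + M m)) => //.
  apply: filterS (xM m) => t h; apply: le_norm; apply: le_trans h.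
  by rewrite lerDl sqr_ge0.
have [c hc] : exists c : R, complex.Im (x t m) @[t --> U] --> c.
  apply: (@ultra_bounded_cvg _ _ _ _ (1 + M m)) => //.
  apply: filterS (xM m) => t h; apply: le_norm; apply: le_trans h.
  by rewrite lerDr sqr_ge0.
by exists (a +i* c); split.
Qed.

(* b S z - lam r z, with r = 1 / rho and z = rho w: linNS - lam at nu = 0. *)
Definition line_op (R : realType) (b : R) (lam : R[i]) (r : int -> R)
    (z : int -> R[i]) (m : int) : R[i] :=
  b%:C * (z (m - 1) - z (m + 1)) - lam * (r m)%:C * z m.

(** For such weights the commutator with a shift is of relative size [eta], so unweighted energy
    estimates survive in weighted norms. *)
Definition slowly_varying (R : realType) (eta : R) (W : int -> R) : Prop :=
  forall m, [/\ 0 < W m, W (m + 1) <= (1 + eta) * W m & W m <= (1 + eta) * W (m + 1)].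

(** The complement of the imaginary segment of half-length 2 |b|, split according to which part of
    the energy identity gives coercivity. *)
Definition off_band (R : realType) (b : R) (lam : R[i]) : Prop :=
  complex.Re lam != 0 \/ 2 * `|b| < `|complex.Im lam|.

Definition window_supp (R : realType) (N : nat) (z : int -> R[i]) : Prop :=
  forall m, ~~ (- N%:Z <= m < N%:Z) -> z m = 0.

Lemma window_shift_le (R : realType) (N : nat) (W : int -> R) (z : int -> R[i]) :
  window_supp N z -> (forall m, 0 < W m) ->
  wsum N (fun m => W (m + 1) * nsq (z (m + 1))) <= wsum N (fun m => W m * nsq (z m)) /\
  wsum N (fun m => W (m - 1) * nsq (z (m - 1))) <= wsum N (fun m => W m * nsq (z m)).
Proof.
move=> zN W0; split.
  rewrite (wsum_shift N (fun m => W m * nsq (z m))) (zN N%:Z); last by lia.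
  by rewrite nsq0 mulr0 sub0r gerDl oppr_le0 mulr_ge0 ?nsq_ge0 // ltW.
rewrite (wsum_unshift N (fun m => W m * nsq (z m))) (zN (- N%:Z - 1)); last by lia.
by rewrite nsq0 mulr0 sub0r gerDl oppr_le0 mulr_ge0 ?nsq_ge0 // ltW.
Qed.

(** Of the coercive term a S, one quarter pays for the variation of the weight and one quarter for
    the Young inequality; half of it remains. *)
Lemma young_absorb (R : realType) (a be eta S T Q : R) :
  0 < a -> 0 <= S -> be * eta <= a / 4 ->
  a * S <= be * eta * S + Q -> Q <= (a / 2 * S + T / (a / 2)) / 2 ->
  S <= 2 / a ^+ 2 * T.
Proof.
move=> a0 S0 be4 h1 h2.
have h3 : be * eta * S <= a / 4 * S by rewrite ler_wpM2r.
have h4 : a / 2 * S <= T / a.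
  have e : T / (a / 2) = 2 * (T / a) by field; rewrite gt_eqF.
  by move: h2; rewrite e; lra.
have -> : 2 / a ^+ 2 * T = T / a * (2 / a) by field; rewrite gt_eqF.
apply: (@le_trans _ _ (a / 2 * S * (2 / a))); last first.
  by rewrite ler_wpM2r // divr_ge0 // ltW.
by rewrite le_eqVlt; apply/orP; left; apply/eqP; field; rewrite gt_eqF.
Qed.

Lemma young_wsum (R : realType) (N : nat) (W : int -> R) (f z : int -> R[i]) (s : R)
    (q : int -> R) :
  0 < s -> (forall m, 0 < W m) ->
  (forall m, `|q m| <= (s * nsq (z m) + nsq (f m) / s) / 2) ->
  `|wsum N (fun m => W m * q m)| <=
    (s * wsum N (fun m => W m * nsq (z m)) + wsum N (fun m => W m * nsq (f m)) / s) / 2.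
Proof.
move=> s0 W0 qle.
have E : (s * wsum N (fun m => W m * nsq (z m)) + wsum N (fun m => W m * nsq (f m)) / s) / 2 =
    wsum N (fun m => W m * ((s * nsq (z m) + nsq (f m) / s) / 2)).
  rewrite mulrC -wsumZ [wsum N _ / s]mulrC -wsumZ -wsumD -wsumZ; apply: eq_wsum => m _.
  by field; rewrite gt_eqF.
rewrite E ler_norml -wsumN; apply/andP; split; apply: ler_wsum => m _.
  by rewrite -mulrN ler_pM2l //; have := qle m; rewrite ler_norml => /andP[].
by rewrite ler_pM2l //; have := qle m; rewrite ler_norml => /andP[].
Qed.

Lemma young_mulJ (R : realType) (s : R) (x y : R[i]) : 0 < s ->
  `|complex.Re (x * y^*)| <= (s * nsq y + nsq x / s) / 2 /\
  `|complex.Im (x * y^*)| <= (s * nsq y + nsq x / s) / 2.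
Proof.
move=> s0; have r0 : 0 < Num.sqrt s by rewrite sqrtr_gt0.
have r2 : Num.sqrt s ^+ 2 = s by rewrite sqr_sqrtr // ltW.
have xy : x * y^* = ((Num.sqrt s)^-1%:C * x) * ((Num.sqrt s)%:C * y)^*.
  apply: complex_ext; rewrite !ReImE /=; field; rewrite gt_eqF //.
have e : s * nsq y + nsq x / s =
    nsq ((Num.sqrt s)^-1%:C * x) + nsq ((Num.sqrt s)%:C * y).
  by rewrite !nsqM !nsqC exprVn r2 addrC [_^-1 * _]mulrC.
by rewrite xy e; split; [exact: Re_mulJ_le|exact: Im_mulJ_le].
Qed.

(** Pair with the weighted conjugate of [z]. If Re lam is nonzero, the real part leaves only
    differences of weights from the skew shift term. If Re lam = 0, the imaginary part of that term
    is at most about 2 |b|, below |Im lam|. The condition [1 <= r m] keeps the [lam] term coercive,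
    and the constants depend on [b] and [lam] alone. *)
Lemma line_op_estimate (R : realType) (b : R) (lam : R[i]) : off_band b lam ->
  exists eta K, [/\ 0 < eta, 0 < K & forall W r N z,
    slowly_varying eta W -> (forall m, 1 <= r m) -> window_supp N z ->
    wsum N (fun m => W m * nsq (z m)) <=
      K * wsum N (fun m => W m * nsq (line_op b lam r z m))].
Proof.
move=> off.
pose a := if complex.Re lam != 0 then `|complex.Re lam| else `|complex.Im lam| - 2 * `|b|.
have a0 : 0 < a.
  rewrite /a; case: ifPn => [|/negPn/eqP re0]; first by rewrite normr_gt0.
  by case: off; rewrite ?re0 ?eqxx // subr_gt0.
(* Chosen so that |b| eta <= a / 4, as [young_absorb] requires; the added 1 covers b = 0. *)
pose eta := a / (4 * (1 + `|b|)).
have b1 : 0 < 1 + `|b| by rewrite ltr_pwDl.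
have eta0 : 0 < eta by rewrite divr_gt0 // mulr_gt0.
have beta : `|b| * eta <= a / 4.
  have -> : a / 4 = (1 + `|b|) * eta by rewrite /eta; field; rewrite gt_eqF.
  by rewrite ler_pM2r // lerDr.
exists eta, (2 / a ^+ 2); split=> // [|W r N z SV r1 zN].
  by rewrite divr_gt0 // exprn_gt0.
have W0 m : 0 < W m by have [] := SV m.
have Wz0 m : 0 <= W m * nsq (z m) by rewrite mulr_ge0 ?nsq_ge0 // ltW.
have S0 : 0 <= wsum N (fun m => W m * nsq (z m)) by exact: wsum_ge0.
have [sh1 sh2] := window_shift_le zN W0.
have rS : wsum N (fun m => W m * nsq (z m)) <= wsum N (fun m => r m * (W m * nsq (z m))).
  by apply: ler_wsum => m _; rewrite ler_peMl.
have s0 : 0 < a / 2 by rewrite divr_gt0.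
pose F m := line_op b lam r z m.
have [re0|re0] := boolP (complex.Re lam != 0).
  have aE : a = `|complex.Re lam| by rewrite /a re0.
  pose q m := complex.Re (z m * (z (m - 1))^*).
  have FE m : complex.Re (F m * (z m)^*) = b * (q m - q (m + 1))
      - complex.Re lam * (r m * nsq (z m)).
    by rewrite /F /line_op /q addrK /nsq !ReImE /=; ring.
  (* Summation by parts moves the difference from [q] to the weight, where slow variation makes it
     small. *)
  have tele : wsum N (fun m => W m * (q m - q (m + 1))) =
      wsum N (fun m => (W (m + 1) - W m) * q (m + 1)).
    have h : wsum N (fun m => W (m + 1) * q (m + 1) - W m * q m) = 0.
      have zr : z N%:Z = 0 by apply: zN; clear; lia.
      have zl : z (- N%:Z - 1) = 0 by apply: zN; clear; lia.
      rewrite (wsum_telescope N (fun m => W m * q m)) /q zr zl conjC0 mul0r mulr0.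
      by rewrite !mulr0 subrr.
    rewrite -[RHS]subr0 -h -wsumN -wsumD; apply: eq_wsum => m _; ring.
  have small : `|wsum N (fun m => W m * (q m - q (m + 1)))| <=
      eta * wsum N (fun m => W m * nsq (z m)).
    have bound m : `|(W (m + 1) - W m) * q (m + 1)| <=
        eta / 2 * (W m * nsq (z m) + W (m + 1) * nsq (z (m + 1))).
      have [_ w1 w2] := SV m.
      have d1 : `|W (m + 1) - W m| <= eta * W m.
        rewrite ler_norml; apply/andP; split; last lra.
        have [le|lt] := leP (W m) (W (m + 1)).
          by have := mulr_ge0 (ltW eta0) (ltW (W0 m)); lra.
        have : eta * W (m + 1) <= eta * W m by rewrite ler_pM2l // ltW.
        lra.
      have d2 : `|W (m + 1) - W m| <= eta * W (m + 1).
        rewrite ler_norml; apply/andP; split; first lra.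
        have [le|lt] := leP (W m) (W (m + 1)).
          have : eta * W m <= eta * W (m + 1) by rewrite ler_pM2l.
          lra.
        by have := mulr_ge0 (ltW eta0) (ltW (W0 (m + 1))); lra.
      have qle : `|q (m + 1)| <= (nsq (z (m + 1)) + nsq (z m)) / 2.
        by rewrite /q addrK; exact: Re_mulJ_le.
      have n1 := nsq_ge0 (z m); have n2 := nsq_ge0 (z (m + 1)).
      rewrite normrM (le_trans (ler_wpM2l (normr_ge0 _) qle)) //.
      have := ler_wpM2r n1 d1; have := ler_wpM2r n2 d2; lra.
    have sum_bound : wsum N (fun m => eta / 2 * (W m * nsq (z m) + W (m + 1) * nsq (z (m + 1))))
        <= eta * wsum N (fun m => W m * nsq (z m)).
      rewrite wsumZ wsumD.
      set A := wsum N (fun m => W m * nsq (z m)) in sh1 sh2 *.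
      set C := wsum N (fun m => W (m + 1) * nsq (z (m + 1))) in sh1 *.
      have : eta / 2 * (A + C) <= eta / 2 * (2 * A) by rewrite ler_pM2l ?divr_gt0 //; lra.
      lra.
    rewrite tele ler_norml; apply/andP; split; last first.
      rewrite (le_trans _ sum_bound) //; apply: ler_wsum => m _.
      by have := bound m; rewrite ler_norml => /andP[].
    rewrite (le_trans (_ : _ <= - wsum N (fun m => eta / 2 * (W m * nsq (z m) + W (m + 1) * nsq (z (m + 1)))))) ?lerN2 //.
    rewrite -wsumN; apply: ler_wsum => m _.
    by have := bound m; rewrite ler_norml => /andP[].
  have Q := @young_wsum R N W F z (a / 2) (fun m => complex.Re (F m * (z m)^*)) s0 W0
    (fun m => (young_mulJ (F m) (z m) s0).1).
  apply: (young_absorb (be := `|b|) (eta := eta) a0 S0 beta _ Q).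
  have sumE : wsum N (fun m => W m * complex.Re (F m * (z m)^*)) =
      b * wsum N (fun m => W m * (q m - q (m + 1))) -
      complex.Re lam * wsum N (fun m => r m * (W m * nsq (z m))).
    rewrite -!wsumZ -wsumN -wsumD; apply: eq_wsum => m _; rewrite FE; ring.
  rewrite (@le_trans _ _ (a * wsum N (fun m => r m * (W m * nsq (z m))))) ?ler_pM2l //.
  have -> : a * wsum N (fun m => r m * (W m * nsq (z m))) =
      `|complex.Re lam * wsum N (fun m => r m * (W m * nsq (z m)))|.
    by rewrite normrM -aE [in RHS]ger0_norm // (le_trans _ rS).
  rewrite (_ : complex.Re lam * _ = b * wsum N (fun m => W m * (q m - q (m + 1))) -
    wsum N (fun m => W m * complex.Re (F m * (z m)^*))); last by rewrite sumE; ring.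
  by rewrite (le_trans (ler_normB _ _)) // lerD2r normrM -mulrA ler_wpM2l.
have aE : a = `|complex.Im lam| - 2 * `|b| by rewrite /a (negPf re0).
pose q m := complex.Im (z (m - 1) * (z m)^*) - complex.Im (z (m + 1) * (z m)^*).
have FE m : complex.Im (F m * (z m)^*) = b * q m - complex.Im lam * (r m * nsq (z m)).
  by move/negPn/eqP: re0 => re0; rewrite /F /line_op /q /nsq !ReImE /= re0; ring.
have small : `|wsum N (fun m => W m * q m)| <=
    (2 + eta) * wsum N (fun m => W m * nsq (z m)).
  have bound m : W m * `|q m| <= W m * nsq (z m) +
      (1 + eta) / 2 * (W (m - 1) * nsq (z (m - 1)) + W (m + 1) * nsq (z (m + 1))).
    have [_ w1 w2] := SV m; have [_ v1 v2] := SV (m - 1); rewrite subrK in v1 v2.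
    have n1 := nsq_ge0 (z (m - 1)); have n2 := nsq_ge0 (z (m + 1)).
    have qle : `|q m| <= nsq (z m) + (nsq (z (m - 1)) + nsq (z (m + 1))) / 2.
      rewrite (le_trans (ler_normB _ _)) //.
      by have := Im_mulJ_le (z (m - 1)) (z m); have := Im_mulJ_le (z (m + 1)) (z m); lra.
    rewrite (le_trans (ler_wpM2l (ltW (W0 m)) qle)) //.
    have := ler_wpM2r n2 w2; have := ler_wpM2r n1 v1; lra.
  have sum_bound : wsum N (fun m => W m * nsq (z m) +
      (1 + eta) / 2 * (W (m - 1) * nsq (z (m - 1)) + W (m + 1) * nsq (z (m + 1))))
      <= (2 + eta) * wsum N (fun m => W m * nsq (z m)).
    rewrite wsumD wsumZ wsumD.
    set A := wsum N (fun m => W m * nsq (z m)) in sh1 sh2 *.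
    set B := wsum N (fun m => W (m - 1) * nsq (z (m - 1))) in sh2 *.
    set C := wsum N (fun m => W (m + 1) * nsq (z (m + 1))) in sh1 *.
    have : (1 + eta) / 2 * (B + C) <= (1 + eta) / 2 * (2 * A).
      by rewrite ler_pM2l ?divr_gt0 //; lra.
    lra.
  have qn m : W m * `|q m| = `|W m * q m| by rewrite normrM (gtr0_norm (W0 m)).
  rewrite ler_norml; apply/andP; split; last first.
    rewrite (le_trans _ sum_bound) //; apply: ler_wsum => m _.
    by have := bound m; rewrite qn ler_norml => /andP[].
  rewrite lerNl -wsumN (le_trans _ sum_bound) //; apply: ler_wsum => m _.
  by have := bound m; rewrite qn ler_norml lerNl => /andP[].
have Q := @young_wsum R N W F z (a / 2) (fun m => complex.Im (F m * (z m)^*)) s0 W0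
  (fun m => (young_mulJ (F m) (z m) s0).2).
apply: (young_absorb (be := `|b|) (eta := eta) a0 S0 beta _ Q).
have sumE : wsum N (fun m => W m * complex.Im (F m * (z m)^*)) =
    b * wsum N (fun m => W m * q m) -
    complex.Im lam * wsum N (fun m => r m * (W m * nsq (z m))).
  rewrite -!wsumZ -wsumN -wsumD; apply: eq_wsum => m _; rewrite FE; ring.
have h : `|complex.Im lam| * wsum N (fun m => W m * nsq (z m)) <=
    `|b| * ((2 + eta) * wsum N (fun m => W m * nsq (z m))) +
    `|wsum N (fun m => W m * complex.Im (F m * (z m)^*))|.
  rewrite (@le_trans _ _ (`|complex.Im lam| * wsum N (fun m => r m * (W m * nsq (z m))))) //.
    by rewrite ler_wpM2l.
  have -> : `|complex.Im lam| * wsum N (fun m => r m * (W m * nsq (z m))) =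
      `|complex.Im lam * wsum N (fun m => r m * (W m * nsq (z m)))|.
    by rewrite normrM [in RHS](ger0_norm (le_trans S0 rS)).
  rewrite (_ : complex.Im lam * _ = b * wsum N (fun m => W m * q m) -
    wsum N (fun m => W m * complex.Im (F m * (z m)^*))); last by rewrite sumE; ring.
  by rewrite (le_trans (ler_normB _ _)) // lerD2r normrM ler_wpM2l.
by rewrite aE; lra.
Qed.

(** * Finite sections and the inverse off the segment *)

Definition window_ext (R : realType) (N : nat) (v : 'rV[R[i]]_(N + N)) (m : int) : R[i] :=
  if - N%:Z <= m then oapp (fun i => v 0 i) 0 (insub (absz (m + N%:Z))) else 0.

Lemma window_ext_supp (R : realType) (N : nat) (v : 'rV[R[i]]_(N + N)) :
  window_supp N (window_ext v).
Proof.
move=> m mN; rewrite /window_ext; case: ifP => // Nm.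
by rewrite insubF //; apply/negbTE; lia.
Qed.

Lemma window_extE (R : realType) (N : nat) (v : 'rV[R[i]]_(N + N)) (i : 'I_(N + N)) :
  window_ext v (i%:Z - N%:Z) = v 0 i.
Proof.
rewrite /window_ext ifT; last by lia.
by rewrite subrK absz_nat insubT //= => iN; congr (v 0 _); exact: val_inj.
Qed.

(** The finite section is a square linear system; the energy estimate with constant weight makes it
    injective, hence invertible. *)
Lemma galerkin (R : realType) (b : R) (lam : R[i]) (r : int -> R) (N : nat)
    (f : int -> R[i]) :
  off_band b lam -> (forall m, 1 <= r m) ->
  exists2 z, window_supp N z &
    forall m, - N%:Z <= m < N%:Z -> line_op b lam r z m = f m.
Proof.
move=> off r1; have [eta [K [eta0 K0 est]]] := line_op_estimate off.
pose T (v : 'rV[R[i]]_(N + N)) : 'rV[R[i]]_(N + N) :=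
  \row_j line_op b lam r (window_ext v) (j%:Z - N%:Z).
have Tlin : linear T.
  move=> c u v; apply/rowP => j; rewrite !mxE.
  have extlin m : window_ext (c *: u + v) m = c * window_ext u m + window_ext v m.
    rewrite /window_ext; case: ifP => _; last by rewrite mulr0 addr0.
    by case: insub => [i|] /=; rewrite ?mxE // mulr0 addr0.
  by rewrite /line_op !extlin; ring.
pose TL := GRing.isLinear.Build _ _ _ _ T Tlin.
pose Tl : {linear 'rV[R[i]]_(N + N) -> 'rV[R[i]]_(N + N)} := HB.pack T TL.
have window m : - N%:Z <= m < N%:Z -> exists i : 'I_(N + N), m = i%:Z - N%:Z.
  move=> mN; have iN : (absz (m + N%:Z)%R < N + N)%N by lia.
  by exists (Ordinal iN) => /=; lia.
have free : row_free (lin1_mx Tl).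
  apply: inj_row_free => v; rewrite mul_rV_lin1 /= => Tv.
  have op0 m : - N%:Z <= m < N%:Z -> line_op b lam r (window_ext v) m = 0.
    by move=> /window[i ->]; move/rowP: Tv => /(_ i); rewrite !mxE.
  have SV : slowly_varying eta (fun=> 1 : R).
    by move=> m; split=> //; rewrite mulr1 lerDl ltW.
  have := est _ r N _ SV r1 (window_ext_supp v).
  rewrite [X in _ <= K * X](@eq_wsum _ _ _ (fun=> 0)); last first.
    by move=> m mN; rewrite op0 // nsq0 mulr0.
  rewrite wsum_const !mulr0 mul0rn mulr0 => S0.
  apply/rowP => i; rewrite mxE -window_extE; apply: nsq_le0.
  rewrite (le_trans _ S0) //.
  have := @wsum_term R N (fun m => 1 * nsq (window_ext v m)) (i%:Z - N%:Z).
  rewrite mul1r; apply => [m|]; first by rewrite mul1r nsq_ge0.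
  by have := ltn_ord i; lia.
pose v := (\row_j f (j%:Z - N%:Z)) *m invmx (lin1_mx Tl).
exists (window_ext v); first exact: window_ext_supp.
move=> m /window[i ->].
have : T v = \row_j f (j%:Z - N%:Z).
  by rewrite -[T v]/(Tl v) -mul_rV_lin1 /v mulmxKV // -row_free_unit.
by move=> /rowP/(_ i); rewrite !mxE.
Qed.

(** The Galerkin solutions are bounded uniformly in N, so they have pointwise limits along an
    ultrafilter. The equation at m involves three sites and passes to the limit, as does the bound
    on each fixed window. *)
Lemma line_op_solve_weighted (R : realType) (b : R) (lam : R[i]) : off_band b lam ->
  exists eta K, [/\ 0 < eta, 0 < K & forall W r f F,
    slowly_varying eta W -> (forall m, 1 <= r m) ->
    (forall N, wsum N (fun m => W m * nsq (f m)) <= F) ->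
    exists z, (forall m, line_op b lam r z m = f m) /\
      forall N, wsum N (fun m => W m * nsq (z m)) <= K * F].
Proof.
move=> off; have [eta [K [eta0 K0 est]]] := line_op_estimate off.
exists eta, K; split=> // W r f F SV r1 fF.
have W0 m : 0 < W m by have [] := SV m.
have [zN zNP] : exists zN : nat -> int -> R[i], forall N, window_supp N (zN N) /\
    forall m, - N%:Z <= m < N%:Z -> line_op b lam r (zN N) m = f m.
  suff [zN zNP] : {zN : nat -> int -> R[i] & forall N, window_supp N (zN N) /\
    forall m, - N%:Z <= m < N%:Z -> line_op b lam r (zN N) m = f m} by exists zN.
  apply: (@choice _ _ (fun N z => window_supp N z /\
    forall m, - N%:Z <= m < N%:Z -> line_op b lam r z m = f m)) => N.
  by have [z h1 h2] := @galerkin _ b lam r N f off r1; exists z.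
have bnd N : wsum N (fun m => W m * nsq (zN N m)) <= K * F.
  have [h1 h2] := zNP N; rewrite (le_trans (est W r N _ SV r1 h1)) // ler_pM2l //.
  rewrite (le_trans _ (fF N)) // le_eqVlt; apply/orP; left; apply/eqP.
  by apply: eq_wsum => m mN; rewrite h2.
have ge0 N m : 0 <= W m * nsq (zN N m) by rewrite mulr_ge0 ?nsq_ge0 // ltW.
have bnd' N N' : (N' <= N)%N -> wsum N' (fun m => W m * nsq (zN N m)) <= K * F.
  by move=> NN; rewrite (le_trans _ (bnd N)) // wsum_mono.
have [U [UU oU]] := ultraFilterLemma eventually_filter.
have FU : ProperFilter U := @ultra_proper _ _ UU.
have [z zP] : exists z : int -> R[i], forall m, ccvg U (fun N => zN N m) (z m).
  apply: (@ultra_ccvg _ _ _ _ (fun m => K * F / W m)) => // m.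
  apply: oU; exists `|m|.+1%N => // N /= mN.
  rewrite ler_pdivlMr // mulrC (le_trans _ (bnd N)) //.
  by apply: (@wsum_term _ _ (fun m => W m * nsq (zN N m))) => //; lia.
exists z; split=> [m|N].
  apply: (@ccvg_near_unique _ _ U _ (fun N => line_op b lam r (zN N) m)).
    apply: ccvgB; apply: ccvgM => //; try exact: ccvg_cst.
    exact: ccvgB.
  apply: oU; exists `|m|.+1%N => // N /= mN.
  by have [_ h] := zNP N; apply: h; lia.
have h : wsum N (fun m => W m * nsq (zN N' m)) @[N' --> U]
    --> wsum N (fun m => W m * nsq (z m)).
  apply: wsum_cvg => m; apply: cvgMr; exact: ccvg_nsq.
by apply: cvg_le h _; apply: oU; exists N => // N' /= NN; exact: bnd'.
Qed.

Lemma expr_one_small (R : realType) (l : nat) (eta : R) : 0 < eta ->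
  exists2 eps : R, 0 < eps & (1 + eps) ^+ l <= 1 + eta.
Proof.
elim: l eta => [|l IH] eta eta0; first by exists 1; rewrite ?expr0 ?lerDl ?ltW.
pose e := Num.min 1 (eta / 3).
have e0 : 0 < e by rewrite lt_min ltr01 divr_gt0.
have [eps eps0 h] := IH e e0.
exists (Num.min eps e); first by rewrite lt_min eps0.
have m0 : 0 < Num.min eps e by rewrite lt_min eps0.
have le1 : (1 + Num.min eps e) ^+ l <= 1 + e.
  rewrite (le_trans _ h) // lerXn2r ?nnegrE ?addr_ge0 ?(ltW m0) ?(ltW eps0) //.
  by rewrite lerD2l ge_min lexx.
have e1 : e <= 1 by rewrite ge_min lexx.
have e3 : e <= eta / 3 by rewrite ge_min lexx orbT.
have me : Num.min eps e <= e by rewrite ge_min lexx orbT.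
rewrite exprS (@le_trans _ _ ((1 + e) * (1 + e))) //.
  by rewrite ler_pM ?exprn_ge0 ?addr_ge0 ?(ltW m0) ?lerD2l.
have : e * e <= e by rewrite ler_piMl // ltW.
lra.
Qed.

(** The Sobolev weight itself may change by a large factor between neighbours near m = 0; with a
    large constant term the increment 2 m + 1 of the base is relatively small everywhere. *)
Lemma sobolev_weight_slow (R : realType) (g : R) (l : nat) (eta : R) :
  0 <= g -> 0 < eta -> exists c : R, 1 <= c /\
    slowly_varying eta (fun m => (c + (g + m%:~R ^+ 2)) ^+ l).
Proof.
move=> g0 eta0; have [eps eps0 he] := expr_one_small l eta0.
(* Multiplied by eps, the term 1/eps^2 completes the squares that dominate 2 |m|, and 1/eps pays for
   the 1 in 2 m + 1. *)
pose c := 1 + eps^-1 * eps^-1 + eps^-1 + eps^-1 + 1.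
have i0 : 0 < eps^-1 by rewrite invr_gt0.
have ii0 : 0 < eps^-1 * eps^-1 by rewrite mulr_gt0.
exists c; split; first by rewrite /c; lra.
pose x (m : int) := c + (g + (m%:~R : R) ^+ 2).
have c0 : 0 < c by rewrite /c; lra.
have x0 m : 0 < x m by rewrite /x ltr_wpDr // addr_ge0 ?sqr_ge0.
have key (m : int) : `|2 * m%:~R + 1 : R| <= eps * (c + (g + m%:~R ^+ 2)).
  set y : R := m%:~R.
  have h1 : eps * c = eps + eps^-1 + 1 + 1 + eps by rewrite /c; field; rewrite gt_eqF.
  have h2 : 0 <= eps * g by rewrite mulr_ge0 // ltW.
  have h3 : 0 <= eps * (y - eps^-1) ^+ 2 by rewrite mulr_ge0 ?sqr_ge0 // ltW.
  have h4 : 0 <= eps * (y + eps^-1) ^+ 2 by rewrite mulr_ge0 ?sqr_ge0 // ltW.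
  have h5 : eps * (y - eps^-1) ^+ 2 = eps * y ^+ 2 - 2 * y + eps^-1.
    by field; rewrite gt_eqF.
  have h6 : eps * (y + eps^-1) ^+ 2 = eps * y ^+ 2 + 2 * y + eps^-1.
    by field; rewrite gt_eqF.
  by rewrite (mulrDr eps c) (mulrDr eps g) h1 ler_norml; apply/andP; split; lra.
have dx m : x (m + 1) = x m + (2 * m%:~R + 1) by rewrite /x intrD; ring.
have up m : x (m + 1) <= (1 + eps) * x m.
  by rewrite dx; have := key m; rewrite -/(x m) ler_norml => /andP[]; lra.
have down m : x m <= (1 + eps) * x (m + 1).
  have := key (- (m + 1)); rewrite mulrNz sqrrN -/(x (m + 1)) ler_norml dx intrD.
  by move=> /andP[]; lra.
move=> m; rewrite -!/(x _); split; first exact: exprn_gt0.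
  rewrite (@le_trans _ _ (((1 + eps) * x m) ^+ l)) //.
    by rewrite lerXn2r ?nnegrE ?(ltW (x0 _)) // mulr_ge0 ?(ltW (x0 _)) // addr_ge0 // ltW.
  by rewrite exprMn ler_pM2r // exprn_gt0.
rewrite (@le_trans _ _ (((1 + eps) * x (m + 1)) ^+ l)) //.
  by rewrite lerXn2r ?nnegrE ?(ltW (x0 _)) // mulr_ge0 ?(ltW (x0 _)) // addr_ge0 // ltW.
by rewrite exprMn ler_pM2r // exprn_gt0.
Qed.

Lemma sobolev_weight_equiv (R : realType) (g c : R) (l : nat) (m : int) :
  0 <= g -> 1 <= c ->
  0 < sobolev_weight g l m /\
  sobolev_weight g l m <= (c + (g + m%:~R ^+ 2)) ^+ l <= c ^+ l * sobolev_weight g l m.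
Proof.
move=> g0 c1; have x0 : 0 <= g + (m%:~R : R) ^+ 2 by rewrite addr_ge0 ?sqr_ge0.
rewrite /sobolev_weight; set x := g + _ in x0 *; clearbody x.
have c0 : 0 <= c by rewrite (le_trans _ c1).
split; first by rewrite exprn_gt0 // ltr_pwDl.
rewrite -exprMn !lerXn2r ?nnegrE ?addr_ge0 ?mulr_ge0 ?addr_ge0 //.
  by rewrite mulrDr mulr1 lerD2l ler_peMl.
by rewrite lerD2r.
Qed.

Lemma line_op_solve (R : realType) (b g : R) (lam : R[i]) (l : nat) :
  0 <= g -> off_band b lam ->
  exists K, 0 < K /\ forall r f F, (forall m, 1 <= r m) ->
    (forall N, wsum N (fun m => sobolev_weight g l m * nsq (f m)) <= F) ->
    exists z, (forall m, line_op b lam r z m = f m) /\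
      forall N, wsum N (fun m => sobolev_weight g l m * nsq (z m)) <= K * F.
Proof.
move=> g0 off; have [eta [K [eta0 K0 solve]]] := line_op_solve_weighted off.
have [c [c1 SV]] := sobolev_weight_slow l g0 eta0.
have cl0 : 0 < c ^+ l by rewrite exprn_gt0 // (lt_le_trans ltr01).
exists (K * c ^+ l); split=> [|r f F r1 fF]; first exact: mulr_gt0.
have [|z [zf zK]] := solve _ r f (c ^+ l * F) SV r1.
  move=> N; apply: (@le_trans _ _ (c ^+ l * wsum N (fun m => sobolev_weight g l m * nsq (f m)))).
    rewrite -wsumZ; apply: ler_wsum => m _; rewrite mulrA ler_wpM2r ?nsq_ge0 //.
    by have [_ /andP[]] := sobolev_weight_equiv l m g0 c1.
  by rewrite ler_pM2l.
exists z; split=> // N; rewrite -mulrA (le_trans _ (zK N)) //.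
apply: ler_wsum => m _; rewrite ler_wpM2r ?nsq_ge0 //.
by have [_ /andP[]] := sobolev_weight_equiv l m g0 c1.
Qed.

(** * Weyl sequences and density of the range *)

(* linNS - lam at nu = 0 on the line k.1 = k1, with b = alpha k1 / 4. *)
Definition euler_op (R : realType) (b : R) (lam : R[i]) (rho : int -> R)
    (w : int -> R[i]) (m : int) : R[i] :=
  b%:C * ((rho (m - 1))%:C * w (m - 1) - (rho (m + 1))%:C * w (m + 1)) - lam * w m.

Definition shear_rho (R : realType) (g : R) (m : int) : R :=
  1 - (g + m%:~R ^+ 2)^-1.

Lemma sum_point (R : realType) (N a : nat) (c : R) :
  \sum_(k < N) (if k == a :> nat then c else 0) = if (a < N)%N then c else 0.
Proof.
elim: N => [|N IH]; first by rewrite big_ord0.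
rewrite big_ord_recr /= IH [in RHS]ltnS [in RHS]leq_eqVlt [N == a]eq_sym.
by case: (eqVneq a N) => [->|_]; rewrite ?ltnn ?add0r ?addr0.
Qed.

Lemma sum_interval_le (R : realType) (N a n : nat) (c : R) : 0 <= c ->
  \sum_(k < N) (if (a <= k < a + n)%N then c else 0) <= n%:R * c.
Proof.
move=> c0; elim: n => [|n IH].
  by rewrite mul0r big1 // => k _; rewrite addn0 ifF //; lia.
have -> : \sum_(k < N) (if (a <= k < a + n.+1)%N then c else 0) =
    \sum_(k < N) (if (a <= k < a + n)%N then c else 0) +
    \sum_(k < N) (if k == (a + n)%N :> nat then c else 0).
  rewrite -big_split; apply: eq_bigr => k _ /=.
  case: eqP => [->|ne]; first by rewrite ltnn andbF ifT ?add0r //; lia.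
  rewrite addr0; congr (if _ then _ else _); lia.
rewrite sum_point -natr1 mulrDl mul1r lerD //.
by case: ifP.
Qed.

Lemma wsum_nonneg_supp (V : zmodType) (N : nat) (f : int -> V) :
  (forall m, m < 0 -> f m = 0) -> wsum N f = \sum_(k < N) f k%:Z.
Proof. by move=> f0; apply: eq_bigr => k _; rewrite [X in _ + X]f0 ?addr0 //; lia. Qed.

(* Plane waves xi ^ m cut off to n <= m < 2 n; the H^l weights are comparable on
   this window, so that the cut-off edges are negligible. *)
Lemma weyl_sequence (R : realType) (b g t M : R) (l : nat) :
  0 <= g -> b != 0 -> `|t| <= 2 * `|b| ->
  exists w N X Y, [/\ window_supp N w,
    forall N', wsum N' (fun m => sobolev_weight g l m *
                       nsq (euler_op b (t *i) (shear_rho g) w m)) <= X,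
    Y <= wsum N (fun m => sobolev_weight g l m * nsq (w m)) & M * X < Y].
Proof.
move=> g0 b0 tb.
pose E := t / b.
have E2 : E ^+ 2 <= 4.
  rewrite /E expr_div_n ler_pdivrMr ?exprn_even_gt0 // -(real_normK (num_real t)).
  rewrite -(real_normK (num_real b)) (_ : 4 = 2 ^+ 2) -?exprMn; last by ring.
  by rewrite ler_pXn2r ?nnegrE // mulr_ge0.
(* A root of modulus 1 of b (1 - xi^2) = i t xi, the equation of plane waves when rho is 1. It
   exists precisely because |t| <= 2 |b|. *)
pose xi : R[i] := (Num.sqrt (1 - E ^+ 2 / 4)) +i* (- (E / 2)).
have s2 : Num.sqrt (1 - E ^+ 2 / 4) ^+ 2 = 1 - E ^+ 2 / 4.
  by rewrite sqr_sqrtr // subr_ge0 ler_pdivrMr // mul1r.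
have nxi : nsq xi = 1 by rewrite /nsq /= s2; field.
have nxik k : nsq (xi ^+ k) = 1.
  by elim: k => [|k IH]; rewrite ?expr0 ?nsqC ?expr1n // exprS nsqM nxi IH mulr1.
have xi_eq : b%:C * (1 - xi ^+ 2) = (t *i) * xi.
  have tE : t = b * E by rewrite /E mulrC divfK.
  apply: complex_ext; rewrite expr2 !ReImE /= ?mulr0 ?mul0r ?subr0 ?addr0 ?add0r ?sub0r.
    rewrite (_ : _ * _ - _ = Num.sqrt (1 - E ^+ 2 / 4) ^+ 2 - (E / 2) ^+ 2); last by ring.
    by rewrite s2 tE; field.
  by rewrite tE; field.
pose K1 : R := 2 * (b ^+ 2 * 4 + t ^+ 2).
pose K2 : R := 4 * b ^+ 2.
have K10 : 0 <= K1 by rewrite mulr_ge0 // addr_ge0 ?sqr_ge0 // mulr_ge0 ?sqr_ge0.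
have K20 : 0 <= K2 by rewrite mulr_ge0 ?sqr_ge0.
(* The wave has squared norm at least n times the weight at n, while its residual stays below 4^l (4
   K1 + K2) times that weight; n is taken large enough to beat [M]. *)
pose n := (Num.truncn (`|M| * (4 ^+ l * (4 * K1 + K2)))).+2.
have nbig : `|M| * (4 ^+ l * (4 * K1 + K2)) < n%:R.
  by rewrite (lt_trans (truncnS_gt _)) // ltr_nat.
have n1 : (1 < n)%N by [].
clearbody n; pose w (m : int) : R[i] :=
  if (0 <= m) && (n <= `|m| < n + n)%N then xi ^+ `|m|%N else 0.
have wE (k : nat) : w k%:Z = if (n <= k < n + n)%N then xi ^+ k else 0.
  by rewrite /w absz_nat.
have w0 m : ~~ (n%:Z <= m < (n + n)%:Z) -> w m = 0.
  by move=> h; rewrite /w ifF //; apply/negbTE; move: h; lia.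
have wge1 m : w m != 0 -> n%:Z <= m < (n + n)%:Z.
  by move=> h; apply: contraNT h => /w0 ->.
have nw m : nsq (w m) <= 1 by rewrite /w; case: ifP; rewrite ?nxik ?nsq0.
have kap_ge (m : int) : n%:Z - 1 <= m -> (n%:R - 1) ^+ 2 <= g + (m%:~R : R) ^+ 2.
  move=> nm; rewrite (@le_trans _ _ ((m%:~R : R) ^+ 2)) ?lerDr //.
  have -> : (n%:R - 1 : R) = (n%:Z - 1)%:~R by rewrite intrB.
  by rewrite ler_pXn2r ?nnegrE ?ler0z ?ler_int //; lia.
pose A := euler_op b (t *i) (shear_rho g) w.
have Wx m : 0 < sobolev_weight g l m.
  by rewrite exprn_gt0 // ltr_pwDl // addr_ge0 ?sqr_ge0.
have rho01 m : n%:Z <= m -> 0 <= shear_rho g m <= 1.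
  move=> nm; have x1 : 1 <= g + (m%:~R : R) ^+ 2.
    have h1 : 1 <= (m%:~R : R) by rewrite -[1]/(1%:~R) ler_int; lia.
    by rewrite (le_trans _ (_ : (m%:~R : R) ^+ 2 <= _)) ?lerDr // exprn_ege1.
  rewrite /shear_rho subr_ge0 gerBl invr_ge0 invf_le1 ?x1 ?(le_trans ler01) //.
  by rewrite (lt_le_trans ltr01).
have nrw m : nsq ((shear_rho g m)%:C * w m) <= 1.
  have [->|wm] := eqVneq (w m) 0; first by rewrite mulr0 nsq0.
  have /andP[r0 r1] : 0 <= shear_rho g m <= 1.
    by apply: rho01; case/andP: (wge1 _ wm).
  by rewrite nsqM nsqC -[leRHS]mulr1 ler_pM ?sqr_ge0 ?nsq_ge0 // exprn_ile1.
have A_all m : nsq (A m) <= K1.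
  rewrite /A /euler_op (le_trans (nsqB_le _ _)) // /K1 ler_pM2l // lerD //.
    rewrite nsqM nsqC ler_wpM2l ?sqr_ge0 // (le_trans (nsqB_le _ _)) //.
    by have := nrw (m - 1); have := nrw (m + 1); lra.
  rewrite nsqM {1}/nsq /= expr0n add0r -[leRHS]mulr1 ler_wpM2l ?sqr_ge0 //.
(* In the interior the wave cancels except for the defects 1 - rho, so the n interior sites together
   contribute at most [K2]. *)
have A_in m : n%:Z < m -> m < (n + n)%:Z - 1 -> nsq (A m) <= K2 / n%:R.
  move=> m1 m2.
  have [k kE] : exists k : nat, m = k.+1%:Z by exists `|m|.-1%N; lia.
  have kn : (n <= k)%N by lia.
  have -> : A m = - (b%:C * (((g + (m - 1)%:~R ^+ 2)^-1)%:C * xi ^+ k -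
       ((g + (m + 1)%:~R ^+ 2)^-1)%:C * xi ^+ k.+2)).
    rewrite /A /euler_op kE.
    have e1 : k.+1%:Z - 1 = k%:Z by lia.
    have e2 : k.+1%:Z + 1 = k.+2%:Z by lia.
    rewrite e1 e2 !wE !ifT; try by lia.
    rewrite /shear_rho !rmorphB /= rmorph1.
    have -> : t *i * xi ^+ k.+1 = b%:C * (1 - xi ^+ 2) * xi ^+ k.
      by rewrite xi_eq exprS mulrA.
    rewrite !exprS; ring.
  rewrite nsqN nsqM nsqC (_ : K2 / n%:R = b ^+ 2 * (4 / n%:R)); last first.
    by rewrite /K2; ring.
  rewrite ler_wpM2l ?sqr_ge0 //.
  have nc (a : R) j : nsq (a%:C * xi ^+ j) = a ^+ 2 by rewrite nsqM nsqC nxik mulr1.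
  rewrite (le_trans (nsqB_le _ _)) // !nc.
  have inv_le (m' : int) : n%:Z <= m' -> ((g + (m'%:~R : R) ^+ 2)^-1) ^+ 2 <= n%:R^-1.
    move=> nm'; have n0 : (0 : R) < n%:R by rewrite ltr0n ltnW.
    have x1 : n%:R <= g + (m'%:~R : R) ^+ 2.
      have h1 : n%:R <= (m'%:~R : R) by rewrite pmulrn ler_int.
      have h2 : 1 <= (m'%:~R : R) by rewrite (le_trans _ h1) // ler1n ltnW.
      have h3 : (m'%:~R : R) <= m'%:~R ^+ 2 by rewrite expr2 ler_peMr // (le_trans ler01).
      lra.
    have x0 : 0 < g + (m'%:~R : R) ^+ 2 by rewrite (lt_le_trans n0).
    have i1 : (g + (m'%:~R : R) ^+ 2)^-1 <= n%:R^-1 by rewrite lef_pV2 ?posrE.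
    have i2 : n%:R^-1 <= 1 :> R by rewrite invf_le1 // ler1n ltnW.
    have i0 : 0 <= (g + (m'%:~R : R) ^+ 2)^-1 by rewrite invr_ge0 ltW.
    rewrite expr2 (le_trans _ i1) // ler_piMl // (le_trans i1) //.
  have a1 : n%:Z <= m - 1 by lia.
  have a2 : n%:Z <= m + 1 by lia.
  by have := inv_le _ a1; have := inv_le _ a2; lra.
have A_out m : ~~ (n%:Z - 1 <= m < (n + n)%:Z + 1) -> A m = 0.
  move=> h; rewrite /A /euler_op !w0 ?mulr0 ?subrr ?mulr0 ?subrr //; move: h; lia.
pose Wn := sobolev_weight g l n%:Z; pose W2 := sobolev_weight g l (n + n)%:Z.
have W2n : W2 <= 4 ^+ l * Wn.
  rewrite /W2 /Wn /sobolev_weight -exprMn lerXn2r ?nnegrE ?mulr_ge0 ?addr_ge0 ?sqr_ge0 //.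
  by rewrite PoszD intrD; have := g0; have := sqr_ge0 (n%:~R : R); lra.
have Wmono (k j : nat) : (k <= j)%N -> sobolev_weight g l k%:Z <= sobolev_weight g l j%:Z.
  move=> kj; rewrite lerXn2r ?nnegrE ?addr_ge0 ?sqr_ge0 //.
  by rewrite !lerD2l ler_pXn2r ?nnegrE ?ler0z // ler_int.
exists w, (n + n)%N, (W2 * (4 * K1 + K2)), (n%:R * Wn); split.
- by move=> m h; apply: w0; move: h; lia.
- move=> N'; rewrite -/A wsum_nonneg_supp; last first.
    by move=> m m0; rewrite -/(A m) A_out ?nsq0 ?mulr0 //; clear -m0 n1; lia.
  (* The residual is dominated by point masses at the four edge sites n - 1, n, 2n - 1, 2n and a
     uniform interior part. *)
  pose pt (a : nat) (k : nat) : R := if k == a then K1 else 0.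
  pose inner (k : nat) : R := if (n <= k < n + n)%N then K2 / n%:R else 0.
  have ptE a : pt a a = K1 by rewrite /pt eqxx.
  have pt0 a k : 0 <= pt a k by rewrite /pt; case: ifP.
  have innerE k : (n <= k < n + n)%N -> inner k = K2 / n%:R by rewrite /inner => ->.
  have inner0 k : 0 <= inner k by rewrite /inner; case: ifP => // _; rewrite divr_ge0.
  have ptle a : \sum_(k < N') pt a k <= K1 by rewrite /pt sum_point; case: ifP.
  have innerle : \sum_(k < N') inner k <= K2.
    rewrite (le_trans (sum_interval_le N' n n _)) ?divr_ge0 // mulrC divfK //.
    by rewrite pnatr_eq0 -lt0n ltnW.
  clearbody pt inner.
  have bound (k : nat) : sobolev_weight g l k%:Z * nsq (A k%:Z) <=
      W2 * (pt n.-1 k + pt n k + pt (n + n).-1 k + pt (n + n)%N k + inner k).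
    have q1 := pt0 n.-1 k; have q2 := pt0 n k; have q3 := pt0 (n + n).-1 k.
    have q4 := pt0 (n + n)%N k; have q5 := inner0 k.
    have [kin|kout] := boolP (n%:Z - 1 <= k%:Z < (n + n)%:Z + 1); last first.
      by rewrite A_out // nsq0 mulr0 mulr_ge0 ?(ltW (Wx _)) // !addr_ge0.
    rewrite ler_pM ?(ltW (Wx _)) ?nsq_ge0 //; first by apply: Wmono; clear -kin n1; lia.
    have A1 := A_all k%:Z.
    have [p1|p1] := eqVneq k n.-1; first by have := ptE n.-1; rewrite -{2}p1; lra.
    have [p2|p2] := eqVneq k n; first by have := ptE n; rewrite -{2}p2; lra.
    have [p3|p3] := eqVneq k (n + n).-1.
      by have := ptE (n + n).-1; rewrite -{2}p3; lra.
    have [p4|p4] := eqVneq k (n + n)%N.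
      by have := ptE (n + n)%N; rewrite -{2}p4; lra.
    have r1 : n%:Z < k%:Z by clear -kin p1 p2; lia.
    have r2 : k%:Z < (n + n)%:Z - 1 by clear -kin p3 p4; lia.
    have := A_in _ r1 r2; rewrite -(innerE k); last by clear -r1 r2; lia.
    lra.
  rewrite (le_trans (ler_sum _ (fun (k : 'I_N') _ => bound k))) //.
  rewrite -mulr_sumr ler_pM2l ?Wx // !big_split /=.
  have := ptle n.-1; have := ptle n; have := ptle (n + n).-1; have := ptle (n + n)%N.
  lra.
- rewrite wsum_nonneg_supp; last by move=> m m0; rewrite w0 ?nsq0 ?mulr0 //; lia.
  rewrite -(big_mkord xpredT (fun k => sobolev_weight g l k%:Z * nsq (w k%:Z))).
  rewrite (big_cat_nat (leq0n n) (leq_addr n n)) /= -[leLHS]add0r lerD //.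
    by apply: sumr_ge0 => k _; rewrite mulr_ge0 ?nsq_ge0 // ltW.
  rewrite (le_trans (_ : _ <= \sum_(n <= k < n + n) Wn)) //.
    by rewrite sumr_const_nat addnK mulr_natl.
  apply: ler_sum_nat => k kn; rewrite wE kn nxik mulr1; apply: Wmono.
  by case/andP: kn.
- have c0 : 0 <= 4 * K1 + K2 by rewrite addr_ge0 // mulr_ge0.
  have X0 : 0 <= W2 * (4 * K1 + K2) by rewrite mulr_ge0 // ltW // Wx.
  apply: (@le_lt_trans _ _ (`|M| * (4 ^+ l * Wn * (4 * K1 + K2)))).
    rewrite (le_trans (ler_wpM2r X0 (ler_norm M))) // ler_wpM2l //.
    by rewrite ler_wpM2r.
  have -> : `|M| * (4 ^+ l * Wn * (4 * K1 + K2)) = `|M| * (4 ^+ l * (4 * K1 + K2)) * Wn.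
    by ring.
  by rewrite ltr_pM2r ?Wx.
Qed.

Lemma window_supp_mono (R : realType) (N N' : nat) (w : int -> R[i]) :
  (N <= N')%N -> window_supp N w -> window_supp N' w.
Proof. by move=> NN h m mN; apply: h; move: mN; lia. Qed.

Lemma euler_op_window (R : realType) (b : R) (lam : R[i]) (rho : int -> R)
    (N : nat) (w : int -> R[i]) :
  window_supp N w -> window_supp N.+1 (euler_op b lam rho w).
Proof.
move=> h m mN; rewrite /euler_op !h ?mulr0 ?subrr ?mulr0 ?subrr //; move: mN; lia.
Qed.

(** * Density of the range *)

Definition euler_adj (R : realType) (b : R) (lam : R[i]) (rho : int -> R)
    (r : int -> R[i]) (m : int) : R[i] :=
  b%:C * (rho m)%:C * (r (m + 1) - r (m - 1)) - lam^* * r m.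

(** The two pairings differ by a discrete flux [G (m + 1) - G m], which telescopes to 0. *)
Lemma euler_adjE (R : realType) (b : R) (lam : R[i]) (rho : int -> R)
    (N : nat) (r h : int -> R[i]) : window_supp N r -> window_supp N h ->
  wsum N.+1 (fun m => complex.Re (r m * (euler_op b lam rho h m)^*)) =
  wsum N.+1 (fun m => complex.Re (euler_adj b lam rho r m * (h m)^*)).
Proof.
move=> rN hN.
pose G m := b * (complex.Re (r m * (h (m - 1))^*) * rho (m - 1)
                + complex.Re (r (m - 1) * (h m)^*) * rho m).
have : wsum N.+1 (fun m => G (m + 1) - G m) = 0.
  have z1 : r N.+1%:Z = 0 by apply: rN; clear; lia.
  have z2 : r (- N.+1%:Z) = 0 by apply: rN; clear; lia.
  have z3 : h N.+1%:Z = 0 by apply: hN; clear; lia.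
  have z4 : h (- N.+1%:Z) = 0 by apply: hN; clear; lia.
  rewrite wsum_telescope /G z1 z2 z3 z4 conjC0 !mul0r !mulr0 /=.
  by rewrite !mul0r addr0 mulr0 subrr.
move=> G0; apply/eqP; rewrite -subr_eq0 -wsumN -wsumD -oppr_eq0 -wsumN; apply/eqP.
rewrite -[RHS]G0; apply: eq_wsum => m _.
rewrite /G addrK /euler_op /euler_adj !ReImE /=; ring.
Qed.

Lemma euler_op_bound (R : realType) (b : R) (lam : R[i]) (rho : int -> R) (P : R)
    (N : nat) (h : int -> R[i]) : (forall m, `|rho m| <= P) -> window_supp N h ->
  wsum N (fun m => nsq (euler_op b lam rho h m)) <=
    (8 * b ^+ 2 * P ^+ 2 + 2 * nsq lam) * wsum N (fun m => nsq (h m)).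
Proof.
move=> rP hN.
have [sh1 sh2] := @window_shift_le R N (fun=> 1) h hN (fun=> ltr01).
have one (f : int -> int) : wsum N (fun m => 1 * nsq (h (f m))) = wsum N (fun m => nsq (h (f m))).
  by apply: eq_wsum => m _; rewrite mul1r.
rewrite (one (fun m => m + 1)) (one id) in sh1.
rewrite (one (fun m => m - 1)) (one id) in sh2.
have rn m : nsq ((rho m)%:C * h m) <= P ^+ 2 * nsq (h m).
  rewrite nsqM nsqC ler_wpM2r ?nsq_ge0 // -(real_normK (num_real (rho m))).
  by rewrite lerXn2r ?nnegrE // (le_trans _ (rP 0)).
have bound m : nsq (euler_op b lam rho h m) <=
    (4 * b ^+ 2 * P ^+ 2) * (nsq (h (m - 1)) + nsq (h (m + 1))) + 2 * nsq lam * nsq (h m).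
  rewrite (le_trans (nsqB_le _ _)) // !nsqM nsqC.
  have h1 := nsqB_le ((rho (m - 1))%:C * h (m - 1)) ((rho (m + 1))%:C * h (m + 1)).
  have h2 := rn (m - 1); have h3 := rn (m + 1).
  have : b ^+ 2 * nsq ((rho (m - 1))%:C * h (m - 1) - (rho (m + 1))%:C * h (m + 1)) <=
      b ^+ 2 * (2 * (P ^+ 2 * nsq (h (m - 1)) + P ^+ 2 * nsq (h (m + 1)))).
    by rewrite ler_wpM2l ?sqr_ge0 //; lra.
  lra.
rewrite (le_trans (ler_wsum (fun m _ => bound m))) // wsumD !wsumZ wsumD.
have c0 : 0 <= 4 * b ^+ 2 * P ^+ 2.
  exact: mulr_ge0 (mulr_ge0 (ler0n _ 4) (sqr_ge0 b)) (sqr_ge0 P).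
set S := wsum N (fun m => nsq (h m)) in sh1 sh2 *.
set B := wsum N (fun m => nsq (h (m - 1))) in sh2 *.
set C := wsum N (fun m => nsq (h (m + 1))) in sh1 *.
have : 4 * b ^+ 2 * P ^+ 2 * (B + C) <= 4 * b ^+ 2 * P ^+ 2 * (2 * S).
  by rewrite ler_wpM2l //; lra.
lra.
Qed.

Lemma wsum_tail (R : realType) (f : int -> R) (F eps : R) :
  (forall m, 0 <= f m) -> (forall N, wsum N f <= F) -> 0 < eps ->
  exists N1, forall N, wsum N f <= wsum N1 f + eps.
Proof.
move=> f0 fF eps0; pose D := [set wsum N f | N in [set: nat]].
have supD : has_sup D by split; [exists (wsum 0 f), 0%N|exists F => _ [N _ <-]].
have [_ [N1 _ <-] h] := sup_adherent eps0 supD.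
exists N1 => N; rewrite ltrBlDr in h; rewrite (le_trans _ (ltW h)) //.
by apply: ub_le_sup => //; [case: supD|exists N].
Qed.

Lemma variation_bound (R : realType) (s a E K Q : R) :
  0 < s -> 2 * - s * Q <= a + (- s) ^+ 2 * E -> E <= K ->
  - Q <= (a / s + s * K) / 2.
Proof.
move=> s0; rewrite sqrrN => h1 EK.
have h2 : s ^+ 2 * E <= s ^+ 2 * K by rewrite ler_wpM2l ?sqr_ge0.
rewrite -(ler_pM2l (_ : 0 < 2 * s)) ?mulr_gt0 //.
have -> : 2 * s * ((a / s + s * K) / 2) = a + s ^+ 2 * K by field; rewrite gt_eqF.
lra.
Qed.

(* The residuals of a minimizing sequence for |A w - f| converge to a solution
   of the adjoint equation, hence to 0; therefore the infimum is 0. *)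
Lemma euler_range_dense_fin (R : realType) (b : R) (lam : R[i]) (rho : int -> R)
    (P : R) (N1 : nat) (f : int -> R[i]) (eps : R) :
  (forall m, `|rho m| <= P) ->
  (forall z, null_line z -> (forall m, euler_adj b lam rho z m = 0) -> forall m, z m = 0) ->
  window_supp N1 f -> 0 < eps ->
  exists N w, window_supp N w /\
    forall N', wsum N' (fun m => nsq (f m - euler_op b lam rho w m)) <= eps.
Proof.
move=> rP inj fN1 eps0.
pose res w m := f m - euler_op b lam rho w m.
have resN N w : (N1 <= N)%N -> window_supp N w -> window_supp N.+1 (res w).
  move=> NN wN m mN; rewrite /res (euler_op_window _ _ _ wN) // subr0 fN1 //.
  by move: mN; lia.
(* Only windows containing the support of [f] compete, so that the residual fits into the window
   enlarged by one site. *)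
pose D := [set x | exists N w, [/\ (N1 <= N)%N, window_supp N w
                      & x = wsum N.+1 (fun m => nsq (res w m))]].
have lbD : lbound D 0.
  by move=> x [N [w [_ _ ->]]]; apply: wsum_ge0 => m; exact: nsq_ge0.
have D0 : D !=set0 by exists (wsum N1.+1 (fun m => nsq (res (fun=> 0) m))), N1, (fun=> 0).
have infD : has_inf D by split=> //; exists 0.
pose d := inf D.
have dge N w : (N1 <= N)%N -> window_supp N w -> d <= wsum N.+1 (fun m => nsq (res w m)).
  by move=> NN wN; apply: ge_inf; [exists 0|exists N, w].
have [xs xsP] : exists xs : nat -> nat * (int -> R[i]), forall j,
    [/\ (N1 <= (xs j).1)%N, window_supp (xs j).1 (xs j).2 &
      wsum (xs j).1.+1 (fun m => nsq (res (xs j).2 m)) < d + j.+1%:R^-1].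
  suff [xs xsP] : {xs : nat -> nat * (int -> R[i]) & forall j,
    [/\ (N1 <= (xs j).1)%N, window_supp (xs j).1 (xs j).2 &
      wsum (xs j).1.+1 (fun m => nsq (res (xs j).2 m)) < d + j.+1%:R^-1]} by exists xs.
  apply: (@choice _ _ (fun j (x : nat * (int -> R[i])) => [/\ (N1 <= x.1)%N, window_supp x.1 x.2 &
      wsum x.1.+1 (fun m => nsq (res x.2 m)) < d + j.+1%:R^-1])) => j.
  have j0 : (0 : R) < j.+1%:R^-1 by rewrite invr_gt0.
  by have [_ [N [w [h1 h2 ->]]] h3] := inf_adherent j0 infD; exists (N, w).
pose r j := res (xs j).2.
have rsupp j : window_supp (xs j).1.+1 (r j).
  by have [h1 h2 _] := xsP j; exact: resN.
have energy j N' : wsum N' (fun m => nsq (r j m)) <= d + j.+1%:R^-1.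
  have [h1 h2 h3] := xsP j; rewrite (le_trans _ (ltW h3)) //.
  have ge0 m : 0 <= nsq (r j m) by exact: nsq_ge0.
  have [le|lt] := leqP N' (xs j).1.+1; first exact: wsum_mono.
  rewrite le_eqVlt; apply/orP; left; apply/eqP; apply: wsum_supp; last exact: ltnW.
  by move=> m mN; rewrite rsupp // nsq0.
have i1 j : j.+1%:R^-1 <= 1 :> R by rewrite invf_le1 // ler1n.
have d0 : 0 <= d by exact: lb_le_inf.
(* First variation in the direction h. *)
have variation j M h s : ((xs j).1 <= M)%N -> window_supp M h ->
    2 * s * wsum M.+1 (fun m => complex.Re (r j m * (euler_op b lam rho h m)^*)) <=
    j.+1%:R^-1 + s ^+ 2 * wsum M.+1 (fun m => nsq (euler_op b lam rho h m)).
  move=> xM hM; have [h1 h2 h3] := xsP j.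
  have := @dge M (fun m => (xs j).2 m + s%:C * h m) (leq_trans h1 xM).
  have wM : window_supp M (fun m => (xs j).2 m + s%:C * h m).
    by move=> m mM; rewrite hM // (window_supp_mono xM h2) // mulr0 addr0.
  move=> /(_ wM) dle.
  have := energy j M.+1.
  have -> : wsum M.+1 (fun m => nsq (r j m)) =
      wsum M.+1 (fun m => nsq (res (fun m => (xs j).2 m + s%:C * h m) m)) +
      (2 * s * wsum M.+1 (fun m => complex.Re (r j m * (euler_op b lam rho h m)^*)) -
       s ^+ 2 * wsum M.+1 (fun m => nsq (euler_op b lam rho h m))).
    rewrite -!wsumZ -wsumN -!wsumD; apply: eq_wsum => m _.
    have -> : res (fun m => (xs j).2 m + s%:C * h m) m = r j m - s%:C * euler_op b lam rho h m.
      by rewrite /r /res /euler_op; ring.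
    move: (r j m) (euler_op b lam rho h m) => x y.
    by rewrite /nsq !ReImE /=; ring.
  have lin (X Y Z a : R) : d <= X -> X + (Y - Z) <= d + a -> Y <= a + Z by lra.
  exact: lin dle.
(* The bound of [euler_op_bound] for the squared norm, plus 1 to make it positive. *)
pose KA := 8 * b ^+ 2 * P ^+ 2 + 2 * nsq lam + 1.
have KA0 : 0 < KA.
  have c0 : 0 <= 8 * b ^+ 2 * P ^+ 2.
    exact: mulr_ge0 (mulr_ge0 (ler0n _ 8) (sqr_ge0 b)) (sqr_ge0 P).
  by have := nsq_ge0 lam; rewrite /KA; lra.
(* First variation along the adjoint residual itself with step 1 / KA: the quadratic term absorbs
   half of the linear one, which leaves a squared norm of at most KA / (j + 1). *)
have adj_small j m : nsq (euler_adj b lam rho (r j) m) <= KA * j.+1%:R^-1.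
  pose h := euler_adj b lam rho (r j); pose M := (xs j).1.+2.
  have hM : window_supp M h.
    move=> k kM; rewrite /h /euler_adj !rsupp ?subrr ?mulr0 ?subrr //; move: kM; rewrite /M; lia.
  have hM1 := window_supp_mono (leqnSn M) hM.
  have rM : window_supp M (r j) by apply: window_supp_mono (rsupp j).
  have v := @variation j M h KA^-1 _ hM; rewrite euler_adjE // in v.
  have v' := v (leq_trans (leqnSn _) (leqnSn _)).
  have e1 : wsum M.+1 (fun m => complex.Re (euler_adj b lam rho (r j) m * (h m)^*)) =
      wsum M.+1 (fun m => nsq (h m)).
    by apply: eq_wsum => k _; rewrite conj_mul_nsq.
  have e2 := @euler_op_bound R b lam rho P M.+1 h rP hM1.
  rewrite e1 in v'; set S := wsum M.+1 (fun m => nsq (h m)) in v' e2.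
  have S0 : 0 <= S by apply: wsum_ge0 => k; exact: nsq_ge0.
  have e3 : KA^-1 ^+ 2 * wsum M.+1 (fun m => nsq (euler_op b lam rho h m)) <= KA^-1 * S.
    rewrite expr2 -mulrA ler_pM2l ?invr_gt0 // mulrC ler_pdivrMr //.
    by rewrite (le_trans e2) // mulrC ler_wpM2l // /KA lerDl.
  have lin (x y a : R) : 2 * x <= a + y -> y <= x -> x <= a by lra.
  have e4 : KA^-1 * S <= j.+1%:R^-1 by apply: lin e3; rewrite mulrA.
  have e5 : S <= KA * j.+1%:R^-1 by rewrite -ler_pdivrMl.
  have [mM|mM] := boolP (- M.+1%:Z <= m < M.+1%:Z).
    rewrite (le_trans _ e5) //; apply: (@wsum_term _ _ (fun m => nsq (h m))) => // k.
    exact: nsq_ge0.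
  by rewrite -/(h m) hM1 // nsq0 mulr_ge0 ?(ltW KA0).
have [U [UU oU]] := ultraFilterLemma eventually_filter.
have FU : ProperFilter U := @ultra_proper _ _ UU.
have inv0 : j.+1%:R^-1 @[j --> U] --> (0 : R) by apply: cvg_trans (@cvg_harmonic R); exact: cvg_app.
have [z zP] : exists z : int -> R[i], forall m, ccvg U (fun j => r j m) (z m).
  apply: (@ultra_ccvg _ _ _ _ (fun=> d + 1)) => // m; near=> j.
  apply: (@le_trans _ _ (wsum `|m|.+1 (fun m => nsq (r j m)))); last first.
    by rewrite (le_trans (energy _ _)) // lerD2l.
  apply: (@wsum_term _ _ (fun m => nsq (r j m))) => [k|]; first exact: nsq_ge0.
  by clear; lia.
have zsum N : wsum N (fun m => nsq (z m)) <= d + 1.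
  have h : wsum N (fun m => nsq (r j m)) @[j --> U] --> wsum N (fun m => nsq (z m)).
    by apply: wsum_cvg => m; exact: ccvg_nsq.
  by apply: cvg_le h _; near=> j; rewrite (le_trans (energy _ _)) // lerD2l.
have z0 : forall m, z m = 0.
  apply: inj; first exact: (wsum_bounded_cvg0 (fun m => nsq_ge0 (z m)) zsum).
  move=> m; apply: nsq_le0.
  have h : nsq (euler_adj b lam rho (r j) m) @[j --> U] --> nsq (euler_adj b lam rho z m).
    apply: ccvg_nsq; apply: ccvgB; apply: ccvgM => //; try exact: ccvg_cst.
    exact: ccvgB.
  have h' : KA * j.+1%:R^-1 @[j --> U] --> (0 : R) by rewrite -(mulr0 KA); exact: cvgMr.
  rewrite -subr_ge0; apply: cvg_ge (cvgB h' h) _; near=> j.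
  by rewrite subr_ge0; exact: adj_small.
pose K := 2 * (d + 1 + wsum N1 (fun m => nsq (f m))).
have F0 : 0 <= wsum N1 (fun m => nsq (f m)) by apply: wsum_ge0 => m; exact: nsq_ge0.
have K0 : 0 < K by rewrite mulr_gt0 // ltr_pwDl // ltr_wpDl.
(* Variation along [w] itself: as r = f - A w, the energy is the pairing of r with f minus that with
   A w. The first tends to 0, because r does pointwise and f has finite support; the second is
   controlled by the near-minimality of w. *)
have dbound s : 0 < s -> d <= s * K / 2.
  move=> s0.
  have ineq j : d <= wsum N1 (fun m => complex.Re (r j m * (f m)^*)) +
      (j.+1%:R^-1 / s + s * K) / 2.
    have [h1 h2 h3] := xsP j.
    have v := variation j (xs j).1 (xs j).2 (- s) (leqnn _) h2.
    have A2 : wsum (xs j).1.+1 (fun m => nsq (euler_op b lam rho (xs j).2 m)) <= K.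
      have pt m : nsq (euler_op b lam rho (xs j).2 m) <= 2 * (nsq (f m) + nsq (r j m)).
        have -> : euler_op b lam rho (xs j).2 m = f m - r j m by rewrite /r /res opprB addrC subrK.
        exact: nsqB_le.
      rewrite (le_trans (ler_wsum (fun m _ => pt m))) // wsumZ wsumD ler_pM2l //.
      rewrite addrC lerD //; first by rewrite (le_trans (energy _ _)) // lerD2l.
      rewrite le_eqVlt; apply/orP; left; apply/eqP; apply: wsum_supp; last exact: leqW.
      by move=> m mN; rewrite fN1 // nsq0.
    have split_r : wsum (xs j).1.+1 (fun m => nsq (r j m)) =
        wsum N1 (fun m => complex.Re (r j m * (f m)^*)) -
        wsum (xs j).1.+1 (fun m => complex.Re (r j m * (euler_op b lam rho (xs j).2 m)^*)).
      have <- : wsum (xs j).1.+1 (fun m => complex.Re (r j m * (f m)^*)) =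
          wsum N1 (fun m => complex.Re (r j m * (f m)^*)).
        apply: wsum_supp; last exact: leqW.
        by move=> m mN; rewrite fN1 // conjC0 mulr0.
      rewrite -wsumN -wsumD; apply: eq_wsum => m _.
      have fE : f m = r j m + euler_op b lam rho (xs j).2 m by rewrite /r /res subrK.
      move: fE; move: (r j m) (euler_op _ _ _ _ _) => x y ->.
      by rewrite /nsq !ReImE; ring.
    have := dge (xs j).1 (xs j).2 h1 h2; rewrite -/(r j) split_r.
    set Q := wsum (xs j).1.+1 _ in v *; move=> hd.
    by rewrite (le_trans hd) // lerD2l (variation_bound s0 v A2).
  have h1 : wsum N1 (fun m => complex.Re (r j m * (f m)^*)) @[j --> U] --> (0 : R).
    have -> : 0 = wsum N1 (fun m => complex.Re (z m * (f m)^*)).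
      rewrite (@eq_wsum _ _ _ (fun=> 0)) ?wsum_const ?mulr0 ?mul0rn // => m _.
      by rewrite z0 mul0r.
    apply: wsum_cvg => m.
    exact: (proj1 (ccvgM FU (zP m) (ccvg_cst FU ((f m)^*)))).
  have h2 : wsum N1 (fun m => complex.Re (r j m * (f m)^*)) +
      (j.+1%:R^-1 / s + s * K) / 2 @[j --> U] --> s * K / 2.
    have -> : s * K / 2 = 0 + (0 / s + s * K) / 2 by rewrite mul0r !add0r.
    by apply: cvgD => //; apply: cvgMl; apply: cvgD; [exact: cvgMl|exact: cvg_cst].
  by apply: cvg_ge h2 _; near=> j.
have dE : d <= eps / 2.
  have := dbound (eps / K) (divr_gt0 eps0 K0).
  by rewrite divfK // gt_eqF.
have e20 : 0 < eps / 2 by rewrite divr_gt0.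
have [j jeps] : exists j : nat, j.+1%:R^-1 <= eps / 2.
  exists (Num.truncn (eps / 2)^-1).
  by rewrite invf_ple ?posrE //; exact/ltW/truncnS_gt.
exists (xs j).1, (xs j).2; split=> [|N']; first by have [] := xsP j.
by rewrite (le_trans (energy j N')) // [leRHS]splitr lerD.
Unshelve. all: by end_near. Qed.

Lemma euler_range_dense (R : realType) (b : R) (lam : R[i]) (rho : int -> R)
    (P F : R) (f : int -> R[i]) (eps : R) :
  (forall m, `|rho m| <= P) ->
  (forall z, null_line z -> (forall m, euler_adj b lam rho z m = 0) -> forall m, z m = 0) ->
  (forall N, wsum N (fun m => nsq (f m)) <= F) -> 0 < eps ->
  exists N w, window_supp N w /\
    forall N', wsum N' (fun m => nsq (euler_op b lam rho w m - f m)) <= eps.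
Proof.
move=> rP inj fF eps0; have e4 : 0 < eps / 4 by rewrite divr_gt0.
have [N1 tail] := wsum_tail (fun m => nsq_ge0 (f m)) fF e4.
pose f1 m := if - N1%:Z <= m < N1%:Z then f m else 0.
have f1N : window_supp N1 f1 by move=> m /negbTE h; rewrite /f1 h.
have [N [w [wN h]]] := euler_range_dense_fin rP inj f1N e4.
exists N, w; split=> // N'.
have pt m : nsq (euler_op b lam rho w m - f m) <=
    2 * (nsq (f1 m - euler_op b lam rho w m) + nsq (f m - f1 m)).
  rewrite (_ : _ - f m = - ((f1 m - euler_op b lam rho w m) + (f m - f1 m))); last by ring.
  by rewrite nsqN nsqD_le.
rewrite (le_trans (ler_wsum (fun m _ => pt m))) // wsumZ wsumD.
have t : wsum N' (fun m => nsq (f m - f1 m)) <= eps / 4.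
  have ge0 m : 0 <= nsq (f m - f1 m) by exact: nsq_ge0.
  pose M := maxn N' N1.
  rewrite (le_trans (wsum_mono ge0 (leq_maxl N' N1))) // -/M.
  have -> : wsum M (fun m => nsq (f m - f1 m)) =
      wsum M (fun m => nsq (f m)) - wsum M (fun m => nsq (f1 m)).
    rewrite -wsumN -wsumD; apply: eq_wsum => m _; rewrite /f1.
    by case: ifP; rewrite ?subrr ?nsq0 ?subr0.
  have -> : wsum M (fun m => nsq (f1 m)) = wsum N1 (fun m => nsq (f m)).
    rewrite (@wsum_supp _ N1) ?leq_maxr // => [|m mN]; last by rewrite f1N ?nsq0.
    by apply: eq_wsum => m mN; rewrite /f1 mN.
  by rewrite lerBlDl; exact: tail.
have := h N'; lra.
Qed.

(** * The Euler operator on a line *)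

Lemma freq_subp (k1 m : int) : (k1, m) - p = (k1, m - 1) :> freq.
Proof. by congr pair; rewrite /= ?subr0. Qed.

Lemma freq_addp (k1 m : int) : (k1, m) + p = (k1, m + 1) :> freq.
Proof. by congr pair; rewrite /= ?addr0. Qed.

Lemma linNS_line (R : realType) (alpha nu : R) (k1 m : int) (w : coeffs R) :
  linNS alpha nu w (k1, m) =
  (alpha * k1%:~R / 4)%:C *
    ((shear_rho ((alpha * k1%:~R) ^+ 2) (m - 1))%:C * w (k1, m - 1) -
     (shear_rho ((alpha * k1%:~R) ^+ 2) (m + 1))%:C * w (k1, m + 1)) -
  (nu * ((alpha * k1%:~R) ^+ 2 + m%:~R ^+ 2))%:C * w (k1, m).
Proof. by rewrite /linNS freq_subp freq_addp. Qed.

Lemma linNS_supp (R : realType) (alpha nu : R) (k1 : int) (w : coeffs R) :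
  (forall k, k.1 != k1 -> w k = 0) ->
  forall k, k.1 != k1 -> linNS alpha nu w k = 0.
Proof.
move=> w0 [a m] /= ak; rewrite linNS_line !w0 //.
by rewrite !mulr0 subrr !mulr0 subrr.
Qed.

Lemma spectrum_eigenvalue (R : realType) (alpha nu : R) (l : nat) (khat : freq)
    (lam : R[i]) :
  eigenvalues alpha nu l khat lam -> spectrum alpha nu l khat lam.
Proof.
move=> [w [wd [k /eqP wk] wE]] [M res]; apply: wk.
have H0 : Hline alpha l khat (fun=> 0).
  split=> //; rewrite /Hnorm2 esum1 // => j _.
  by rewrite normc_sqr nsq0 mulr0.
have L0 : linNS alpha nu (fun=> 0) = fun=> 0.
  by apply/funext => j; rewrite /linNS !mulr0 subrr !mulr0 subrr.
have [w0 [_ _ uniq _]] := res _ H0.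
have -> : w = w0.
  by apply: uniq => //; apply/funext => j; rewrite /shifted wE subrr.
rewrite -(uniq (fun=> 0)) //; first by split=> //; rewrite L0.
by apply/funext => j; rewrite /shifted L0 mulr0 subrr.
Qed.

Section Line.
Variables (R : realType) (alpha : R) (khat : freq) (l : nat).

Let k1 := khat.1.
Let g := (alpha * k1%:~R) ^+ 2.
Let b := alpha * k1%:~R / 4.
Let rho := shear_rho g.
Let W := sobolev_weight g l.

(** [g0] keeps the line off the axis, where the coupling vanishes; [g1] excludes rho = 0 at m = 0.
    At the other sites kappa exceeds 1 by itself. *)
Hypothesis (g0 : 0 < g) (g1 : g != 1).

Lemma k1_neq0 : k1 != 0.
Proof. by apply: contraTneq g0; rewrite /g => ->; rewrite mulr0 expr0n ltxx. Qed.

Lemma amplitude_neq0 : b != 0.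
Proof.
apply: contraTneq g0 => b0; rewrite /g (_ : alpha * k1%:~R = 4 * b); last by rewrite /b; field.
by rewrite b0 mulr0 expr0n ltxx.
Qed.

Lemma weight_ge1 m : 1 <= W m.
Proof. by rewrite exprn_ege1 // lerDl addr_ge0 ?sqr_ge0 // ltW. Qed.

Lemma weight_gt0 m : 0 < W m.
Proof. exact: lt_le_trans (weight_ge1 m). Qed.

Lemma kap_pos (m : int) : 0 < g + m%:~R ^+ 2.
Proof. by rewrite ltr_wpDr ?sqr_ge0. Qed.

Lemma kap_ge1D (m : int) : m != 0 -> g + 1 <= g + (m%:~R : R) ^+ 2.
Proof.
move=> m0; rewrite lerD2l -(real_normK (num_real _)) exprn_ege1 //.
by rewrite -intr_norm -[1]/(1%:~R) ler_int; lia.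
Qed.

Lemma rho_neq0 m : rho m != 0.
Proof.
rewrite /rho /shear_rho subr_eq0 eq_sym invr_eq1; have [->|m0] := eqVneq m 0.
  by rewrite expr0n addr0.
by rewrite gt_eqF // (lt_le_trans _ (kap_ge1D m0)) // ltrDr.
Qed.

Lemma rho_lower m : m != 0 -> g / (g + 1) <= rho m < 1.
Proof.
move=> m0; have h := kap_ge1D m0; have gp : 0 < g + 1 by rewrite addr_gt0.
have e : g / (g + 1) = 1 - (g + 1)^-1 by field; rewrite gt_eqF.
rewrite /rho /shear_rho e lerD2l lerN2 lef_pV2 ?posrE ?kap_pos // h /=.
by rewrite gtrBl invr_gt0 kap_pos.
Qed.

Lemma rho_bound m : `|rho m| <= 1 + g^-1.
Proof.
rewrite (le_trans (ler_normB _ _)) // normr1 lerD2l ger0_norm ?invr_ge0 ?(ltW (kap_pos m)) //.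
by rewrite lef_pV2 ?posrE ?kap_pos // lerDl sqr_ge0.
Qed.

Lemma Hline_seq (w : coeffs R) : Hline alpha l khat w <->
  (forall k, k.1 != k1 -> w k = 0) /\
  exists M, forall N, wsum N (fun m => W m * nsq (w (k1, m))) <= M.
Proof.
split=> [[w0 _ /Hnorm2_fin[M wM]]|[w0 [M wM]]].
  have w0' k : k.1 != k1 -> w k = 0.
    by move=> kk; apply: w0 => /lineE/eqP kk'; rewrite kk' in kk.
  by split=> //; exists M; apply/Hnorm2_le.
split; first by move=> k kk; apply: w0; apply/eqP => kk'; apply: kk; apply/lineE.
  by apply: w0; rewrite eq_sym k1_neq0.
by apply/Hnorm2_fin; exists M; exact: (proj2 (@Hnorm2_le R alpha l k1 w M w0) wM).
Qed.

Lemma weighted_comb (x y : int -> R[i]) (a c : R[i]) (M M' : R) (N : nat) :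
  wsum N (fun m => W m * nsq (x m)) <= M -> wsum N (fun m => W m * nsq (y m)) <= M' ->
  wsum N (fun m => W m * nsq (a * x m + c * y m)) <= 2 * (nsq a * M + nsq c * M').
Proof.
move=> xM yM.
have pt m : W m * nsq (a * x m + c * y m) <=
    2 * (nsq a * (W m * nsq (x m)) + nsq c * (W m * nsq (y m))).
  have := ler_wpM2l (ltW (weight_gt0 m)) (nsqD_le (a * x m) (c * y m)).
  by rewrite !nsqM; lra.
rewrite (le_trans (ler_wsum (fun m _ => pt m))) // wsumZ wsumD !wsumZ.
by rewrite ler_pM2l // lerD // ler_wpM2l // nsq_ge0.
Qed.

Lemma Hline_comb (w w' : coeffs R) (a c : R[i]) :
  Hline alpha l khat w -> Hline alpha l khat w' ->
  Hline alpha l khat (fun k => a * w k + c * w' k).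
Proof.
move=> /Hline_seq[w0 [M wM]] /Hline_seq[w0' [M' wM']]; apply/Hline_seq.
split=> [k kk|]; first by rewrite w0 // w0' // !mulr0 addr0.
exists (2 * (nsq a * M + nsq c * M')) => N.
exact: (weighted_comb _ _ (wM N) (wM' N)).
Qed.

(** The domain condition is automatic, the image of [w] being a multiple of [w]. *)
Lemma eigenfunction_intro (nu : R) (lam : R[i]) (w : coeffs R) :
  Hline alpha l khat w -> (exists k, w k != 0) ->
  (forall k, linNS alpha nu w k = lam * w k) ->
  eigenfunction alpha nu l khat lam w.
Proof.
move=> wH wn0 wE; split=> //; split=> //.
have -> : linNS alpha nu w = fun k => lam * w k + 0 * w k.
  by apply/funext => k; rewrite wE mul0r addr0.
exact: Hline_comb.
Qed.

Lemma eigenfunction_seq (nu : R) (lam : R[i]) (w : coeffs R) :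
  eigenfunction alpha nu l khat lam w ->
  let z m := (rho m)%:C * w (k1, m) in
  [/\ null_line z, exists m, z m != 0 &
    forall m, (lam + (nu * (g + m%:~R ^+ 2))%:C) / (rho m)%:C * z m =
              b%:C * (z (m - 1) - z (m + 1))].
Proof.
move=> [[/Hline_seq[w0 [M wM]] _] [k wk] wE] z.
have rC m : (rho m)%:C != 0 :> R[i] by rewrite eq_complex /= eqxx andbT rho_neq0.
have nzw m : nsq (z m) <= (1 + g^-1) ^+ 2 * (W m * nsq (w (k1, m))).
  rewrite nsqM nsqC ler_pM ?sqr_ge0 ?nsq_ge0 //.
    rewrite -(real_normK (num_real _)) lerXn2r ?nnegrE ?rho_bound //.
    by rewrite addr_ge0 // invr_ge0 ltW.
  by rewrite ler_peMl ?nsq_ge0 ?weight_ge1.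
split.
- apply: (@wsum_bounded_cvg0 _ (fun m => nsq (z m)) ((1 + g^-1) ^+ 2 * M)).
    by move=> m; exact: nsq_ge0.
  move=> N; rewrite (le_trans (ler_wsum (fun m _ => nzw m))) // wsumZ.
  by rewrite ler_wpM2l ?sqr_ge0.
- case: k wk => a m wk; have [ak|ak] := eqVneq a k1.
    by exists m; rewrite /z mulf_neq0 // -ak.
  by rewrite (w0 (a, m) ak) eqxx in wk.
- move=> m; rewrite /z mulrA divfK // mulrDl -wE linNS_line -/k1 -/g -/b -/rho; ring.
Qed.

Lemma eigenvalue_seq (nu : R) (lam : R[i]) (z : int -> R[i]) (M : R) :
  (forall N, wsum N (fun m => W m * nsq (z m)) <= M) -> (exists m, z m != 0) ->
  (forall m, (lam + (nu * (g + m%:~R ^+ 2))%:C) / (rho m)%:C * z m =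
             b%:C * (z (m - 1) - z (m + 1))) ->
  eigenvalues alpha nu l khat lam.
Proof.
move=> zM [m0 zm0] zE.
have rC m : (rho m)%:C != 0 :> R[i] by rewrite eq_complex /= eqxx andbT rho_neq0.
pose w : coeffs R := fun k => if k.1 == k1 then z k.2 / (rho k.2)%:C else 0.
have wE m : w (k1, m) = z m / (rho m)%:C by rewrite /w eqxx.
have w0 k : k.1 != k1 -> w k = 0 by rewrite /w => /negbTE ->.
(* [rho] is bounded away from 0: by [g / (g + 1)] off the origin, and at m = 0 by its own value,
   which may be negative. *)
have [P Pr] : exists P, forall m, (rho m) ^- 2 <= P.
  exists (Num.max ((rho 0) ^- 2) ((g / (g + 1)) ^- 2)) => m; rewrite le_max.
  have [->|mn0] := eqVneq m 0; first by rewrite lexx.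
  have /andP[h _] := rho_lower mn0; have gp : 0 < g / (g + 1) by rewrite divr_gt0 // addr_gt0.
  apply/orP; right; have rp := lt_le_trans gp h.
  by rewrite lef_pV2 ?posrE ?(exprn_gt0 2 gp) ?(exprn_gt0 2 rp) // lerXn2r // nnegrE ltW.
have P0 : 0 <= P by rewrite (le_trans _ (Pr 0)) // invr_ge0 sqr_ge0.
exists w; apply: eigenfunction_intro.
- apply/Hline_seq; split=> //; exists (P * M) => N.
  have pt m : W m * nsq (w (k1, m)) <= P * (W m * nsq (z m)).
    rewrite wE nsqM nsqV nsqC mulrA [leRHS]mulrC ler_wpM2l //.
    by rewrite mulr_ge0 ?nsq_ge0 // ltW // weight_gt0.
  by rewrite (le_trans (ler_wsum (fun m _ => pt m))) // wsumZ ler_wpM2l.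
- by exists (k1, m0); rewrite wE mulf_neq0 // invr_eq0.
- move=> [a m]; have [->|ak] := eqVneq a k1; last first.
    by rewrite (linNS_supp alpha nu w0) // w0 // mulr0.
  rewrite linNS_line !wE -/g -/b -/rho !(mulrC _ (_ / _)) !divfK //.
  by rewrite -zE; field; rewrite rC.
Qed.

(** With v = 1 / (kappa - 1) one has 1 / rho = 1 + v, which is the form of [line_imaginary]. At m =
    0, v is positive if g > 1, and 1 + v is negative if g < 1. *)
Lemma no_imaginary (t : R) (z : int -> R[i]) :
  null_line z ->
  (forall m, (t *i) / (rho m)%:C * z m = b%:C * (z (m - 1) - z (m + 1))) ->
  forall m, z m = 0.
Proof.
move=> znull zE; pose v (m : int) : R := (g + m%:~R ^+ 2 - 1)^-1.
have b0 := amplitude_neq0.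
have kg1 m : g + m%:~R ^+ 2 - 1 != 0.
  have := rho_neq0 m; rewrite /rho /shear_rho subr_eq0 eq_sym invr_eq1 => h.
  by rewrite subr_eq0.
have vE m : (rho m)^-1 = 1 + v m.
  by rewrite /rho /shear_rho /v; field; rewrite kg1 gt_eqF ?kap_pos.
(* The constant 2 + 2 / g comes from (n+1)(n+2) <= (2 + 2/g)(g + n^2 + 2n): the part 2/g, multiplied
   by g, pays for the constant 2, and the part 2 for the rest. *)
apply: (@line_imaginary R (- (t / b)) (2 + 2 / g) v z).
- move=> m.
  have bC : b%:C != 0 :> R[i] by rewrite eq_complex /= eqxx andbT.
  apply: (mulfI bC); have -> : b%:C * (z (m + 1) - z (m - 1)) = - (b%:C * (z (m - 1) - z (m + 1))) by ring.
  rewrite -zE -fmorphV vE mulrA -[RHS]mulNr; congr (_ * _).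
  by apply: complex_ext; rewrite !ReImE /=; field.
- exact: znull.
- by move=> m; rewrite /v mulrNz sqrrN.
- by rewrite addr_ge0 // divr_ge0 // ltW.
- move=> n; have n0 : (0 : R) <= n%:R := ler0n _ _.
  have e : g + (n.+1%:Z%:~R : R) ^+ 2 - 1 = g + n%:R ^+ 2 + 2 * n%:R.
    by rewrite -pmulrn -natr1; ring.
  have d0 : 0 < g + n%:R ^+ 2 + 2 * n%:R.
    by rewrite -addrA ltr_wpDr // addr_ge0 ?sqr_ge0 // mulr_ge0.
  rewrite /v e invr_gt0 d0 /=.
  have -> : (n.+1%:R : R)^-1 - n.+2%:R^-1 = ((n%:R + 1) * (n%:R + 2))^-1.
    rewrite -!natr1; field.
    by rewrite !gt_eqF ?ltr_wpDl ?addr_ge0.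
  rewrite ler_pdivlMr; last by rewrite mulr_gt0 // ltr_wpDl.
  rewrite mulrC ler_pdivrMr //.
  have h : 2 / g * g = 2 by rewrite divfK // gt_eqF.
  have h2 : 0 <= 2 / g * (n%:R ^+ 2 + 2 * n%:R).
    by rewrite mulr_ge0 ?divr_ge0 ?(ltW g0) // addr_ge0 ?sqr_ge0 // mulr_ge0.
  have lin (x q G : R) : 0 <= x -> q * G = 2 -> 0 <= q * (x ^+ 2 + 2 * x) ->
      0 <= x ^+ 2 -> 0 < G -> (x + 1) * (x + 2) <= (2 + q) * (G + x ^+ 2 + 2 * x) by lra.
  by apply: lin => //; exact: sqr_ge0.
- rewrite /v expr0n addr0; have [lt|gt|e] := ltgtP g 1; last by move: g1; rewrite e eqxx.
    right; have -> : 1 + (g - 1)^-1 = g / (g - 1).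
      by field; rewrite subr_eq0.
    by rewrite pmulr_rlt0 // invr_lt0 subr_lt0.
  by left; rewrite invr_gt0 subr_gt0.
Qed.

(** * Resolvent set and spectrum of the Euler operator on one line *)

Lemma shifted_line (lam : R[i]) (w : coeffs R) m :
  shifted alpha 0 lam w (k1, m) = euler_op b lam rho (fun m => w (k1, m)) m.
Proof. by rewrite /shifted linNS_line /euler_op mul0r mul0r subr0. Qed.

Lemma shifted_supp (nu : R) (lam : R[i]) (w : coeffs R) :
  (forall k, k.1 != k1 -> w k = 0) ->
  forall k, k.1 != k1 -> shifted alpha nu lam w k = 0.
Proof. by move=> w0 k kk; rewrite /shifted (linNS_supp alpha nu w0) // w0 // mulr0 subrr. Qed.

Lemma linNS_shifted (nu : R) (lam : R[i]) (w : coeffs R) :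
  linNS alpha nu w = fun k => 1 * shifted alpha nu lam w k + lam * w k.
Proof. by apply/funext => k; rewrite mul1r subrK. Qed.

Lemma shifted_comb (nu : R) (lam : R[i]) (w : coeffs R) :
  shifted alpha nu lam w = fun k => 1 * linNS alpha nu w k + (- lam) * w k.
Proof. by apply/funext => k; rewrite mul1r mulNr. Qed.

Definition on_line (x : int -> R[i]) : coeffs R :=
  fun k => if k.1 == k1 then x k.2 else 0.

Lemma on_lineE x m : on_line x (k1, m) = x m.
Proof. by rewrite /on_line eqxx. Qed.

Lemma on_line_supp x k : k.1 != k1 -> on_line x k = 0.
Proof. by rewrite /on_line => /negbTE ->. Qed.

Lemma dom_window (N : nat) (x : int -> R[i]) : window_supp N x ->
  dom alpha 0 l khat (on_line x).
Proof.
move=> xN.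
have fin N' y : window_supp N' y -> Hline alpha l khat (on_line y).
  move=> yN; apply/Hline_seq; split; first exact: on_line_supp.
  exists (wsum N' (fun m => W m * nsq (y m))) => K.
  have -> : wsum K (fun m => W m * nsq (on_line y (k1, m))) = wsum K (fun m => W m * nsq (y m)).
    by apply: eq_wsum => m _; rewrite on_lineE.
  have ge0 m : 0 <= W m * nsq (y m) by rewrite mulr_ge0 ?nsq_ge0 // ltW // weight_gt0.
  have [KN|/ltnW NK] := leqP K N'; first exact: wsum_mono.
  rewrite le_eqVlt; apply/orP; left; apply/eqP; apply: wsum_supp NK => m mN.
  by rewrite yN // nsq0 mulr0.
split; first exact: fin xN.
have -> : linNS alpha 0 (on_line x) = on_line (euler_op b 0 rho x).
  apply/funext => -[a m]; have [->|ak] := eqVneq a k1; last first.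
    by rewrite (linNS_supp alpha 0 (@on_line_supp x)) // on_line_supp.
  rewrite on_lineE linNS_line !on_lineE /euler_op mul0r rmorph0 !mul0r //.
exact: fin (euler_op_window _ _ _ xN).
Qed.

(* The value of rho at m = 0 is changed to 1, so that line_op_solve applies;
   this is a rank one perturbation. *)
Lemma off_band_resolvent (lam : R[i]) :
  off_band b lam -> ~ eigenvalues alpha 0 l khat lam ->
  resolvent_set alpha 0 l khat lam.
Proof.
move=> off noneig.
pose r (m : int) : R := if m == 0 then 1 else (rho m)^-1.
pose c := rho 0 - 1.
(* Coupling of site 0 to its two neighbours: replacing [rho 0] by 1 changes the operator by
   [c * z 0] times this vector. *)
pose gv (m : int) : R[i] := b%:C * ((m == 1)%:R - (m == -1)%:R).
have r1 m : 1 <= r m.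
  rewrite /r; case: eqVneq => // m0; have /andP[h1 h2] := rho_lower m0.
  have gp : 0 < g / (g + 1) by rewrite divr_gt0 // addr_gt0.
  by rewrite invf_ge1 ?ltW // (lt_le_trans gp).
pose rM := (g + 1) / g.
have gp : 0 < g + 1 by rewrite addr_gt0.
have rM1 : 1 <= rM by rewrite ler_pdivlMr // mul1r lerDl.
have r_le m : r m <= rM.
  rewrite /r; case: eqVneq => // m0; have /andP[h1 h2] := rho_lower m0.
  have gp' : 0 < g / (g + 1) by rewrite divr_gt0.
  by rewrite /rM -invf_div lef_pV2 ?posrE // (lt_le_trans gp').
pose S (z : int -> R[i]) m := (r m)%:C * z m.
have opE z m : euler_op b lam rho (S z) m = line_op b lam r z m + c%:C * z 0 * gv m.
  have rr m' : (rho m')%:C * S z m' = z m' + (if m' == 0 then c%:C * z 0 else 0).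
    rewrite /S /r; case: eqVneq => [->|m0].
      by rewrite /c (_ : (rho 0)%:C = 1 + (rho 0 - 1)%:C) ?mul1r ?mulrDl ?mul1r // -[1 in RHS]/(1%:C) -rmorphD subrKC.
    by rewrite addr0 mulrA -rmorphM /= mulfV ?rho_neq0 // (_ : 1%:C = 1) // mul1r.
  rewrite /euler_op !rr /line_op /gv /S subr_eq0 addr_eq0.
  case: eqP => _; case: eqP => _ /=; ring.
have [K [K0 solve]] := line_op_solve l (ltW g0) off.
have gvF : exists Fg, forall N, wsum N (fun m => W m * nsq (gv m)) <= Fg.
  exists (wsum 2 (fun m => W m * nsq (gv m))) => N.
  have ge0 m : 0 <= W m * nsq (gv m) by rewrite mulr_ge0 ?nsq_ge0 // ltW // weight_gt0.
  have [N2|/ltnW N2] := leqP N 2; first exact: wsum_mono.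
  rewrite le_eqVlt; apply/orP; left; apply/eqP; apply: wsum_supp N2 => m m2.
  have -> : gv m = 0; last by rewrite nsq0 mulr0.
  rewrite /gv; have [e|_] := eqVneq m 1; first by rewrite e in m2.
  have [e|_] := eqVneq m (-1); first by rewrite e in m2.
  by rewrite subrr mulr0.
have [Fg gvFg] := gvF.
have [v [vE vK]] := solve r gv Fg r1 gvFg.
have SW z m : W m * nsq (S z m) <= rM ^+ 2 * (W m * nsq (z m)).
  rewrite /S nsqM nsqC mulrCA ler_wpM2r //.
    by rewrite mulr_ge0 ?nsq_ge0 // ltW // weight_gt0.
  by rewrite lerXn2r ?nnegrE // (le_trans ler01).
have Sbnd z M N : wsum N (fun m => W m * nsq (z m)) <= M ->
    wsum N (fun m => W m * nsq (S z m)) <= rM ^+ 2 * M.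
  move=> zM; rewrite (le_trans (ler_wsum (fun m _ => SW z m))) // wsumZ.
  by rewrite ler_wpM2l // sqr_ge0.
(* Denominator of the rank one inversion formula. If it vanished, [S v] would be an
   eigenfunction. *)
pose den := 1 + c%:C * v 0.
have den0 : den != 0.
  apply/eqP => d0; apply: noneig; exists (on_line (S v)).
  have v0 : v 0 != 0.
    apply/eqP => v0; move/eqP: d0; rewrite /den v0 mulr0 addr0; apply/negP.
    exact: oner_neq0.
  apply: eigenfunction_intro.
  - apply/Hline_seq; split; first exact: on_line_supp.
    exists (rM ^+ 2 * (K * Fg)) => N.
    rewrite (@eq_wsum _ _ _ (fun m => W m * nsq (S v m))); first exact: Sbnd.
    by move=> m _; rewrite on_lineE.
  - by exists (k1, 0); rewrite on_lineE /S /r eqxx (_ : 1%:C = 1) // mul1r.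
  - move=> [a m]; have [->|ak] := eqVneq a k1; last first.
      by rewrite (linNS_supp alpha 0 (@on_line_supp _)) // on_line_supp // mulr0.
    apply/eqP; rewrite -subr_eq0 -/(shifted alpha 0 lam _ _) shifted_line.
    have -> : (fun m => on_line (S v) (k1, m)) = S v by apply/funext => m'; rewrite on_lineE.
    by rewrite opE vE -[X in X + _]mul1r -mulrDl -/den d0 mul0r.
have kFg : 0 <= K * Fg.
  rewrite mulr_ge0 ?(ltW K0) // (le_trans _ (gvFg 0%N)) // wsum0 //.
pose T := nsq (c%:C / den).
have T0 : 0 <= T := nsq_ge0 _.
pose M := rM ^+ 2 * (2 * (K + T * K * (K * Fg))).
have M0 : 0 <= M.
  rewrite mulr_ge0 ?sqr_ge0 // mulr_ge0 // addr_ge0 ?(ltW K0) // mulr_ge0 //.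
  by rewrite mulr_ge0 // ltW.
exists M => f fH; have [f0 _] := proj1 (Hline_seq f) fH.
pose F := fine (Hnorm2 alpha l f).
have fE : Hnorm2 alpha l f = F%:E.
  by rewrite fineK // ge0_fin_numE ?Hnorm2_ge0 //; case: fH.
have fF : forall N, wsum N (fun m => W m * nsq (f (k1, m))) <= F.
  by apply: (proj1 (@Hnorm2_le R alpha l k1 f F f0)); rewrite fE.
clearbody F.
have [u [uE uK]] := solve r (fun m => f (k1, m)) F r1 fF.
(* For z = u - tau v this choice gives c z 0 = tau, so the rank one term cancels the right-hand side
   - tau gv. *)
pose tau := c%:C / den * u 0.
pose zz m := 1 * u m + (- tau) * v m.
pose w := on_line (S zz).
have wE : shifted alpha 0 lam w = f.
  apply/funext => -[a m]; have [->|ak] := eqVneq a k1; last first.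
    by rewrite (shifted_supp 0 lam (@on_line_supp _)) // f0.
  rewrite shifted_line (_ : (fun m => w (k1, m)) = S zz); last first.
    by apply/funext => m'; rewrite /w on_lineE.
  rewrite opE.
  have -> : line_op b lam r zz m = line_op b lam r u m - tau * line_op b lam r v m.
    by rewrite /line_op /zz; ring.
  rewrite uE vE /zz mul1r.
  have e : c%:C * (u 0 + - tau * v 0) = tau.
    by rewrite /tau; move: den0; rewrite /den => h; field.
  by rewrite e subrK.
have u00 : nsq (u 0) <= K * F.
  rewrite (le_trans _ (uK 1%N)) //.
  apply: le_trans (wsum_term (m := 0) (N := 1) _ _) => //=.
    by rewrite ler_peMl ?nsq_ge0 // weight_ge1.
  by move=> m; rewrite mulr_ge0 ?nsq_ge0 // ltW // weight_gt0.
have zbnd N : wsum N (fun m => W m * nsq (zz m)) <= 2 * (K + T * K * (K * Fg)) * F.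
  have n1 : nsq (1 : R[i]) = 1 by rewrite nsqC expr1n.
  apply: (le_trans (weighted_comb 1 (- tau) (uK N) (vK N))).
  rewrite n1 nsqN /tau nsqM -/T.
  have : T * nsq (u 0) * (K * Fg) <= T * (K * F) * (K * Fg).
    by apply: ler_wpM2r => //; exact: ler_wpM2l.
  by lra.
have wM N : wsum N (fun m => W m * nsq (w (k1, m))) <= M * F.
  rewrite (@eq_wsum _ _ _ (fun m => W m * nsq (S zz m))); last first.
    by move=> m _; rewrite /w on_lineE.
  by rewrite /M -mulrA; exact: Sbnd.
have wH : Hline alpha l khat w.
  by apply/Hline_seq; split; [exact: on_line_supp|exists (M * F)].
exists w; split=> //.
- split=> //; rewrite (linNS_shifted 0 lam w) wE; exact: Hline_comb.
- move=> w' [w'H _] w'E; apply/funext => k; apply/eqP; rewrite -subr_eq0.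
  apply/negPn/negP => kn0; apply: noneig.
  exists (fun k => 1 * w' k + (-1) * w k); apply: eigenfunction_intro.
  + exact: Hline_comb.
  + by exists k; rewrite mul1r mulN1r.
  + move=> j; have e1 : shifted alpha 0 lam w' j = shifted alpha 0 lam w j by rewrite w'E wE.
    have -> : linNS alpha 0 (fun k => 1 * w' k + (-1) * w k) j =
        linNS alpha 0 w' j - linNS alpha 0 w j by rewrite /linNS; ring.
    move: e1; rewrite /shifted => /eqP; rewrite subr_eq => /eqP ->; ring.
- rewrite fE -EFinM; apply: (proj2 (@Hnorm2_le R alpha l k1 w _ (@on_line_supp _))).
  exact: wM.
Qed.

Lemma resolvent_bounded_below (nu : R) (lam : R[i]) :
  resolvent_set alpha nu l khat lam ->
  exists M : R, forall w, dom alpha nu l khat w ->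
    (Hnorm2 alpha l w <= M%:E * Hnorm2 alpha l (shifted alpha nu lam w))%E.
Proof.
move=> [M res]; exists M => w wd.
have fH : Hline alpha l khat (shifted alpha nu lam w).
  by rewrite shifted_comb; case: wd => *; exact: Hline_comb.
by have [w' [_ _ uniq]] := res _ fH; rewrite -(uniq w wd erefl).
Qed.

Lemma band_not_bounded_below (t : R) : `|t| <= 2 * `|b| ->
  ~ exists M : R, forall w, dom alpha 0 l khat w ->
    (Hnorm2 alpha l w <= M%:E * Hnorm2 alpha l (shifted alpha 0 (t *i) w))%E.
Proof.
move=> tb [M bnd].
(* [M] may be negative, hence the maximum with 0. *)
have [w [N [X [Y [wN opX Yw lt]]]]] := weyl_sequence (Num.max M 0) l (ltW g0) amplitude_neq0 tb.
have /bnd := dom_window wN.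
have sE : shifted alpha 0 (t *i) (on_line w) = on_line (euler_op b (t *i) rho w).
  apply/funext => -[a m]; have [->|ak] := eqVneq a k1; last first.
    by rewrite (shifted_supp 0 _ (@on_line_supp w)) // on_line_supp.
  rewrite on_lineE shifted_line; congr euler_op.
  by apply/funext => m'; rewrite on_lineE.
have n1 : (Hnorm2 alpha l (shifted alpha 0 (t *i) (on_line w)) <= X%:E)%E.
  rewrite sE; apply: (proj2 (@Hnorm2_le R alpha l k1 _ _ (@on_line_supp _))) => N'.
  by rewrite (@eq_wsum _ _ _ (fun m => W m * nsq (euler_op b (t *i) rho w m))) // => m _; rewrite on_lineE.
set h := Hnorm2 _ _ (shifted _ _ _ _) in n1 *.
have h0 : (0 <= h)%E := Hnorm2_ge0 _ _ _.
have hE : h = (fine h)%:E.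
  by rewrite fineK // ge0_fin_numE // (le_lt_trans n1) // ltry.
have fh0 : 0 <= fine h by rewrite -lee_fin -hE.
have fhX : fine h <= X by rewrite -lee_fin -hE.
have X0 := le_trans fh0 fhX.
rewrite hE -EFinM => /(proj1 (@Hnorm2_le R alpha l k1 _ _ (@on_line_supp w)))/(_ N).
rewrite (@eq_wsum _ _ _ (fun m => W m * nsq (w m))); last by move=> m _; rewrite on_lineE.
move=> /(le_trans Yw) YM; move: lt; apply/negP; rewrite -leNgt (le_trans YM) //.
apply: (@le_trans _ _ (Num.max M 0 * fine h)).
  by rewrite ler_wpM2r // le_max lexx.
by rewrite ler_wpM2l // le_max lexx orbT.
Qed.

Lemma imaginary_not_eigenvalue (t : R) : ~ eigenvalues alpha 0 l khat (t *i).
Proof.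
move=> [w /eigenfunction_seq[znull [m zm] zE]]; move/eqP: zm; apply.
apply: (no_imaginary (t := t) znull) => j; rewrite -zE.
by rewrite mul0r (_ : 0%:C = 0) // addr0.
Qed.

(** The approximants have finite support, so they lie in the domain for every [l] although the
    approximation is in the L^2 norm. *)
Lemma dense_range (t : R) (f : coeffs R) : Hline alpha 0 khat f ->
  forall eps : R, 0 < eps ->
  exists2 w, dom alpha 0 l khat w &
    (Hnorm2 alpha 0 (fun k => shifted alpha 0 (t *i) w k - f k)%R < eps%:E)%E.
Proof.
move=> [f0' _ /Hnorm2_fin[F fF]] eps eps0.
have f0 k : k.1 != k1 -> f k = 0.
  by move=> kk; apply: f0' => /lineE/eqP kk'; rewrite kk' in kk.
have {}fF := proj1 (@Hnorm2_le R alpha 0 k1 f F f0) fF.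
have W0 m : sobolev_weight ((alpha * k1%:~R) ^+ 2) 0 m = 1 by [].
have e2 : 0 < eps / 2 by rewrite divr_gt0.
have [] := @euler_range_dense R b (t *i) rho (1 + g^-1) F (fun m => f (k1, m)) (eps / 2) rho_bound _ _ e2.
(* For imaginary [lam] the adjoint equation, divided by [rho m], is the eigenvalue equation
   satisfied by rho w, so the same uniqueness applies to [z]. *)
- move=> z znull zE; apply: (no_imaginary (t := t) znull) => m.
  have rC : (rho m)%:C != 0 :> R[i] by rewrite eq_complex /= eqxx andbT rho_neq0.
  have := zE m; rewrite /euler_adj.
  have -> : (t *i)^* = - (t *i) by apply: complex_ext; rewrite !ReImE /= ?oppr0.
  move=> h; apply: (mulfI rC); rewrite mulrA mulrCA divff // mulr1.
  move/eqP: h; rewrite mulNr opprK addrC addr_eq0 => /eqP ->; ring.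
- by move=> N; have := fF N; under eq_wsum do rewrite W0 mul1r.
move=> N [w [wN wE]]; exists (on_line w); first exact: dom_window wN.
apply: (@le_lt_trans _ _ (eps / 2)%:E); last by rewrite lte_fin; lra.
apply: (proj2 (@Hnorm2_le R alpha 0 k1 _ _ _)) => [k kk|N'].
  by rewrite (shifted_supp 0 _ (@on_line_supp w)) // f0 // subr0.
rewrite (le_trans _ (wE N')) // le_eqVlt; apply/orP; left; apply/eqP.
apply: eq_wsum => m _; rewrite W0 mul1r shifted_line; congr (nsq (euler_op _ _ _ _ _ - _)).
by apply/funext => m'; rewrite on_lineE.
Qed.

Lemma segmentE : 2 * `|b| = alpha * `|k1|%:~R / 2 -> forall lam : R[i],
  imag_segment (alpha * `|k1|%:~R / 2) lam <-> ~ off_band b lam.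
Proof.
move=> bE lam; rewrite -bE; split=> [[t] /=|].
  rewrite in_itv /= => /andP[t1 t2] <- [] /=; first by rewrite eqxx.
  by rewrite ltNge ler_norml t1 t2.
case: lam => x y h; exists y => /=.
  rewrite in_itv /= -ler_norml leNgt; apply/negP => h2; apply: h; by right.
by congr (_ +i* _); apply/eqP; rewrite eq_sym; apply/negPn/negP => h2; apply: h; left.
Qed.

Hypothesis al0 : 0 < alpha.

Lemma amplitude_norm : 2 * `|b| = alpha * `|k1|%:~R / 2.
Proof.
by rewrite /b !normrM gtr0_norm // normfV (ger0_norm (ler0n R 4)) intr_norm; field.
Qed.

Lemma euler_spectrum : spectrum alpha 0 l khat =
  imag_segment (alpha * `|k1|%:~R / 2) `|`
  [set lam | off_band b lam /\ eigenvalues alpha 0 l khat lam].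
Proof.
apply/seteqP; split=> lam /=.
  move=> nres; have [off|on] := pselect (off_band b lam); last first.
    by left; apply/(segmentE amplitude_norm).
  right; split=> //; apply: contrapT => ne; exact/nres/off_band_resolvent.
move=> [[t]|[_ Elam]] /=; last exact: spectrum_eigenvalue.
rewrite in_itv /= -ler_norml -amplitude_norm => tb <- /resolvent_bounded_below.
exact: band_not_bounded_below.
Qed.

Lemma euler_continuous_spectrum :
  continuous_spectrum alpha 0 l khat = imag_segment (alpha * `|k1|%:~R / 2).
Proof.
apply/seteqP; split=> lam /=.
  move=> [ne _ nb]; apply/(segmentE amplitude_norm) => off; apply: nb.
  exact/resolvent_bounded_below/off_band_resolvent.
move=> [t] /=; rewrite in_itv /= -ler_norml -amplitude_norm => tb <-; split.
- exact: imaginary_not_eigenvalue.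
- exact: dense_range.
- exact: band_not_bounded_below.
Qed.
End Line.

(** * The unstable line *)

(** Adapted to [cf_mul_le], which gives decay only over two consecutive ratios. *)
Lemma sum_two_step_le (R : realType) (q : nat -> R) (theta : R) (N : nat) :
  (forall n, 0 <= q n) -> theta < 1 -> (forall n, q n.+2 <= theta * q n) ->
  \sum_(n < N) q n <= (q 0%N + q 1%N) / (1 - theta).
Proof.
move=> q0 th step.
have mono : \sum_(n < N) q n <= \sum_(n < N.+2) q n.
  by rewrite !big_ord_recr /= -addrA lerDl addr_ge0.
have geom : \sum_(n < N.+2) q n <= q 0%N + q 1%N + theta * \sum_(n < N) q n.
  rewrite !big_ord_recl /= addrA lerD2l mulr_sumr.
  by apply: ler_sum => n _; exact: step.
have lin (S T Q th' : R) : S <= T -> T <= Q + th' * S -> S * (1 - th') <= Q by lra.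
by rewrite ler_pdivlMr ?subr_gt0 //; exact: lin mono geom.
Qed.

Definition shear_coef (R : realType) (alpha nu : R) (lam : R[i]) (m : int) : R[i] :=
  (lam + (nu * (alpha ^+ 2 + m%:~R ^+ 2))%:C) *
  ((alpha / 4 * (1 - (alpha ^+ 2 + m%:~R ^+ 2)^-1))^-1)%:C.

Definition alternating (R : realType) (m : int) : R[i] := (-1) ^+ absz m.

Lemma alternating_succ (R : realType) (m : int) :
  alternating R (m + 1) = - alternating R m.
Proof.
have e n : (-1) ^+ n.+1 = - (-1) ^+ n :> R[i] by rewrite exprS mulN1r.
rewrite /alternating; case: m => [n|n].
  by rewrite -PoszD addn1 /= e.
have -> : Negz n + 1 = - n%:Z by lia.
by rewrite abszN /= e opprK.
Qed.

Lemma nsq_alternating (R : realType) (m : int) : nsq (alternating R m) = 1.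
Proof.
rewrite /alternating; elim: (absz m) => [|n IH]; first by rewrite nsqC expr1n.
by rewrite exprS nsqM IH mulr1 nsqN nsqC expr1n.
Qed.

(* Multiplication by (-1)^m on the line (a shift by pi in x_2) anticommutes
   with the linear Euler operator. *)
Lemma euler_eigenvalue_opp (R : realType) (alpha : R) (l : nat) (khat : freq)
    (g0 : 0 < (alpha * khat.1%:~R) ^+ 2) (lam : R[i]) :
  eigenvalues alpha 0 l khat lam -> eigenvalues alpha 0 l khat (- lam).
Proof.
move=> [w [[/(Hline_seq l g0)[w0 [M wM]] _] [[a m] wk] wE]].
exists (fun k => alternating R k.2 * w k); apply: (eigenfunction_intro g0).
- apply/(Hline_seq l g0); split=> [k kk|]; first by rewrite w0 // mulr0.
  exists M => N; rewrite (le_trans _ (wM N)) // le_eqVlt; apply/orP; left.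
  by apply/eqP/eq_wsum => j _; rewrite nsqM nsq_alternating mul1r.
- exists (a, m); rewrite mulf_neq0 // -nsq_eq0 nsq_alternating; exact: oner_neq0.
- move=> [c j]; have := wE (c, j); rewrite !linNS_line /= alternating_succ.
  have -> : alternating R (j - 1) = - alternating R j.
    by rewrite -[in RHS](subrK 1 j) alternating_succ opprK.
  rewrite !mul0r !subr0 => e.
  transitivity (- alternating R j * (lam * w (c, j))); last by ring.
  by rewrite -e; ring.
Qed.

Lemma intSD1 (n : nat) : n%:Z + 1 = n.+1%:Z.
Proof. by lia. Qed.

Lemma intSB1 (n : nat) : n.+1%:Z - 1 = n%:Z.
Proof. by lia. Qed.

Lemma NegzD1 (n : nat) : Negz n + 1 = - n%:Z.
Proof. by lia. Qed.

Lemma NegzB1 (n : nat) : Negz n - 1 = - n.+2%:Z.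
Proof. by lia. Qed.

Section ShearLine.
Variables (R : realType) (alpha : R) (l : nat).
Hypotheses (alpha_gt : 1 / 2 < alpha) (alpha_lt : alpha < 1).

Let khat : freq := (-1, 0).
Let alpha0 : 0 < alpha := alpha_gt0 alpha_gt.
Let a2 := alpha2_bounds alpha_gt alpha_lt.

Lemma shear_gE : (alpha * khat.1%:~R) ^+ 2 = alpha ^+ 2.
Proof. by rewrite /= mulrN1z mulrN mulr1 sqrrN. Qed.

Lemma shear_bE : alpha * khat.1%:~R / 4 = - (alpha / 4).
Proof. by rewrite /= mulrN1z mulrN mulr1 mulNr. Qed.

Lemma shear_g0 : 0 < (alpha * khat.1%:~R) ^+ 2.
Proof. by rewrite shear_gE; case/andP: a2 => + _; apply: lt_trans; lra. Qed.

Lemma shear_g1 : (alpha * khat.1%:~R) ^+ 2 != 1.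
Proof. by rewrite shear_gE lt_eqF //; case/andP: a2. Qed.

Let g0 := shear_g0.
Let g1 := shear_g1.
Let den (m : int) : R := alpha / 4 * (1 - (alpha ^+ 2 + m%:~R ^+ 2)^-1).

Lemma shear_den_neg : den 0 < 0.
Proof.
case/andP: a2; rewrite /den expr0n addr0; set x := alpha ^+ 2 => x1 x2.
have x0 : 0 < x by apply: lt_trans x1; lra.
by rewrite pmulr_rlt0 ?divr_gt0 // subr_lt0 invf_gt1.
Qed.

Lemma shear_den_gt0 n : 0 < den n.+1%:Z.
Proof. exact: coef_den_gt0. Qed.

Lemma shear_den_opp m : den (- m) = den m.
Proof. by rewrite /den mulrNz sqrrN. Qed.

Lemma shear_den_neq0 m : den m != 0.
Proof.
case: m => [[|n]|n]; first by rewrite lt_eqF // shear_den_neg.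
  by rewrite gt_eqF // shear_den_gt0.
by rewrite NegzE shear_den_opp gt_eqF // shear_den_gt0.
Qed.

Lemma shear_coefE (nu : R) (lam : R[i]) m :
  (lam + (nu * ((alpha * khat.1%:~R) ^+ 2 + m%:~R ^+ 2))%:C) /
    (shear_rho ((alpha * khat.1%:~R) ^+ 2) m)%:C =
  (alpha / 4)%:C * shear_coef alpha nu lam m.
Proof.
rewrite shear_gE /shear_coef -fmorphV mulrCA -rmorphM /=; congr (_ * _%:C).
rewrite invfM mulrA divff ?mul1r //.
by rewrite gt_eqF // divr_gt0.
Qed.

Lemma shear_eigenvalue_line (nu : R) (lam : R[i]) :
  eigenvalues alpha nu l khat lam ->
  exists z, [/\ line_eq (shear_coef alpha nu lam) z, null_line z & exists m, z m != 0].
Proof.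
move=> [w /(eigenfunction_seq g0 g1)[]]; set z := fun m => _ => znull zn0 zE.
have {}zE m : (alpha / 4)%:C * shear_coef alpha nu lam m * z m =
    - (alpha / 4)%:C * (z (m - 1) - z (m + 1)).
  by rewrite -shear_coefE -[- _]rmorphN -shear_bE; exact: zE.
have aC : (alpha / 4)%:C != 0 :> R[i].
  by rewrite eq_complex /= eqxx andbT gt_eqF // divr_gt0.
by exists z; split=> // m; apply: (mulfI aC); rewrite mulrA zE; ring.
Qed.

Lemma ImJ_prod (mu : R[i]) (k c h : R) :
  complex.Im ((mu + k%:C) * c%:C * (mu + h%:C)^*) = c * complex.Im mu * (h - k).
Proof. by rewrite !ReImE /=; ring. Qed.

Lemma Im_prod (mu : R[i]) (k c h : R) :
  complex.Im ((mu + k%:C) * c%:C * (mu + h%:C)) =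
  c * complex.Im mu * (2 * complex.Re mu + k + h).
Proof. by rewrite !ReImE /=; ring. Qed.

(** Apply [line_cone] with u = mu + nu alpha^2, the numerator at m = 0: the others are u + nu m^2,
    which lie in the cone of u when Re mu >= 0 and Im mu > 0. Conjugating the solution reduces a
    negative imaginary part to this case. *)
Lemma shear_eigenvalue_real (nu : R) (lam : R[i]) :
  0 <= nu -> 0 <= complex.Re lam -> 0 < complex.Re lam + nu ->
  eigenvalues alpha nu l khat lam -> complex.Im lam = 0.
Proof.
move=> nu0 re0 s0.
have a20 : 0 < alpha ^+ 2 by rewrite exprn_gt0.
have t0 := shear_sum_gt0 alpha_gt alpha_lt nu0 re0 s0.
have upper (mu : R[i]) z : complex.Re mu = complex.Re lam -> 0 < complex.Im mu ->
    line_eq (shear_coef alpha nu mu) z -> null_line z -> forall m, z m = 0.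
  move=> reE im0 zE znull.
  apply: (@line_cone R _ z (mu + (nu * alpha ^+ 2)%:C) (- (den 0)^-1) zE znull).
  - by move=> m; rewrite /shear_coef mulrNz sqrrN.
  - by rewrite oppr_gt0 invr_lt0 shear_den_neg.
  - by rewrite eq_complex ReD ImD /= addr0 negb_and orbC gt_eqF.
  - by rewrite /shear_coef -/(den 0) expr0n addr0 rmorphN; ring.
  - move=> n; rewrite /shear_coef -/(den n.+1%:Z) ImJ_prod.
    have c0 := shear_den_gt0 n; rewrite -invr_gt0 in c0.
    rewrite mulr_ge0_le0 ?(ltW (mulr_gt0 c0 im0)) //.
    by rewrite -mulrBr mulr_ge0_le0 // opprD addNKr oppr_le0 sqr_ge0.
  - move=> n; rewrite /shear_coef -/(den n.+1%:Z) Im_prod reE.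
    have c0 := shear_den_gt0 n; rewrite -invr_gt0 in c0.
    rewrite (mulr_gt0 (mulr_gt0 c0 im0)) //.
    have : 0 <= nu * n.+1%:~R ^+ 2 by rewrite mulr_ge0 // sqr_ge0.
    by rewrite [nu * (_ + _)]mulrDr; lra.
move=> /shear_eigenvalue_line[z [zE znull [m zm]]].
have [im|im|//] := ltgtP (complex.Im lam) 0.
- suff : (z m)^* = 0 by move=> /(congr1 Num.conj); rewrite conjCK conjC0 => e; rewrite e eqxx in zm.
  apply: (upper (lam^*) (fun m => (z m)^*)).
  + by rewrite ReJ.
  + by rewrite ImJ oppr_gt0.
  + move=> j; rewrite -rmorphB -zE rmorphM; congr (_ * _).
    by rewrite /shear_coef; apply: complex_ext; rewrite !ReImE /= ?ReImE /=; ring.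
  + case: znull => z1 z2; split; [apply: cvg_ext z1|apply: cvg_ext z2] => n; by rewrite nsqJ.
- by rewrite (upper lam z _ _ zE znull) // eqxx in zm.
Qed.

Lemma shear_eigenvalue_dispersion (nu x : R) : 0 <= nu -> 0 <= x -> 0 < x + nu ->
  eigenvalues alpha nu l khat x%:C -> dispersion alpha nu x (neutral_level alpha).
Proof.
move=> nu0 x0 s0 /shear_eigenvalue_line[z [zE znull [m zm]]].
have [delta d0 [dd _]] := right_coef_delta alpha_gt alpha_lt nu0 x0 s0 nu0 x0 s0.
have dE : shear_coef alpha nu x%:C = fun m => (dcoef alpha nu x m)%:C.
  by apply/funext => j; rewrite /shear_coef -rmorphD -rmorphM.
rewrite dE in zE.
have [|zz|[s [sol s00]]] := line_real zE znull _ d0 dd; last 2 first.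
- by rewrite zz eqxx in zm.
- exists s; split=> //; move: s00; rewrite /dcoef -/(den 0) expr0n addr0 => e.
  have -> : x + nu * alpha ^+ 2 = - (2 * s 0%N) * den 0.
    by rewrite -e divfK // shear_den_neq0.
  by rewrite /neutral_level /den expr0n addr0; field; rewrite gt_eqF.
- by move=> j; rewrite /dcoef mulrNz sqrrN.
Qed.

(** The eigenfunction is built from partial products of [s], whose decay over two steps beats the
    growth of any Sobolev weight. *)
Lemma dispersion_shear_eigenvalue (nu x : R) : 0 <= nu -> 0 <= x -> 0 < x + nu ->
  dispersion alpha nu x (neutral_level alpha) -> eigenvalues alpha nu l khat x%:C.
Proof.
move=> nu0 x0 s0 [s [sol s00]].
have [delta d0 [dd _]] := right_coef_delta alpha_gt alpha_lt nu0 x0 s0 nu0 x0 s0.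
pose P n := \prod_(j < n) s j.
have PS n : P n.+1 = P n * s n by rewrite /P big_ord_recr.
have P0 : P 0%N = 1 by rewrite /P big_ord0.
have Ppos n : 0 < P n by apply: prodr_gt0 => j _; exact: cf_gt0 sol.
(* On the right the ratios are - s n; on the left the alternating sign of [left_half] cancels this
   minus. *)
pose zr (m : int) : R := if m is Posz n then (-1) ^+ n * P n else P (absz m).
pose z (m : int) : R[i] := (zr m)%:C.
have zrN n : zr (- n%:Z) = P n by case: n => [|n]; rewrite /zr /= ?mul1r.
have lineR m : dcoef alpha nu x m * zr m = zr (m + 1) - zr (m - 1).
  have rc n : s n * (right_coef alpha nu x n + s n.+1) = 1 by case: (sol n).
  case: m => [[|n]|n].
  - have -> : zr (0 - 1) = P 1 by rewrite sub0r (zrN 1%N).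
    have e : neutral_level alpha = - 2 * den 0.
      by rewrite /neutral_level /den expr0n addr0; field; rewrite gt_eqF.
    have -> : dcoef alpha nu x 0 = - 2 * s 0%N.
      rewrite /dcoef -/(den 0) expr0n addr0 -s00 e; field.
      exact: shear_den_neq0.
    have z0 : zr 0 = 1 by rewrite -[zr 0]/((-1) ^+ 0 * P 0%N) P0 mulr1 expr0.
    have z1 : zr 1 = - s 0%N.
      by rewrite -[zr 1]/((-1) ^+ 1 * P 1%N) expr1 PS P0 mul1r mulN1r.
    by rewrite add0r z0 z1 PS P0; ring.
  - rewrite intSD1 intSB1 /zr -/(right_coef alpha nu x n) !exprS !PS.
    have := rc n; move: (right_coef _ _ _ _) (s n) (s n.+1) => d u v e.
    transitivity ((-1) ^+ n * P n * (u * v - u * (d + v))); first by ring.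
    by rewrite e; ring.
  - have -> : dcoef alpha nu x (Negz n) = right_coef alpha nu x n.
      by rewrite NegzE /right_coef /dcoef mulrNz sqrrN.
    rewrite NegzD1 NegzB1 NegzE !zrN !PS.
    have := rc n; move: (right_coef _ _ _ _) (s n) (s n.+1) => d u v e.
    transitivity (P n * (u * (d + v) - u * v)); first by ring.
    by rewrite e; ring.
pose th := (1 + delta ^+ 2)^-1.
have th1 : th < 1 by rewrite invf_lt1 ?ltrDl ?exprn_gt0 // addr_gt0 // exprn_gt0.
have th0 : 0 < th by rewrite invr_gt0 addr_gt0 // exprn_gt0.
(* Two steps multiply the squared products by at most th^2 and the weight by at most (1 + eta)^2 <=
   1 / th, which leaves a net factor th. *)
have [eta eta0 etath] : exists2 eta : R, 0 < eta & (1 + eta) ^+ 2 <= th^-1.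
  have d2 : 0 < delta ^+ 2 by rewrite exprn_gt0.
  by have [e e0 he] := expr_one_small 2 d2; exists e => //; rewrite /th invrK.
have a20 : 0 <= alpha ^+ 2 by exact: sqr_ge0.
have [c [c1 slow]] := sobolev_weight_slow l a20 eta0.
pose V (m : int) := (c + (alpha ^+ 2 + m%:~R ^+ 2)) ^+ l.
pose q n := V n%:Z * P n ^+ 2.
have Vpos m : 0 < V m by case: (slow m).
have q0 n : 0 <= q n by rewrite mulr_ge0 ?sqr_ge0 // ltW.
have qstep n : q n.+2 <= th * q n.
  rewrite /q !PS.
  have V2 : V n.+2%:Z <= (1 + eta) ^+ 2 * V n%:Z.
    have [_ h1 _] := slow n%:Z; have [_ h2 _] := slow n.+1%:Z.
    rewrite intSD1 in h1; rewrite intSD1 in h2; rewrite (le_trans h2) // expr2 -mulrA.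
    by rewrite ler_wpM2l // addr_ge0 // ltW.
  have ss : (s n * s n.+1) ^+ 2 <= th ^+ 2.
    rewrite lerXn2r ?nnegrE ?(ltW th0) ?(cf_mul_le _ d0 dd sol) //.
    by rewrite mulr_ge0 // ltW // (cf_gt0 _ sol).
  have V2' : V n.+2%:Z <= th^-1 * V n%:Z.
    by rewrite (le_trans V2) // ler_wpM2r // ltW.
  have -> : (P n * s n * s n.+1) ^+ 2 = (s n * s n.+1) ^+ 2 * P n ^+ 2 by ring.
  have -> : th * (V n%:Z * P n ^+ 2) = (th^-1 * V n%:Z) * (th ^+ 2 * P n ^+ 2).
    by field; rewrite gt_eqF.
  apply: ler_pM; [exact: ltW (Vpos _)| |exact: V2'|].
    by apply: mulr_ge0; exact: sqr_ge0.
  by apply: ler_wpM2r => //; exact: sqr_ge0.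
have sumq N := sum_two_step_le N q0 th1 qstep.
have nz n : nsq (z n%:Z) = P n ^+ 2.
  by rewrite nsqC /zr exprMn sqrr_sign mul1r.
have nzN n : nsq (z (- n%:Z)) = P n ^+ 2 by rewrite nsqC zrN.
have VN n : V (- n%:Z) = V n%:Z by rewrite /V mulrNz sqrrN.
pose K := (q 0%N + q 1%N) / (1 - th).
apply: (@eigenvalue_seq R alpha khat l g0 g1 nu x%:C z (K + K)).
- move=> N; rewrite shear_gE.
  have le1 m : sobolev_weight (alpha ^+ 2) l m * nsq (z m) <= V m * nsq (z m).
    rewrite ler_wpM2r ?nsq_ge0 //.
    by have [_ /andP[]] := sobolev_weight_equiv l m a20 c1.
  rewrite (le_trans (ler_wsum (fun m _ => le1 m))) // /wsum big_split /=.
  apply: lerD.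
    rewrite (eq_bigr (fun n : 'I_N => q n)); first exact: sumq.
    by move=> n _; rewrite nz.
  rewrite (eq_bigr (fun n : 'I_N => q n.+1)); last by move=> n _; rewrite nzN VN.
  by rewrite (le_trans _ (sumq N.+1)) // big_ord_recl lerDr.
- by exists 0; rewrite /z (etrans (zrN 0%N) P0); exact: oner_neq0.
- move=> m; rewrite shear_coefE shear_bE -mulrA.
  have -> : shear_coef alpha nu x%:C m * z m = z (m + 1) - z (m - 1).
    rewrite /z -rmorphB -lineR /shear_coef -rmorphD -!rmorphM //.
  by rewrite rmorphN; ring.
Qed.

(** * Critical viscosity and the unstable branch *)

Let E nu := eigenvalues alpha nu l khat.
Let neutral := neutral_level alpha.

Lemma shear_unstable_dispersion (nu : R) (mu : R[i]) :
  0 <= nu -> 0 <= complex.Re mu -> 0 < complex.Re mu + nu -> E nu mu ->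
  mu = (complex.Re mu)%:C /\ dispersion alpha nu (complex.Re mu) neutral.
Proof.
move=> nu0 re0 s0 Emu; have im0 := shear_eigenvalue_real nu0 re0 s0 Emu.
have e : mu = (complex.Re mu)%:C by apply: complex_ext.
by split=> //; apply: shear_eigenvalue_dispersion => //; rewrite -e.
Qed.

(** Eigenvalues with nonnegative real part are exactly the real roots lam >= 0 of the dispersion
    relation. For nu > nus every such lam has [F] above the neutral level; for nu < nus a root
    exists and monotonicity in [lam] makes it unique. *)
Lemma dispersion_critical (nus : R) : 0 < nus -> dispersion alpha nus 0 neutral ->
  critical_viscosity alpha l khat nus.
Proof.
move=> nus0 dnus nu nu0 Enu.
have unstable mu : Enu mu -> 0 <= complex.Re mu ->
    mu = (complex.Re mu)%:C /\ dispersion alpha nu (complex.Re mu) neutral.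
  by move=> Emu re0; apply: shear_unstable_dispersion => //; rewrite ?ltW // ltr_wpDl.
split.
- move=> lt mu Emu; rewrite ltNge; apply/negP => re0.
  have [_ dmu] := unstable mu Emu re0.
  have := dispersion_nu_lt alpha_gt alpha_lt nus0 lt (lexx 0) re0 _ dnus dmu.
  by rewrite mul0r divr_ge0 ?(ltW nu0) // ltxx => /(_ isT).
- move=> e; split.
    have d : dispersion alpha nu 0 neutral by rewrite e.
    by apply: dispersion_shear_eigenvalue => //; rewrite ?add0r // ltW.
  move=> mu Emu mu0; rewrite ltNge; apply/negP => re0.
  have [muE dmu] := unstable mu Emu re0; move: mu0.
  rewrite muE -(dispersion_unique alpha_gt alpha_lt (ltW nu0) (lexx 0) _ re0 _ _ dmu) ?eqxx //.
  + by rewrite add0r.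
  + by rewrite ltr_wpDl.
  + by rewrite e.
- move=> lt.
  have [lam lam0 dlam] := unstable_root_exists alpha_gt alpha_lt nu0 lt dnus.
  have lamnu : 0 < lam + nu by rewrite addr_gt0.
  have uniq x : 0 <= x -> dispersion alpha nu x neutral -> lam = x.
    move=> x0 dx.
    by apply: (dispersion_unique alpha_gt alpha_lt (ltW nu0) (ltW lam0) lamnu x0 _ dlam dx); rewrite ltr_wpDl.
  exists lam; split.
    split; first by split=> //; apply: dispersion_shear_eigenvalue => //; exact: ltW.
    move=> x [x0 Ex]; apply: uniq; first exact: ltW.
    by apply: shear_eigenvalue_dispersion => //; rewrite ?ltW // addr_gt0.
  move=> mu Emu mul; rewrite ltNge; apply/negP => re0.
  have [muE dmu] := unstable mu Emu re0; move: mul.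
  by rewrite muE -(uniq _ re0 dmu) eqxx.
Qed.

(** Otherwise the midpoint would have a positive eigenvalue according to one threshold and none
    according to the other. *)
Lemma critical_viscosity_le (nus nus' : R) : 0 <= nus' ->
  critical_viscosity alpha l khat nus -> critical_viscosity alpha l khat nus' ->
  nus <= nus'.
Proof.
move=> nus0 c c'; rewrite leNgt; apply/negP => lt.
pose nu := (nus + nus') / 2.
have [h1 h2] : nus' < nu /\ nu < nus by rewrite /nu; split; lra.
have nu0 : 0 < nu by apply: le_lt_trans h1.
have [_ _ /(_ h2)[lam [[[lam0 Elam] _] _]]] := c nu nu0.
have [/(_ h1 _ Elam) /= + _ _] := c' nu nu0.
by rewrite ltNge (ltW lam0).
Qed.

Lemma critical_viscosity_unique (nus nus' : R) : 0 < nus ->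
  critical_viscosity alpha l khat nus -> critical_viscosity alpha l khat nus' ->
  nus' = nus.
Proof.
move=> nus0 c c'.
(* [critical_viscosity] speaks of positive [nu] only, so a negative [nus'] has to be excluded
   separately. *)
have [lt|le] := ltP nus' 0.
  pose nu := nus / 2; have nu0 : 0 < nu by rewrite divr_gt0.
  have h2 : nu < nus by rewrite /nu; lra.
  have [_ _ /(_ h2)[lam [[[lam0 Elam] _] _]]] := c nu nu0.
  have [/(_ (lt_trans lt nu0) _ Elam) /= + _ _] := c' nu nu0.
  by rewrite ltNge (ltW lam0).
apply/eqP; rewrite eq_le (critical_viscosity_le (ltW nus0) c' c) //.
by rewrite (critical_viscosity_le le c c').
Qed.

Lemma positive_branch_dispersion (nus : R) (lam : R -> R) (nu : R) :
  positive_branch alpha l khat nus lam -> 0 < nu -> nu < nus ->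
  0 < lam nu /\ dispersion alpha nu (lam nu) neutral.
Proof.
move=> br nu0 lt; have [lam0 Elam] := br nu nu0 lt; split=> //.
by apply: shear_eigenvalue_dispersion => //; rewrite ?ltW // addr_gt0.
Qed.

Lemma positive_branch_exists (nus : R) : critical_viscosity alpha l khat nus ->
  exists lam : R -> R, positive_branch alpha l khat nus lam.
Proof.
move=> c; exists (fun nu => xget 0 [set x : R | 0 < x /\ E nu x%:C]) => nu nu0 lt.
have [_ _ /(_ lt)[lam [[lamP _] _]]] := c nu nu0.
by have := @xgetPex R 0 [set x : R | 0 < x /\ E nu x%:C]; apply; exists lam.
Qed.

Lemma positive_branch_slope (nus : R) (lam : R -> R) (nu1 nu2 : R) :
  positive_branch alpha l khat nus lam -> 0 < nu1 -> nu1 < nu2 -> nu2 < nus ->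
  nu2^-1 * lam nu2 < nu1^-1 * lam nu1.
Proof.
move=> br nu10 lt lts.
have [l1 d1] := positive_branch_dispersion br nu10 (lt_trans lt lts).
have [l2 d2] := positive_branch_dispersion br (lt_trans nu10 lt) lts.
rewrite ![_^-1 * _]mulrC.
exact: (dispersion_slope alpha_gt alpha_lt nu10 lt (ltW l1) (ltW l2) d1 d2).
Qed.

Lemma positive_branch_bounds (nus : R) (lam : R -> R) (nu : R) :
  positive_branch alpha l khat nus lam -> 0 < nu -> nu < nus ->
  Num.sqrt (lam_lower_radicand alpha) - nu * (alpha ^+ 2 + 1) < lam nu /\
  lam nu < Num.sqrt (lam_upper_radicand alpha) - nu * alpha ^+ 2.
Proof.
move=> br nu0 lt; have [l0 d] := positive_branch_dispersion br nu0 lt.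
exact: (dispersion_lam_bounds alpha_gt alpha_lt nu0 (ltW l0) d).
Qed.

Lemma positive_branch_limit (nus : R) (lam : R -> R) (lam0 : R) :
  alpha < 8469 / 10000 -> 0 < nus -> positive_branch alpha l khat nus lam ->
  0 < lam0 -> dispersion alpha 0 lam0 neutral -> lam nu @[nu --> 0^'+] --> lam0.
Proof.
move=> al nus0 br lam00 d0; have rad := lam_lower_radicand_gt0 alpha_gt alpha_lt al; clear al.
have near_lt (c : R) : 0 < c -> \forall nu \near 0^'+, 0 < nu < c.
  by move=> c0; near=> nu; apply/andP; split; near: nu; [exact: nbhs_right_gt|exact: nbhs_right_lt].
have sq0 : 0 < Num.sqrt (lam_lower_radicand alpha) by rewrite sqrtr_gt0.
(* Half of the root is a lower bound for [lam nu] as soon as nu (alpha^2 + 1) is below the other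
   half. *)
have m0 : 0 < Num.sqrt (lam_lower_radicand alpha) / 2 by rewrite divr_gt0.
have a1 : 0 < alpha ^+ 2 + 1 by rewrite ltr_wpDl ?sqr_ge0.
apply: (dispersion_limit alpha_gt alpha_lt lam00 d0 m0).
  near=> nu.
  have /andP[nu0 nult] : 0 < nu < nus by near: nu; exact: near_lt.
  have /andP[_ nub] : 0 < nu < Num.sqrt (lam_lower_radicand alpha) / 2 / (alpha ^+ 2 + 1).
    by near: nu; apply: near_lt; exact: divr_gt0.
  have [+ _] := positive_branch_bounds br nu0 nult.
  move: nub; rewrite ltr_pdivlMr //.
  by move: (Num.sqrt _) (nu * _) => r q; lra.
near=> nu.
have /andP[nu0 nult] : 0 < nu < nus by near: nu; exact: near_lt.
by have [] := positive_branch_dispersion br nu0 nult.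
Unshelve. all: by end_near. Qed.

(** The right half plane is settled by the dispersion relation, the left one by the symmetry lam to
    - lam, and the imaginary axis by [imaginary_not_eigenvalue]. *)
Lemma shear_inviscid_eigenvalues (lam0 : R) : 0 < lam0 ->
  dispersion alpha 0 lam0 neutral ->
  E 0 = [set lam0%:C; - lam0%:C].
Proof.
move=> lam00 d0.
have E0 : E 0 lam0%:C by apply: dispersion_shear_eigenvalue; rewrite ?addr0 // ltW.
have pos mu : E 0 mu -> 0 < complex.Re mu -> mu = lam0%:C.
  move=> Emu re0.
  have s0 : 0 < complex.Re mu + 0 by rewrite addr0.
  have [muE dmu] := shear_unstable_dispersion (lexx 0) (ltW re0) s0 Emu.
  rewrite muE; congr _%:C.
  by apply: (dispersion_unique alpha_gt alpha_lt (lexx 0) (ltW re0) _ (ltW lam00) _ dmu d0); rewrite addr0.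
apply/seteqP; split=> mu /=; last first.
  by move=> [->//|->]; exact: (euler_eigenvalue_opp g0).
move=> Emu; have [re|re|re] := ltgtP (complex.Re mu) 0.
- right; rewrite -(pos (- mu)) ?opprK ?ReN ?oppr_gt0 //.
  exact: (euler_eigenvalue_opp g0).
- by left; exact: pos.
- exfalso; apply: (imaginary_not_eigenvalue (l := l) g0 g1 (t := complex.Im mu)).
  by rewrite (_ : (complex.Im mu)*i = mu) //; apply: complex_ext.
Qed.

Lemma shear_segmentE : alpha * `|khat.1|%:~R / 2 = alpha / 2.
Proof. by rewrite /= normrN1 mulr1. Qed.

Lemma shear_continuous_spectrum :
  continuous_spectrum alpha 0 l khat = imag_segment (alpha / 2).
Proof. by rewrite (euler_continuous_spectrum l g0 g1 alpha0) shear_segmentE. Qed.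

Lemma shear_inviscid_spectrum (lam0 : R) : 0 < lam0 ->
  dispersion alpha 0 lam0 neutral ->
  spectrum alpha 0 l khat `\` [set lam0%:C; - lam0%:C] = imag_segment (alpha / 2).
Proof.
move=> lam00 d0; have EE := shear_inviscid_eigenvalues lam00 d0.
rewrite (euler_spectrum l g0 g1 alpha0) shear_segmentE -EE.
apply/seteqP; split=> mu /=; first by move=> [[//|[_ Emu]] ne].
move=> mus; split; first by left.
case: mus => t _ <-; exact: (imaginary_not_eigenvalue (l := l) g0 g1).
Qed.

Lemma shear_viscous :
  alpha < 95 / 100 ->
  0 < nu_lower_radicand alpha /\ nu_lower alpha < nu_upper alpha /\
  exists nus : R,
    [/\ nu_lower alpha < nus, nus < nu_upper alpha,
        critical_viscosity alpha l khat nus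
      & forall nus', critical_viscosity alpha l khat nus' -> nus' = nus] /\
    exists lam : R -> R,
      positive_branch alpha l khat nus lam /\
      (forall nu1 nu2 : R, 0 < nu1 -> nu1 < nu2 -> nu2 < nus ->
         nu2^-1 * lam nu2 < nu1^-1 * lam nu1) /\
      (alpha < 8469 / 10000 ->
         0 < lam_lower_radicand alpha /\
         (forall nu : R, 0 < nu -> nu < nus ->
            Num.sqrt (lam_lower_radicand alpha) - nu * (alpha ^+ 2 + 1)
              < lam nu /\
            lam nu < Num.sqrt (lam_upper_radicand alpha)
              - nu * alpha ^+ 2) /\
         (cvg (lam @ 0^'+) /\
          Num.sqrt (lam_lower_radicand alpha) <= lim (lam @ 0^'+) /\
          lim (lam @ 0^'+) <= Num.sqrt (lam_upper_radicand alpha)) /\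
         lam =O_ (0^'+) (fun=> 1 : R)).
Proof.
move=> al; split; first exact: nu_lower_radicand_gt0.
split; first exact: nu_lower_lt_upper.
have [nus [lo up dnus]] := critical_nu_exists alpha_gt alpha_lt al.
have [lo0 _] := nu_lower_sqr alpha_gt alpha_lt al.
have nus0 : 0 < nus := lt_trans lo0 lo.
have crit := dispersion_critical nus0 dnus.
exists nus; split.
  split=> // nus' c'; exact: critical_viscosity_unique nus0 crit c'.
have [lam br] := positive_branch_exists crit.
exists lam; split=> //; split.
  by move=> nu1 nu2 h1 h2 h3; exact: (positive_branch_slope br).
move=> al'; split; first exact: lam_lower_radicand_gt0.
split; first by move=> nu h1 h2; exact: (positive_branch_bounds br).
have [lam0 [h1 h2 d0]] := inviscid_root_exists alpha_gt alpha_lt al'.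
have lam00 : 0 < lam0 by apply: le_lt_trans h1; exact: sqrtr_ge0.
have lim0 := positive_branch_limit al' nus0 br lam00 d0.
split.
  split; first by apply/cvg_ex; exists lam0.
  by rewrite (cvg_lim _ lim0) // !ltW.
have bnd : \forall nu \near 0^'+, `|lam nu| <= lam0 + 1.
  move/cvgrPdist_lt: lim0 => /(_ 1 ltr01); apply: filterS => nu h.
  rewrite -(ger0_norm (ltW lam00)) -lerBlDl (le_trans (lerB_dist _ _)) //.
  by rewrite distrC ltW.
apply/eqOP; exists (lam0 + 1); split; first exact: num_real.
move=> k hk; move: bnd; apply: filterS => nu h.
by rewrite normr1 mulr1 (le_trans h) // ltW.
Qed.

Lemma shear_inviscid :
  alpha < 8469 / 10000 ->
  exists lam0 : R,
    0 < lam0 /\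
    eigenvalues alpha 0 l khat = [set lam0%:C; - lam0%:C] /\
    Num.sqrt (lam_lower_radicand alpha) < lam0 /\
    lam0 < Num.sqrt (lam_upper_radicand alpha) /\
    spectrum alpha 0 l khat `\` [set lam0%:C; - lam0%:C] =
      imag_segment (alpha / 2) /\
    continuous_spectrum alpha 0 l khat = imag_segment (alpha / 2).
Proof.
move=> al; have [lam0 [h1 h2 d0]] := inviscid_root_exists alpha_gt alpha_lt al.
have lam00 : 0 < lam0 by apply: le_lt_trans h1; exact: sqrtr_ge0.
exists lam0; split=> //; split; first exact: shear_inviscid_eigenvalues.
split=> //; split=> //; split; first exact: shear_inviscid_spectrum.
exact: shear_continuous_spectrum.
Qed.

Lemma shear_inviscid_limit (nus : R) (lam : R -> R) (lam0 : R) :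
  alpha < 8469 / 10000 ->
  critical_viscosity alpha l khat nus -> positive_branch alpha l khat nus lam ->
  0 < lam0 -> eigenvalues alpha 0 l khat lam0%:C -> lam @ 0^'+ --> lam0.
Proof.
move=> al c br lam00 E0.
have al' : alpha < 95 / 100 by lra.
have [_ [_ [nus' [[lo _ _ uniq] _]]]] := shear_viscous al'.
have [lo0 _] := nu_lower_sqr alpha_gt alpha_lt al'.
(* Positivity of [nus] is obtained by identifying it with the constructed threshold, which exceeds
   [nu_lower]. *)
apply: (positive_branch_limit al _ br lam00).
  by rewrite (uniq _ c); exact: lt_trans lo.
by apply: shear_eigenvalue_dispersion; rewrite ?addr0 // ltW.
Qed.
End ShearLine.

(** * The other lines *)

Lemma line_partE (R : realType) (khat : freq) (w : coeffs R) (a m : int) :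
  line_part khat w (a, m) = if a == khat.1 then w (a, m) else 0.
Proof.
rewrite /line_part; case: asboolP => [/lineE /= ->|h]; first by rewrite eqxx.
by case: eqP => // e; case: h; apply/lineE.
Qed.

Lemma linNS_line_part (R : realType) (alpha nu : R) (khat : freq) (w : coeffs R) :
  linNS alpha nu (line_part khat w) = line_part khat (linNS alpha nu w).
Proof.
apply/funext => -[a m]; rewrite line_partE !linNS_line !line_partE.
by case: eqP => // _; rewrite !mulr0 subrr !mulr0 subrr.
Qed.

Lemma imag_segment_Re (R : realType) (r : R) (lam : R[i]) :
  imag_segment r lam -> complex.Re lam = 0.
Proof. by case=> t _ <-. Qed.

Section OutsideDisc.
Variables (R : realType) (alpha : R) (khat : freq) (l : nat).
Hypotheses (alpha0 : 0 < alpha) (out : outside_disc alpha khat).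

Let g := (alpha * khat.1%:~R) ^+ 2.
Let b := alpha * khat.1%:~R / 4.

(** The line passes through the frequency with second coordinate 0, so the condition there already
    makes every [rho] positive. *)
Lemma outside_gt1 : 1 < g.
Proof. by case: out => _ /(_ (- khat.2)); rewrite subrr expr0n addr0. Qed.

Lemma outside_g0 : 0 < g.
Proof. exact: lt_trans outside_gt1. Qed.

Lemma outside_g1 : g != 1.
Proof. by rewrite gt_eqF // outside_gt1. Qed.

(** All [rho] are positive, so [line_dissipative] applies; the factor - b makes up for the sign of
    [khat.1]. *)
Lemma outside_stable (nu : R) (lam : R[i]) :
  0 <= nu -> 0 <= complex.Re lam -> 0 < complex.Re lam + nu ->
  ~ eigenvalues alpha nu l khat lam.
Proof.
move=> nu0 re0 s0 [w /(eigenfunction_seq outside_g0 outside_g1)[]].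
set z := fun m => _ => znull [m zm] zE; move/eqP: zm; apply.
have b0 : b != 0 by exact: (amplitude_neq0 outside_g0).
have bC : b%:C != 0 :> R[i] by rewrite eq_complex /= eqxx andbT.
have rho0 j : 0 < shear_rho g j.
  rewrite /shear_rho subr_gt0 invf_lt1.
    by apply: lt_le_trans outside_gt1 _; rewrite lerDl sqr_ge0.
  exact: (kap_pos outside_g0).
apply: (@line_dissipative R (fun j => (lam + (nu * (g + j%:~R ^+ 2))%:C) *
  ((- (b^-1 / shear_rho g j))%:C)) z (- b)) => // j.
- have -> : z (j + 1) - z (j - 1) = - (b%:C^-1 * (b%:C * (z (j - 1) - z (j + 1)))).
    by field.
  have zEj : (lam + (nu * (g + j%:~R ^+ 2))%:C) / (shear_rho g j)%:C * z j =
    b%:C * (z (j - 1) - z (j + 1)) := zE j.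
  have dC : (- (b^-1 / shear_rho g j))%:C = - (b%:C^-1 / (shear_rho g j)%:C) :> R[i].
    by rewrite rmorphN rmorphM !fmorphV.
  by rewrite -zEj dC; move: (z j) (lam + _) => x y; ring.
- rewrite ReM /= mulr0 subr0 ReD /= mulrCA.
  rewrite mulrNN (mulrA b b^-1) mulfV // mul1r mulr_gt0 ?invr_gt0 //.
  have k0 : 0 < g + j%:~R ^+ 2 := kap_pos outside_g0 j.
  have [n0|n0] := eqVneq nu 0.
    by move: s0; rewrite n0 mul0r !addr0.
  by rewrite ltr_wpDl // mulr_gt0 // lt_neqAle eq_sym n0.
Qed.

Lemma outside_inviscid (lam : R[i]) : ~ eigenvalues alpha 0 l khat lam.
Proof.
have [re|re|re] := ltgtP (complex.Re lam) 0.
- move=> /(euler_eigenvalue_opp outside_g0); apply: outside_stable => //.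
    by rewrite ReN oppr_ge0 ltW.
  by rewrite ReN addr0 oppr_gt0.
- by apply: outside_stable; rewrite ?addr0 // ltW.
- rewrite (_ : lam = (complex.Im lam)*i); last exact: complex_ext.
  exact: imaginary_not_eigenvalue outside_g0 outside_g1 _.
Qed.

Lemma outside_spectra :
  (forall nu : R, 0 < nu -> forall lam : R[i],
     eigenvalues alpha nu l khat lam -> complex.Re lam < 0) /\
  spectrum alpha 0 l khat = imag_segment (alpha * `|khat.1|%:~R / 2) /\
  continuous_spectrum alpha 0 l khat = imag_segment (alpha * `|khat.1|%:~R / 2).
Proof.
split=> [nu nu0 lam Elam|].
  rewrite ltNge; apply/negP => re0; apply: (outside_stable _ re0 _ Elam).
    exact: ltW.
  exact: ltr_wpDl.
split; last exact: (euler_continuous_spectrum l outside_g0 outside_g1 alpha0).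
rewrite (euler_spectrum l outside_g0 outside_g1 alpha0).
apply/seteqP; split=> lam /=; last by left.
by move=> [//|[_ /outside_inviscid]].
Qed.
End OutsideDisc.

(** Take khat = (K, 0) with K >= 2, so that alpha K > 1 since alpha > 1/2, and with K >= 2 |t| /
    alpha, so that the segment reaches t. *)
Lemma imaginary_axis_cover (R : realType) (alpha t : R) : 1 / 2 < alpha ->
  exists khat : freq, outside_disc alpha khat /\
    imag_segment (alpha * `|khat.1|%:~R / 2) (t *i).
Proof.
move=> a12; have a0 : 0 < alpha by apply: lt_trans a12; lra.
pose K := (Num.truncn (2 * `|t| / alpha)).+2.
exists (K%:Z, 0); split; [split=> //= n|exists t => //=].
  have K2 : (2 : R) <= K%:R by rewrite ler_nat.
  have aK : 1 < alpha * K%:R.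
    have : 1 < alpha * 2 by lra.
    by move=> /lt_le_trans; apply; rewrite ler_pM2l.
  have : 1 < (alpha * K%:R) ^+ 2 by rewrite exprn_egt1.
  by move=> /lt_le_trans; apply; rewrite lerDl sqr_ge0.
have y0 : 0 <= 2 * `|t| / alpha by rewrite divr_ge0 ?mulr_ge0 // ltW.
have /andP[_ lt] := truncn_itv y0.
have : 2 * `|t| / alpha <= K%:R.
  by rewrite (le_trans (ltW lt)) // ler_nat.
rewrite ler_pdivrMr // => h.
by rewrite in_itv /= -ler_norml -pmulrn; lra.
Qed.

(** * The diagonal line with first frequency 0 *)

Section ShearAxis.
Variables (R : realType) (alpha : R) (l : nat).

Let khat : freq := (0, 1).
Let W := sobolev_weight ((alpha * (0 : int)%:~R) ^+ 2) l.

Lemma axis_weight_ge0 m : 0 <= W m.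
Proof. by rewrite exprn_ge0 // addr_ge0 // addr_ge0 ?sqr_ge0. Qed.

Lemma axis_Hline (w : coeffs R) : Hline alpha l khat w <->
  [/\ forall k, k.1 != 0 -> w k = 0, w 0 = 0 &
    exists M, forall N, wsum N (fun m => W m * nsq (w (0, m))) <= M].
Proof.
split=> [[w0 w00 /Hnorm2_fin[M wM]]|[w0 w00 [M wM]]].
  have w0' k : k.1 != 0 -> w k = 0.
    by move=> kk; apply: w0 => /lineE/eqP kk'; rewrite kk' in kk.
  by split=> //; exists M; exact: (proj1 (@Hnorm2_le R alpha l 0 w M w0') wM).
split=> //; first by move=> k kk; apply: w0; apply/eqP => kk'; apply: kk; apply/lineE.
by apply/Hnorm2_fin; exists M; exact: (proj2 (@Hnorm2_le R alpha l 0 w M w0) wM).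
Qed.

Lemma axis_linNS (nu : R) (w : coeffs R) (m : int) :
  linNS alpha nu w (0, m) = (- (nu * m%:~R ^+ 2))%:C * w (0, m).
Proof.
by rewrite linNS_line mulr0 expr0n mul0r (_ : 0%:C = 0) // mul0r add0r add0r rmorphN mulNr.
Qed.

(** The equation itself bounds the image of [w]; f = 0 serves eigenfunctions, a general [f] the
    resolvent. *)
Lemma axis_eigen_dom (nu : R) (lam : R[i]) (w f : coeffs R) :
  Hline alpha l khat w -> Hline alpha l khat f ->
  (forall m, linNS alpha nu w (0, m) = f (0, m) + lam * w (0, m)) ->
  dom alpha nu l khat w.
Proof.
move=> wH fH wE; split=> //.
have /axis_Hline[w0 w00 [M wM]] := wH; have /axis_Hline[f0 f00 [F fF]] := fH.
apply/axis_Hline; split; first exact: linNS_supp.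
  by rewrite [LHS](wE 0) [f _]f00 [w _]w00 mulr0 addr0.
exists (2 * (F + nsq lam * M)) => N.
have pt m : W m * nsq (linNS alpha nu w (0, m)) <=
    2 * (W m * nsq (f (0, m)) + nsq lam * (W m * nsq (w (0, m)))).
  rewrite wE; have := ler_wpM2l (axis_weight_ge0 m) (nsqD_le (f (0, m)) (lam * w (0, m))).
  by rewrite nsqM; lra.
rewrite (le_trans (ler_wsum (fun m _ => pt m))) // wsumZ wsumD wsumZ.
by rewrite ler_pM2l // lerD // ler_wpM2l // nsq_ge0.
Qed.

Lemma Hline0 : Hline alpha l khat (fun=> 0).
Proof.
apply/axis_Hline; split=> //; exists 0 => N.
rewrite (@eq_wsum _ _ _ (fun=> 0)); first by rewrite wsum_const mulr0 mul0rn.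
by move=> m _; rewrite nsq0 mulr0.
Qed.

Lemma shear_modeE (n : int) (c : R[i]) (a m : int) :
  shear_mode n c (a, m) =
  if a != 0 then 0 else if m == n then c else if m == - n then c^* else 0.
Proof.
rewrite /shear_mode !freq_pmulz !xpair_eqE.
by case: (a =P 0).
Qed.

Lemma shear_mode_eigenfunction (nu : R) (n : int) (c : R[i]) : n != 0 -> c != 0 ->
  eigenfunction alpha nu l khat (- (nu * n%:~R ^+ 2))%:C (shear_mode n c).
Proof.
move=> n0 c0.
have supp k : k.1 != 0 -> shear_mode n c k = 0.
  by case: k => a m /= a0; rewrite shear_modeE a0.
have eig k : linNS alpha nu (shear_mode n c) k =
    (- (nu * n%:~R ^+ 2))%:C * shear_mode n c k.
  case: k => a m; have [->|a0] := eqVneq a 0; last first.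
    by rewrite (linNS_supp alpha nu supp) // supp // mulr0.
  rewrite axis_linNS shear_modeE /=; case: eqP => [->//|_].
  by case: eqP => [->|_]; rewrite ?mulrNz ?sqrrN ?mulr0.
have H : Hline alpha l khat (shear_mode n c).
  apply/axis_Hline; split=> //.
    rewrite [LHS]shear_modeE /= eq_sym (negbTE n0).
    by rewrite -eqr_oppLR oppr0 eq_sym (negbTE n0).
  exists (wsum (absz n).+1 (fun m => W m * nsq (shear_mode n c (0, m)))) => N.
  have ge0 m : 0 <= W m * nsq (shear_mode n c (0, m)).
    by rewrite mulr_ge0 ?nsq_ge0 // axis_weight_ge0.
  have [KN|/ltnW NK] := leqP N (absz n).+1; first exact: wsum_mono.
  rewrite le_eqVlt; apply/orP; left; apply/eqP; apply: wsum_supp NK => m mN.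
  have [m1 m2] : m <> n /\ m <> - n by clear -mN; lia.
  by rewrite shear_modeE /=; case: eqP => // _; case: eqP => // _; rewrite nsq0 mulr0.
split=> //.
- apply: (axis_eigen_dom (lam := (- (nu * n%:~R ^+ 2))%:C) H Hline0) => m.
  by rewrite eig add0r.
- by exists (0, n); rewrite shear_modeE /= eqxx.
Qed.

Lemma axis_eigenvalue (nu : R) (lam : R[i]) (w : coeffs R) :
  eigenfunction alpha nu l khat lam w ->
  (forall k, k.1 != 0 -> w k = 0) /\ w 0 = 0 /\
  (exists n, n != 0 /\ w (0, n) != 0) /\
  forall n, w (0, n) != 0 -> lam = (- (nu * n%:~R ^+ 2))%:C.
Proof.
move=> [[/axis_Hline[w0 w00 _] _] [[a m] wk] wE]; split=> //; split=> //; split.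
  have [e|a0] := eqVneq a 0; last by rewrite w0 // eqxx in wk.
  rewrite e in wk; exists m; split=> //.
  by apply: contraNneq wk => ->; exact/eqP.
by move=> n wn; have := wE (0, n); rewrite axis_linNS => /(mulIf wn).
Qed.

Lemma axis_eigenvalues (nu : R) : eigenvalues alpha nu l khat =
  [set (- (nu * n%:~R ^+ 2))%:C | n in [set n : int | n != 0]].
Proof.
apply/seteqP; split=> lam /=.
  move=> [w /axis_eigenvalue[_ [_ [[n [n0 wn]] lamE]]]].
  by exists n => //; rewrite (lamE n wn).
move=> [n n0 <-]; exists (shear_mode n 1).
by apply: shear_mode_eigenfunction => //; exact: oner_neq0.
Qed.

(** Only finitely many of the numbers - nu n^2 come within distance 1 of [lam], since they tend to
    minus infinity; the minimum over these is positive. *)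
Lemma axis_gap (nu : R) (lam : R[i]) : 0 < nu ->
  (forall n : int, n != 0 -> lam != (- (nu * n%:~R ^+ 2))%:C) ->
  exists2 delta : R, 0 < delta &
    forall n : int, n != 0 -> delta <= nsq ((- (nu * n%:~R ^+ 2))%:C - lam).
Proof.
move=> nu0 ne; pose f (n : int) := nsq ((- (nu * n%:~R ^+ 2))%:C - lam).
have f0 n : n != 0 -> 0 < f n.
  by move=> n0; rewrite lt_neqAle nsq_ge0 andbT eq_sym nsq_eq0 subr_eq0 eq_sym ne.
have fin (N : nat) : exists2 d : R, 0 < d & forall n : int, n != 0 -> (absz n <= N)%N -> d <= f n.
  elim: N => [|N [d d0 dN]].
    by exists 1 => // n n0; rewrite leqn0 absz_eq0 (negbTE n0).
  exists (Num.min d (f N.+1%:Z)); first by rewrite lt_min d0 f0.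
  move=> n n0; rewrite leq_eqVlt => /orP[/eqP nN|nN]; last by rewrite ge_min dN.
  have -> : f n = f N.+1%:Z; last by rewrite ge_min lexx orbT.
  have sq : (n%:~R : R) ^+ 2 = N.+1%:Z%:~R ^+ 2.
    by rewrite -(real_normK (num_real n%:~R)) -intr_norm -abszE nN.
  by rewrite /f sq.
pose T := (`|complex.Re lam| + 1) / nu.
have T0 : 0 <= T by rewrite divr_ge0 ?addr_ge0 // ltW.
have [d d0 dN] := fin (Num.truncn T).+1.
exists (Num.min d 1); first by rewrite lt_min d0 ltr01.
move=> n n0; have [nN|nN] := leqP (absz n) (Num.truncn T).+1.
  by rewrite ge_min dN.
rewrite ge_min; apply/orP; right.
have n1 : T <= n%:~R ^+ 2.
  have /andP[_ lt] := truncn_itv T0.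
  have h : T <= (absz n)%:R by rewrite (le_trans (ltW lt)) // ler_nat ltnW.
  rewrite -(real_normK (num_real _)) -intr_norm -abszE -pmulrn (le_trans h) //.
  by rewrite ler_eXnr // ler1n; apply: leq_trans nN.
move: n1; rewrite ler_pdivrMr // mulrC => n1.
rewrite /nsq !ReImE /=; apply: (@le_trans _ _ ((- (nu * n%:~R ^+ 2) - complex.Re lam) ^+ 2)).
  rewrite -[leLHS](expr1n _ 2) -[leRHS]sqrrN lerXn2r // ?nnegrE //.
    by have := ler_norm (- complex.Re lam); rewrite normrN; lra.
  by have := ler_norm (- complex.Re lam); rewrite normrN; lra.
by rewrite lerDl sqr_ge0.
Qed.

Lemma axis_resolvent (nu : R) (lam : R[i]) : 0 < nu ->
  (forall n : int, n != 0 -> lam != (- (nu * n%:~R ^+ 2))%:C) ->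
  resolvent_set alpha nu l khat lam.
Proof.
move=> nu0 ne; have [d d0 dle] := axis_gap nu0 ne.
pose q (n : int) : R[i] := (- (nu * n%:~R ^+ 2))%:C - lam.
have q0 n : n != 0 -> q n != 0.
  by move=> n0; rewrite -nsq_eq0 gt_eqF // (lt_le_trans d0 (dle n n0)).
exists d^-1 => f fH; have /axis_Hline[f0 f00 _] := fH.
pose F := fine (Hnorm2 alpha l f).
have fE : Hnorm2 alpha l f = F%:E.
  by rewrite fineK // ge0_fin_numE ?Hnorm2_ge0 //; case: fH.
have fF : forall N, wsum N (fun m => W m * nsq (f (0, m))) <= F.
  by apply: (proj1 (@Hnorm2_le R alpha l 0 f F f0)); rewrite fE.
clearbody F.
pose w : coeffs R := fun k => f k / q k.2.
have w0 k : k.1 != 0 -> w k = 0 by move=> kk; rewrite /w f0 // mul0r.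
have qw m : q m * w (0, m) = f (0, m).
  have [->|m0] := eqVneq m 0; last by rewrite /w mulrC divfK // q0.
  by rewrite /w [f _]f00 mul0r mulr0.
have wF N : wsum N (fun m => W m * nsq (w (0, m))) <= d^-1 * F.
  have pt m : W m * nsq (w (0, m)) <= d^-1 * (W m * nsq (f (0, m))).
    rewrite mulrCA ler_wpM2l ?axis_weight_ge0 //.
    have [->|m0] := eqVneq m 0; first by rewrite /w [f _]f00 mul0r nsq0 mulr0.
    rewrite -qw nsqM mulrA ler_peMl ?nsq_ge0 // mulrC ler_pdivlMr // mul1r.
    exact: dle.
  rewrite (le_trans (ler_wsum (fun m _ => pt m))) // wsumZ ler_wpM2l //.
  by rewrite invr_ge0 ltW.
have wH : Hline alpha l khat w.
  apply/axis_Hline; split=> //; first by rewrite /w f00 mul0r.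
  by exists (d^-1 * F).
exists w; split.
- apply: (axis_eigen_dom (lam := lam) wH fH) => m.
  by rewrite axis_linNS -qw /q; ring.
- apply/funext => -[a m]; have [->|a0] := eqVneq a 0.
    by rewrite /shifted axis_linNS -mulrBl qw.
  by rewrite /shifted (linNS_supp alpha nu w0) // w0 // f0 // mulr0 subr0.
- move=> w' [/axis_Hline[w0' w00' _] _] w'E; apply/funext => -[a m].
  have [->|a0] := eqVneq a 0; last by rewrite w0' // w0.
  have [->|m0] := eqVneq m 0; first by rewrite [LHS]w00' /w [f _]f00 mul0r.
  apply: (mulfI (q0 m m0)); rewrite qw -w'E /shifted axis_linNS /q; ring.
- by rewrite fE -EFinM; exact: (proj2 (@Hnorm2_le R alpha l 0 w _ w0) wF).
Qed.

Lemma axis_spectrum (nu : R) : 0 < nu -> spectrum alpha nu l khat =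
  [set (- (nu * n%:~R ^+ 2))%:C | n in [set n : int | n != 0]].
Proof.
move=> nu0; apply/seteqP; split=> lam; last first.
  by rewrite -axis_eigenvalues; exact: spectrum_eigenvalue.
move=> nres; apply: contrapT => ne; apply: nres; apply: axis_resolvent => // n n0.
by apply/eqP => e; apply: ne; exists n.
Qed.

(** For nu > 0 the eigenvalue determines n up to sign, so only the modes n and -n occur, and reality
    ties their coefficients by conjugation. *)
Lemma axis_real_eigenfunction (nu : R) (lam : R[i]) (w : coeffs R) : 0 < nu ->
  real_valued w ->
  (eigenfunction alpha nu l khat lam w <->
   exists (n : int) (c : R[i]),
     [/\ n != 0, c != 0, lam = (- (nu * n%:~R ^+ 2))%:C & w = shear_mode n c]).
Proof.
move=> nu0 wreal; split=> [/axis_eigenvalue[w0 [w00 [[n [n0 wn]] lamE]]]|].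
  exists n, (w (0, n)); split=> //; first exact: lamE.
  apply/funext => -[a m]; rewrite shear_modeE.
  case: ifPn => [a0|]; first exact: w0.
  rewrite negbK => /eqP ->; case: eqP => [->//|mn]; case: eqP => [->|mn'].
    by rewrite -wreal; congr (w _); congr pair; rewrite oppr0.
  apply: contrapT => /eqP wm.
  have := lamE m wm; rewrite (lamE n wn) => /(congr1 (@complex.Re R)) /= /eqP.
  rewrite eqr_opp (inj_eq (mulfI (lt0r_neq0 nu0))) eqf_sqr.
  rewrite -mulrNz !eqr_int => /orP[/eqP e|/eqP e]; first by apply: mn.
  by apply: mn'; rewrite e opprK.
by move=> [n [c [n0 c0 -> ->]]]; exact: shear_mode_eigenfunction.
Qed.

Lemma axis_eigenvalues_dense (x : R) : x <= 0 -> exists ev : R -> R,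
  (forall nu, 0 < nu -> eigenvalues alpha nu l khat (ev nu)%:C) /\ ev @ 0^'+ --> x.
Proof.
(* With t = sqrt (- x) and s = sqrt nu, n s lies between t and t + s, so - nu n^2 lies between x - 2
   t s - nu and x. The successor also keeps n nonzero. *)
move=> x0; pose n (nu : R) := (Num.truncn (Num.sqrt (- x) / Num.sqrt nu)).+1.
exists (fun nu => - (nu * (n nu)%:Z%:~R ^+ 2)); split=> [nu nu0|].
  by rewrite axis_eigenvalues; exists (n nu)%:Z.
pose h (nu : R) := x - (2 * Num.sqrt (- x) * Num.sqrt nu + nu).
apply: (@squeeze_cvgr _ _ _ _ h (fun=> x)); last exact: cvg_cst.
  near=> nu; have nu0 : 0 < nu by near: nu; exact: nbhs_right_gt.
  have s0 : 0 < Num.sqrt nu by rewrite sqrtr_gt0.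
  have y0 : 0 <= Num.sqrt (- x) / Num.sqrt nu by rewrite divr_ge0 ?sqrtr_ge0.
  have /andP[lo up] := truncn_itv y0.
  have sx : Num.sqrt (- x) ^+ 2 = - x by rewrite sqr_sqrtr // oppr_ge0.
  have sn : Num.sqrt nu ^+ 2 = nu by rewrite sqr_sqrtr // ltW.
  rewrite -pmulrn /n /h; move: lo up; rewrite ler_pdivlMr // ltr_pdivrMr // -natr1.
  move: (Num.truncn _)%:R (ler0n R (Num.truncn (Num.sqrt (- x) / Num.sqrt nu))) => k k0 lo up.
  have := sqrtr_ge0 (- x); move: sx sn lo up s0.
  move: (Num.sqrt nu) (Num.sqrt (- x)) => s t sx sn lo up s0 t0.
  have e : nu * (k + 1) ^+ 2 = ((k + 1) * s) ^+ 2 by rewrite -sn; ring.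
  have h1 : t ^+ 2 <= ((k + 1) * s) ^+ 2.
    by rewrite lerXn2r ?nnegrE ?(ltW up) // mulr_ge0 ?(ltW s0) // addr_ge0.
  have h2 : ((k + 1) * s) ^+ 2 <= (t + s) ^+ 2.
    rewrite lerXn2r ?nnegrE ?addr_ge0 ?mulr_ge0 ?addr_ge0 ?(ltW s0) //.
    by rewrite mulrDl mul1r lerD2r.
  rewrite e; move: h1 h2.
  by move: (((k + 1) * s) ^+ 2) => u h1 h2; apply/andP; split; lra.
have h0 : h 0 = x by rewrite /h sqrtr0 mulr0 addr0 subr0.
rewrite -[X in _ --> X]h0; apply: cvg_at_right_filter.
apply: cvgB; first exact: cvg_cst.
apply: cvgD; last exact: cvg_id.
by apply: cvgM; [exact: cvg_cst|exact: sqrt_continuous].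
Unshelve. all: by end_near. Qed.

Lemma axis_inviscid_eigenvalues : eigenvalues alpha 0 l khat = [set 0].
Proof.
rewrite axis_eigenvalues; apply/seteqP; split=> lam /=.
  by move=> [n _ <-]; rewrite mul0r oppr0.
by move=> ->; exists 1 => //; rewrite mul0r oppr0.
Qed.

Lemma axis_inviscid_eigenfunction (n : int) (c : R[i]) : n != 0 -> c != 0 ->
  eigenfunction alpha 0 l khat 0 (shear_mode n c).
Proof.
move=> n0 c0; have := shear_mode_eigenfunction 0 n0 c0.
by rewrite mul0r oppr0.
Qed.

Lemma axis_infinite_multiplicity : infinite_multiplicity alpha 0 l khat 0.
Proof.
move=> N; exists (fun j => shear_mode j.+1%:Z 1); split=> [j|c cE j].
  by apply: axis_inviscid_eigenfunction => //; exact: oner_neq0.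
have := cE (0, j.+1%:Z); rewrite (bigD1 j) //= shear_modeE /= eqxx mulr1.
rewrite big1 ?addr0 // => i ij; rewrite shear_modeE /=.
have -> : (j.+1%:Z == i.+1%:Z) = false by apply/negP => /eqP[e]; move/eqP: ij; apply; exact: val_inj.
by rewrite mulr0.
Qed.
End ShearAxis.

Theorem theorem4p1 (R : realType) (alpha : R) (l : nat)
    (alpha_gt : 1 / 2 < alpha) (alpha_lt : alpha < 1) :
  (* decoupling *)
  (forall (nu : R) (khat : freq) (w : coeffs R), 0 <= nu -> khat != 0 ->
     linNS alpha nu (line_part khat w) = line_part khat (linNS alpha nu w)) /\
  (* 1 *)
  (forall khat : freq, outside_disc alpha khat ->
     (forall nu : R, 0 < nu -> forall lam : R[i],
        eigenvalues alpha nu l khat lam -> complex.Re lam < 0) /\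
     spectrum alpha 0 l khat = imag_segment (alpha * `|khat.1|%:~R / 2) /\
     continuous_spectrum alpha 0 l khat =
       imag_segment (alpha * `|khat.1|%:~R / 2)) /\
  (* 2 *)
  (let khat : freq := (0, 1) in
     (forall nu : R, 0 < nu ->
        spectrum alpha nu l khat =
          [set (- (nu * n%:~R ^+ 2))%:C | n in [set n : int | n != 0]] /\
        eigenvalues alpha nu l khat =
          [set (- (nu * n%:~R ^+ 2))%:C | n in [set n : int | n != 0]] /\
        (forall (lam : R[i]) (w : coeffs R), real_valued w ->
           (eigenfunction alpha nu l khat lam w <->
            exists (n : int) (c : R[i]),
              [/\ n != 0, c != 0, lam = (- (nu * n%:~R ^+ 2))%:C
                & w = shear_mode n c]))) /\
     (forall x : R, x <= 0 -> exists ev : R -> R,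
        (forall nu, 0 < nu -> eigenvalues alpha nu l khat (ev nu)%:C) /\
        ev @ 0^'+ --> x) /\
     eigenvalues alpha 0 l khat = [set 0] /\
     infinite_multiplicity alpha 0 l khat 0 /\
     (forall (n : int) (c : R[i]), n != 0 -> c != 0 ->
        eigenfunction alpha 0 l khat 0 (shear_mode n c))) /\
  (* 3 *)
  (let khat : freq := (-1, 0) in
     (* a *)
     (alpha < 95 / 100 ->
        0 < nu_lower_radicand alpha /\ nu_lower alpha < nu_upper alpha /\
        exists nus : R,
          [/\ nu_lower alpha < nus, nus < nu_upper alpha,
              critical_viscosity alpha l khat nus
            & forall nus', critical_viscosity alpha l khat nus' -> nus' = nus] /\
          exists lam : R -> R,
            positive_branch alpha l khat nus lam /\
            (forall nu1 nu2 : R, 0 < nu1 -> nu1 < nu2 -> nu2 < nus ->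
               nu2^-1 * lam nu2 < nu1^-1 * lam nu1) /\
            (alpha < 8469 / 10000 ->
               0 < lam_lower_radicand alpha /\
               (forall nu : R, 0 < nu -> nu < nus ->
                  Num.sqrt (lam_lower_radicand alpha) - nu * (alpha ^+ 2 + 1)
                    < lam nu /\
                  lam nu < Num.sqrt (lam_upper_radicand alpha)
                    - nu * alpha ^+ 2) /\
               (cvg (lam @ 0^'+) /\
                Num.sqrt (lam_lower_radicand alpha) <= lim (lam @ 0^'+) /\
                lim (lam @ 0^'+) <= Num.sqrt (lam_upper_radicand alpha)) /\
               lam =O_ (0^'+) (fun=> 1 : R))) /\
     (* b *)
     (alpha < 8469 / 10000 ->
        exists lam0 : R,
          0 < lam0 /\
          eigenvalues alpha 0 l khat = [set lam0%:C; - lam0%:C] /\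
          Num.sqrt (lam_lower_radicand alpha) < lam0 /\
          lam0 < Num.sqrt (lam_upper_radicand alpha) /\
          spectrum alpha 0 l khat `\` [set lam0%:C; - lam0%:C] =
            imag_segment (alpha / 2) /\
          continuous_spectrum alpha 0 l khat = imag_segment (alpha / 2)) /\
     (* c *)
     (alpha < 8469 / 10000 ->
        forall (nus : R) (lam : R -> R) (lam0 : R),
          critical_viscosity alpha l khat nus ->
          positive_branch alpha l khat nus lam ->
          0 < lam0 -> eigenvalues alpha 0 l khat lam0%:C ->
          lam @ 0^'+ --> lam0)) /\
  (* 4 *)
  (continuous_spectrum alpha 0 l (-1, 0) = imag_segment (alpha / 2) /\
   (\bigcup_(khat in [set khat : freq | outside_disc alpha khat])
       continuous_spectrum alpha 0 l khat)
     `|` continuous_spectrum alpha 0 l (-1, 0)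
   = [set z : R[i] | complex.Re z = 0]).
Proof.
have alpha0 := alpha_gt0 alpha_gt.
split; first by move=> nu khat w _ _; exact: linNS_line_part.
split; first by move=> khat out; exact: outside_spectra.
split.
  split; first by move=> nu nu0; split; [exact: axis_spectrum|split;
    [exact: axis_eigenvalues|move=> lam w; exact: axis_real_eigenfunction]].
  split; first by move=> x; exact: axis_eigenvalues_dense.
  split; first exact: axis_inviscid_eigenvalues.
  split; first exact: axis_infinite_multiplicity.
  by move=> n c; exact: axis_inviscid_eigenfunction.
split.
  split; first exact: shear_viscous.
  split; first exact: shear_inviscid.
  by move=> al nus lam lam0; exact: shear_inviscid_limit.
split; first exact: shear_continuous_spectrum.
apply/seteqP; split=> lam /=.
  move=> [[khat out]|]; last first.
    by rewrite shear_continuous_spectrum //; exact: imag_segment_Re.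
  by have [_ [_ ->]] := outside_spectra l alpha0 out; exact: imag_segment_Re.
move=> re0; have [khat [out seg]] := imaginary_axis_cover (complex.Im lam) alpha_gt.
left; exists khat => //; have [_ [_ ->]] := outside_spectra l alpha0 out.
by rewrite (_ : lam = (complex.Im lam)*i) //; exact: complex_ext.
Qed.
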